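(* For $c>0$ let $\theta_c=2\arctan(e^{2/c})\in(\pi/2,\pi)$, and let $F(c)=v(1)$, where $v(t)$ is the solution to the initial value problem $$ v(t)+\frac{tv'(t)}{v(t)}=1+\frac c2\log\frac{1+te^{i\theta_c}}{1-te^{i\theta_c}}, \qquad v(0)=1. $$ Then $\gamma(\mathcal{S}^* )=\pi c_0/4$, where $c_0$ is the smallest positive number such that $\operatorname{Re} F(c_0)=0$.
   Context: $\log$ is the principal branch, and $v$ is complex-valued, considered for $0\le t\le 1$. $\mathbb{D}=\{z\in\mathbb{C}:|z|<1\}$. $\mathcal{A}_1$ is the class of holomorphic functions $f$ on $\mathbb{D}$ with $f(0)=f'(0)-1=0$. A function $f\in\mathcal{A}_1$ is called starlike if $f$ maps $\mathbb{D}$ univalently onto a domain starlike with respect to the origin (equivalently, $zf'(z)/f(z)$ is holomorphic with positive real part on $\mathbb{D}$); $\mathcal{S}^*$ denotes the class of starlike functions in $\mathcal{A}_1$. For $f\in\mathcal{A}_1$ put $\varphi_f(z)=1+zf''(z)/f'(z)$, and for $\gamma\ge 0$ let $W_\gamma=\{w\in\mathbb{C}:|\operatorname{Im} w|<\gamma\}$. For a subset $\mathcal{F}$ of $\mathcal{A}_1$ define $$\gamma(\mathcal{F})=\sup\{\gamma\ge0:\ \text{for every } f\in\mathcal{A}_1,\ \varphi_f(\mathbb{D})\subset W_\gamma \text{ implies } f\in\mathcal{F}\}.$$ (The condition $\varphi_f(\mathbb{D})\subset W_\gamma$ includes that $f'$ has no zeros in $\mathbb{D}$.) The function $F$ satisfies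 $F(c)=q_c(e^{i\theta_c})$, where $q_c$ is the meromorphic solution on $\mathbb{D}$ of $q_c(z)+zq_c'(z)/q_c(z)=1+\frac c2\log\frac{1+z}{1-z}$, $q_c(0)=1$, continued meromorphically to $\overline{\mathbb{D}}\setminus\{1,-1\}$; that is, $v(t)=q_c(te^{i\theta_c})$ (values of $c$ for which $q_c$ has a pole at $e^{i\theta_c}$ do not count as zeros of $\operatorname{Re}F$). *)

(* Defs.v *)
From Stdlib Require Export Reals Lra.
From Coquelicot Require Export Coquelicot.
Open Scope R_scope.

(** Functions on a subset of the plane are total functions [C -> C]; every
    predicate below depends only on their values on (a neighbourhood of) that
    subset. Differentiability is complex: [ex_derive] over [C_AbsRing]. *)

Definition in_disk (z : C) : Prop := Cmod z < 1.

Definition cis (x : R) : C := (cos x, sin x).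

(** Principal argument, in (-PI, PI], for [z <> 0]. *)
Definition Carg (z : C) : R :=
  if Rlt_dec (Im z) 0 then - acos (Re z / Cmod z) else acos (Re z / Cmod z).

Definition Clog (z : C) : C := (ln (Cmod z), Carg z).

Definition holomorphic_at (f : C -> C) (a : C) : Prop :=
  locally a (fun z => ex_derive (f : C -> C) z).

Definition pole_at (f : C -> C) (a : C) : Prop :=
  locally' a (fun z => ex_derive (f : C -> C) z) /\
  filterlim (fun z => Cmod (f z)) (locally' a) (Rbar_locally p_infty).

(** The value that the total function takes at a pole is irrelevant. *)
Definition meromorphic_at (f : C -> C) (a : C) : Prop :=
  holomorphic_at f a \/ pole_at f a.

Definition class_A1 (f : C -> C) : Prop :=
  (forall z, in_disk z -> ex_derive (f : C -> C) z) /\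
  f 0 = 0 /\ C_derive f 0 = 1.

Definition image_disk (f : C -> C) (w : C) : Prop :=
  exists z, in_disk z /\ f z = w.

(** A domain is an open connected set; connectedness of a set containing the
    segments to the origin of all its points is automatic. *)
Definition starlike_domain (U : C -> Prop) : Prop :=
  open U /\ U 0 /\
  forall (w : C) (t : R), U w -> 0 <= t <= 1 -> U (RtoC t * w)%C.

Definition starlike (f : C -> C) : Prop :=
  class_A1 f /\
  (forall z1 z2, in_disk z1 -> in_disk z2 -> f z1 = f z2 -> z1 = z2) /\
  starlike_domain (image_disk f).

Definition phi (f : C -> C) (z : C) : C :=
  (1 + z * C_derive (C_derive f) z / C_derive f z)%C.

Definition W (gam : R) (w : C) : Prop := Rabs (Im w) < gam.

Definition phi_maps_into (f : C -> C) (gam : R) : Prop :=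
  forall z, in_disk z -> C_derive f z <> 0 /\ W gam (phi f z).

Definition gamma (calF : (C -> C) -> Prop) : Rbar :=
  Lub_Rbar (fun gam => 0 <= gam /\
    forall f, class_A1 f -> phi_maps_into f gam -> calF f).

Definition rhs (c : R) (z : C) : C :=
  (1 + RtoC (c / 2) * Clog ((1 + z) / (1 - z)))%C.

Definition theta (c : R) : R := 2 * atan (exp (2 / c)).

(** [q] is meromorphic on the closed disk without 1 and -1 (that is, near each
    of its points) and solves the equation on the disk. As an identity between
    meromorphic functions, the equation is required wherever its left-hand side
    can be evaluated pointwise: away from the poles and zeros of [q]. *)
Definition is_q (c : R) (q : C -> C) : Prop :=
  (forall z, Cmod z <= 1 -> z <> 1 -> z <> (-1)%C -> meromorphic_at q z) /\
  holomorphic_at q 0 /\ q 0 = 1 /\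
  (forall z, in_disk z -> holomorphic_at q z -> q z <> 0 ->
     (q z + z * C_derive q z / q z)%C = rhs c z).

Definition ray (c : R) (q : C -> C) (t : R) : C :=
  q (RtoC t * cis (theta c))%C.

(** [F(c)] exists and equals [w]; it does not exist when the solution has a
    pole at [cis (theta c)]. *)
Definition is_F (c : R) (w : C) : Prop :=
  exists q, is_q c q /\ holomorphic_at q (cis (theta c)) /\ w = ray c q 1.

Definition ReF_zero (c : R) : Prop := exists w, is_F c w /\ Re w = 0.

Lemma theta_bounds (c : R) : 0 < c -> PI / 2 < theta c < PI.
Proof.
intros Hc; unfold theta.
assert (H1 : 1 < exp (2 / c)).
{ rewrite <- exp_0; apply exp_increasing, Rdiv_lt_0_compat; lra. }
apply atan_increasing in H1; rewrite atan_1 in H1.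
destruct (atan_bound (exp (2 / c))); lra.
Qed.

(** [ray c q] solves the initial value problem on the radius. *)
Lemma ray_ivp (c : R) (q : C -> C) : is_q c q ->
  ray c q 0 = 1 /\
  forall t, 0 <= t < 1 ->
    holomorphic_at q (RtoC t * cis (theta c))%C -> ray c q t <> 0 ->
    exists dv : C,
      is_derive (K := R_AbsRing) (V := C_R_NormedModule) (ray c q) t dv /\
      (ray c q t + RtoC t * dv / ray c q t)%C = rhs c (RtoC t * cis (theta c))%C.
Proof.
intros (_ & _ & H0 & Hode); split.
{ unfold ray; rewrite Cmult_0_l; exact H0. }
intros t Ht Hh Hn.
set (e := cis (theta c)) in *.
assert (He : Cmod e = 1).
{ unfold e, cis, Cmod; simpl fst; simpl snd.
  replace (cos (theta c) ^ 2 + sin (theta c) ^ 2) with 1.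
  apply sqrt_1.
  generalize (sin2_cos2 (theta c)); unfold Rsqr; nra. }
assert (Hd : in_disk (RtoC t * e)%C).
{ unfold in_disk; rewrite Cmod_mult, He, Cmod_R, Rabs_pos_eq; lra. }
exists (e * C_derive q (RtoC t * e))%C; split.
- assert (Hq := C_derive_correct q (RtoC t * e)%C 0 (locally_singleton _ _ Hh)).
  split; [apply @is_linear_scal_l|].
  intros x Hx eps.
  apply (is_filter_lim_locally_unique (t:R) x) in Hx; subst x.
  destruct Hq as [_ Hq].
  specialize (Hq _ (fun P HP => HP) eps).
  destruct Hq as [d Hq].
  exists d; intros y Hy.
  assert (Hb : forall u v : R, (RtoC u * e - RtoC v * e)%C = (RtoC (u - v) * e)%C).
  { intros; rewrite RtoC_minus; ring. }
  specialize (Hq (RtoC y * e)%C).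
  lapply Hq; [clear Hq; intros Hq|].
  + change (Cmod (q (RtoC y * e) - q (RtoC t * e)
      - (RtoC y * e - RtoC t * e) * C_derive q (RtoC t * e))%C
      <= eps * Cmod (RtoC y * e - RtoC t * e)%C) in Hq.
    rewrite Hb, Cmod_mult, He, Rmult_1_r, Cmod_R in Hq.
    assert (Hnorm : forall z : C, @norm R_AbsRing C_R_NormedModule z = Cmod z).
    { intros z; unfold Cmod; rewrite <- (pow2_abs (fst z)), <- (pow2_abs (snd z)).
      reflexivity. }
    rewrite Hnorm, scal_R_Cmult.
    change (Cmod (ray c q y - ray c q t
      - RtoC (y - t) * (e * C_derive q (RtoC t * e)))%C <= eps * Rabs (y - t)).
    replace (RtoC (y - t) * (e * C_derive q (RtoC t * e)))%C
      with (RtoC (y - t) * e * C_derive q (RtoC t * e))%C by ring.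
    exact Hq.
  + change (Cmod (RtoC y * e - RtoC t * e)%C < d).
    rewrite Hb, Cmod_mult, He, Rmult_1_r, Cmod_R; exact Hy.
- unfold ray in *; fold e in Hn |- *.
  rewrite <- (Hode _ Hd Hh Hn); unfold Cdiv; ring.
Qed.

(* Main.v *)
(** Idea of the proof. For [f] with non-vanishing derivative the function
    [g = f / (z f')] solves [z g' + phi g = 1], [g 0 = 1], and [f] is starlike
    iff [Re g > 0]; if [f' = exp a], then [g] is [G a]. For [phi = rhs c] this is
    [gc c], whose reciprocal is the function [q_c] of the statement. Since
    [rhs c] maps the disk onto the strip of half-width [pi c / 4], as long as
    [Re (gc c) > 0] on the closed disk every [g] with [phi] in that strip is
    subordinate to the univalent function [gc c] (by Jack's lemma and the
    convexity of the sets [artanh (|z| < r)]), so [Re g > 0]. At the first [c]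
    where this positivity fails, [Re (gc c)] vanishes at a boundary minimum, where
    the equation forces [Re (rhs c) = 0], that is, at [cis (theta c)] or at its
    conjugate. Conversely, if [Re (gc c)] vanishes at [cis (theta c)], a small
    perturbation of [phi = rhs c] makes [Re g] negative. *)

Require Import Defs.
From Stdlib Require Import Lia Psatz Classical ClassicalEpsilon.

(** * Continuity and complex differentiability *)

(** Working with [g = f / (z f')] rather than [z f' / f] keeps the equation linear: [G a] is an
    explicit integral without poles, and [gc c z] is continuous in [c] and in [z] up to the circle,
    since the logarithmic singularities of [rhs c] at 1 and -1 are integrable. Positivity on the
    closed disk is therefore an open condition on [c]. The comparison needs an inverse of [gc c], so
    the univalence of [gc c] is first deduced from its positivity. In the coordinate [x = artanh z]
    the logarithmic derivative of [gc c] has a real part of fixed sign; on the circle this follows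
    from [|Im (1 / gc c)| <= pi c / 4], which the equation yields at a boundary maximum. The same
    sign gives the contradiction at the point supplied by Jack's lemma: the two differential
    equations displace [(phi - 1) / c] outwards along the normal of a level set of [|tanh|], while
    Schwarz's lemma keeps it inside that level set. For larger [c] the function [q_c] may have poles
    on the radius. It is identified with [1 / gc c] along the radius only, by a continuation that
    crosses poles; [F(c)] needs no more. *)

Definition cts {T : Type} (d : T -> T -> R) (S : T -> Prop) (f : T -> C) (x : T) : Prop :=
  forall eps, 0 < eps -> exists del, 0 < del /\
    forall y, S y -> d y x < del -> Cmod (f y - f x) < eps.

Definition dC (z w : C) : R := Cmod (z - w).
Definition dR (s t : R) : R := Rabs (s - t).
(** The unrestricted case of [cts]. Continuity relative to a set serves on the closed disk, outside
    which [artanh] and the functions built on it may take arbitrary values, and on parameter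
    intervals. *)
Definition everywhere {T : Type} (_ : T) : Prop := True.

Lemma Cmod_sub_sym (z w : C) : Cmod (z - w) = Cmod (w - z).
Proof. rewrite <- Cmod_opp; f_equal; ring. Qed.

Lemma Cmod_sub_triangle (x y z : C) : Cmod (x - z) <= Cmod (x - y) + Cmod (y - z).
Proof.
replace (x - z)%C with ((x - y) + (y - z))%C by ring; apply Cmod_triangle.
Qed.

Lemma Cmod_sub_le (x y : C) : Cmod x - Cmod y <= Cmod (x - y).
Proof.
assert (H := Cmod_triangle (x - y) y).
replace (x - y + y)%C with x in H by ring; lra.
Qed.

Lemma Cmod_sub_le_sum (x y : C) : Cmod (x - y) <= Cmod x + Cmod y.
Proof. rewrite <- (Cmod_opp y); apply Cmod_triangle. Qed.

Lemma Cmod_sub_self (z : C) : Cmod (z - z) = 0.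
Proof. replace (z - z)%C with (RtoC 0) by ring; apply Cmod_0. Qed.

Lemma dC_self (z : C) : dC z z = 0.
Proof. apply Cmod_sub_self. Qed.

Lemma im_le_Cmod (z : C) : Rabs (Im z) <= Cmod z.
Proof.
apply Rle_trans with (2 := Rmax_Cmod z); apply Rmax_r.
Qed.

Lemma Re_le_Cmod (z : C) : Re z <= Cmod z.
Proof. apply Rle_trans with (2 := re_le_Cmod z); apply Rle_abs. Qed.

Lemma Cmod_le_Re_Im (z : C) : Cmod z <= Rabs (Re z) + Rabs (Im z).
Proof.
destruct z as [x y]; simpl.
replace (x, y) with (RtoC x + Ci * RtoC y)%C.
2:{ unfold Ci, RtoC, Cplus, Cmult; simpl; f_equal; ring. }
apply Rle_trans with (1 := Cmod_triangle _ _).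
rewrite Cmod_mult, Cmod_Ci, !Cmod_R; lra.
Qed.

Lemma C_ext (z w : C) : Re z = Re w -> Im z = Im w -> z = w.
Proof. destruct z, w; simpl; intros -> ->; reflexivity. Qed.

Lemma re_minus (z w : C) : Re (z - w) = Re z - Re w.
Proof. reflexivity. Qed.
Lemma im_minus (z w : C) : Im (z - w) = Im z - Im w.
Proof. reflexivity. Qed.

Lemma Cmod_sqr (z : C) : Cmod z * Cmod z = Re z * Re z + Im z * Im z.
Proof. generalize (Cmod2_alt z); simpl; lra. Qed.

Section Continuity.
Context {T : Type} (d : T -> T -> R) (S : T -> Prop).
Implicit Types f g : T -> C.

Lemma cts_const (a : C) x : cts d S (fun _ => a) x.
Proof.
intros e He; exists 1; split; [lra|]; intros.
rewrite Cmod_sub_self; lra.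
Qed.

Lemma cts_plus f g x : cts d S f x -> cts d S g x -> cts d S (fun y => f y + g y)%C x.
Proof.
intros Hf Hg e He.
destruct (Hf (e / 2)) as (d1 & D1 & H1); [lra|].
destruct (Hg (e / 2)) as (d2 & D2 & H2); [lra|].
exists (Rmin d1 d2); split; [now apply Rmin_pos|]; intros y Sy Hy.
assert (A1 := H1 y Sy (Rlt_le_trans _ _ _ Hy (Rmin_l _ _))).
assert (A2 := H2 y Sy (Rlt_le_trans _ _ _ Hy (Rmin_r _ _))).
replace (f y + g y - (f x + g x))%C with ((f y - f x) + (g y - g x))%C by ring.
assert (A := Cmod_triangle (f y - f x) (g y - g x)); lra.
Qed.

Lemma cts_mult f g x : cts d S f x -> cts d S g x -> cts d S (fun y => f y * g y)%C x.
Proof.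
intros Hf Hg e He.
set (M := 1 + Cmod (f x) + Cmod (g x)).
assert (P1 := Cmod_ge_0 (f x)); assert (P2 := Cmod_ge_0 (g x)).
assert (HM : 0 < M) by (unfold M; lra).
assert (Hq : 0 < e / (2 * M)) by (apply Rdiv_lt_0_compat; lra).
destruct (Hf (Rmin 1 (e / (2 * M)))) as (d1 & D1 & H1); [apply Rmin_pos; lra|].
destruct (Hg (e / (2 * M))) as (d2 & D2 & H2); [lra|].
exists (Rmin d1 d2); split; [now apply Rmin_pos|]; intros y Sy Hy.
assert (A1 := H1 y Sy (Rlt_le_trans _ _ _ Hy (Rmin_l _ _))).
assert (A2 := H2 y Sy (Rlt_le_trans _ _ _ Hy (Rmin_r _ _))).
assert (A3 := Rlt_le_trans _ _ _ A1 (Rmin_l _ _)).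
assert (A4 := Rlt_le_trans _ _ _ A1 (Rmin_r _ _)).
replace (f y * g y - f x * g x)%C
  with ((f y - f x) * g x + f y * (g y - g x))%C by ring.
apply Rle_lt_trans with (1 := Cmod_triangle _ _); rewrite !Cmod_mult.
assert (A5 := Cmod_sub_le (f y) (f x)).
assert (A6 : Cmod (f y) <= M) by (unfold M; lra).
assert (A7 : Cmod (g x) <= M) by (unfold M; lra).
assert (B1 : Cmod (f y - f x) * Cmod (g x) <= e / (2 * M) * M).
{ apply Rmult_le_compat; try apply Cmod_ge_0; lra. }
assert (B2 : Cmod (f y) * Cmod (g y - g x) < M * (e / (2 * M))).
{ apply Rle_lt_trans with (M * Cmod (g y - g x)).
  - apply Rmult_le_compat_r; [apply Cmod_ge_0|lra].
  - apply Rmult_lt_compat_l; lra. }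
replace (e / (2 * M) * M) with (e / 2) in B1 by (field; lra).
replace (M * (e / (2 * M))) with (e / 2) in B2 by (field; lra).
lra.
Qed.

Lemma cts_opp f x : cts d S f x -> cts d S (fun y => - f y)%C x.
Proof.
intros Hf e He; destruct (Hf e He) as (d1 & D1 & H1).
exists d1; split; [easy|]; intros y Sy Hy.
replace (- f y - - f x)%C with (- (f y - f x))%C by ring.
rewrite Cmod_opp; auto.
Qed.

Lemma cts_minus f g x : cts d S f x -> cts d S g x -> cts d S (fun y => f y - g y)%C x.
Proof. intros; apply cts_plus; [easy|]; now apply cts_opp. Qed.

Lemma cts_scal (a : C) f x : cts d S f x -> cts d S (fun y => a * f y)%C x.
Proof. intros; apply cts_mult; [apply cts_const|easy]. Qed.

Lemma cts_comp (V : C -> Prop) (h : C -> C) f x :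
  (forall y, S y -> V (f y)) -> cts d S f x -> cts dC V h (f x) ->
  cts d S (fun y => h (f y)) x.
Proof.
intros HV Hf Hh e He.
destruct (Hh e He) as (d1 & D1 & H1).
destruct (Hf d1 D1) as (d2 & D2 & H2).
exists d2; split; [easy|]; intros y Sy Hy.
apply H1; [now apply HV|]; unfold dC; auto.
Qed.

Lemma cts_ext f g x :
  (forall y, S y -> f y = g y) -> f x = g x -> cts d S f x -> cts d S g x.
Proof.
intros E Ex Hf e He; destruct (Hf e He) as (d1 & D1 & H1).
exists d1; split; [easy|]; intros y Sy Hy.
rewrite <- E, <- Ex; auto.
Qed.

Lemma cts_Cmod f x : cts d S f x -> cts d S (fun y => RtoC (Cmod (f y))) x.
Proof.
intros Hf e He; destruct (Hf e He) as (d1 & D1 & H1).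
exists d1; split; [easy|]; intros y Sy Hy.
apply Rle_lt_trans with (2 := H1 y Sy Hy).
rewrite <- RtoC_minus, Cmod_R.
assert (A1 := Cmod_sub_le (f y) (f x)).
assert (A2 := Cmod_sub_le (f x) (f y)); rewrite (Cmod_sub_sym (f x)) in A2.
apply Rabs_le; lra.
Qed.

Lemma cts_Re f x : cts d S f x -> cts d S (fun y => RtoC (Re (f y))) x.
Proof.
intros Hf e He; destruct (Hf e He) as (d1 & D1 & H1).
exists d1; split; [easy|]; intros y Sy Hy.
apply Rle_lt_trans with (2 := H1 y Sy Hy).
rewrite <- RtoC_minus, Cmod_R, <- re_minus; apply re_le_Cmod.
Qed.

Lemma cts_Im f x : cts d S f x -> cts d S (fun y => RtoC (Im (f y))) x.
Proof.
intros Hf e He; destruct (Hf e He) as (d1 & D1 & H1).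
exists d1; split; [easy|]; intros y Sy Hy.
apply Rle_lt_trans with (2 := H1 y Sy Hy).
rewrite <- RtoC_minus, Cmod_R, <- im_minus; apply im_le_Cmod.
Qed.

End Continuity.

Lemma cts_sub {T} (d : T -> T -> R) (S S' : T -> Prop) f x :
  (forall y, S' y -> S y) -> cts d S f x -> cts d S' f x.
Proof.
intros H Hf e He; destruct (Hf e He) as (d1 & D1 & H1).
exists d1; split; [easy|]; auto.
Qed.

Lemma cts_id (S : C -> Prop) z : cts dC S (fun w => w) z.
Proof. intros e He; exists e; split; [easy|]; auto. Qed.

Lemma cts_RtoC (S : R -> Prop) t : cts dR S (fun s => RtoC s) t.
Proof.
intros e He; exists e; split; [easy|]; intros y _ Hy.
now rewrite <- RtoC_minus, Cmod_R.
Qed.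

Lemma cts_loc (S : C -> Prop) (f : C -> C) z r :
  0 < r -> cts dC (fun w => S w /\ Cmod (w - z) < r) f z -> cts dC S f z.
Proof.
intros Hr Hf e He; destruct (Hf e He) as (d1 & D1 & H1).
exists (Rmin d1 r); split; [now apply Rmin_pos|]; intros y Sy Hy.
assert (A1 := Rlt_le_trans _ _ _ Hy (Rmin_l _ _)).
assert (A2 := Rlt_le_trans _ _ _ Hy (Rmin_r _ _)).
apply H1; auto.
Qed.

Lemma cts_inv (S : C -> Prop) (z : C) : z <> 0 -> cts dC S Cinv z.
Proof.
intros Hz e He.
assert (Pz := proj1 (Cmod_gt_0 z) Hz).
assert (Hd : 0 < e * (Cmod z * Cmod z) / 2).
{ apply Rdiv_lt_0_compat; [|lra]; apply Rmult_lt_0_compat; [lra|].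
  now apply Rmult_lt_0_compat. }
exists (Rmin (Cmod z / 2) (e * (Cmod z * Cmod z) / 2)); split.
{ apply Rmin_pos; lra. }
intros w _ Hw; unfold dC in Hw.
assert (A1 := Rlt_le_trans _ _ _ Hw (Rmin_l _ _)).
assert (A2 := Rlt_le_trans _ _ _ Hw (Rmin_r _ _)).
assert (A3 := Cmod_sub_le z w); rewrite Cmod_sub_sym in A3.
assert (Pw : Cmod z / 2 < Cmod w) by lra.
assert (Hw0 : w <> 0) by (apply Cmod_gt_0; lra).
replace (/ w - / z)%C with (- (w - z) * / (w * z))%C by (field; auto).
rewrite Cmod_mult, Cmod_opp, Cmod_inv by (now apply Cmult_neq_0).
rewrite Cmod_mult.
apply Rmult_lt_reg_r with (Cmod w * Cmod z); [nra|].
rewrite Rmult_assoc, Rinv_l, Rmult_1_r by nra.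
apply Rlt_trans with (1 := A2).
assert (B : Cmod z * Cmod z / 2 < Cmod w * Cmod z) by nra.
nra.
Qed.

Lemma cts_Cinv {T} (d : T -> T -> R) S (f : T -> C) x :
  f x <> 0 -> cts d S f x -> cts d S (fun y => / f y)%C x.
Proof.
intros H Hf; apply (cts_comp d S (fun _ => True) Cinv f x); auto.
now apply cts_inv.
Qed.

Lemma cts_div {T} (d : T -> T -> R) S (f g : T -> C) x :
  g x <> 0 -> cts d S f x -> cts d S g x -> cts d S (fun y => f y / g y)%C x.
Proof. intros; apply cts_mult; [easy|]; now apply cts_Cinv. Qed.

(** * Complex derivatives by slopes *)

Definition cder (f : C -> C) (z d : C) : Prop :=
  forall eps, 0 < eps -> exists del, 0 < del /\
    forall w, Cmod (w - z) < del ->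
      Cmod (f w - f z - d * (w - z)) <= eps * Cmod (w - z).

Definition cdiff (f : C -> C) (z : C) : Prop := exists d, cder f z d.

Definition hol (V : C -> Prop) (f : C -> C) : Prop := forall z, V z -> cdiff f z.

Lemma is_derive_cder (f : C -> C) (z d : C) :
  is_derive (K := C_AbsRing) (V := C_NormedModule) f z d <-> cder f z d.
Proof.
split.
- intros [_ H] e He.
  specialize (H z (fun P HP => HP) (mkposreal e He)).
  destruct H as [dl Hd]; exists dl; split; [apply cond_pos|]; intros w Hw.
  specialize (Hd w Hw).
  change (Cmod (f w - f z - (w - z) * d)%C <= e * Cmod (w - z)%C) in Hd.
  replace (d * (w - z))%C with ((w - z) * d)%C by ring; exact Hd.
- intros H; split; [apply @is_linear_scal_l|].
  intros x Hx eps.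
  apply (is_filter_lim_locally_unique (V := AbsRing_NormedModule C_AbsRing) z x) in Hx; subst x.
  destruct (H eps (cond_pos eps)) as (dl & D & Hd).
  exists (mkposreal dl D); intros w Hw; specialize (Hd w Hw).
  change (Cmod (f w - f z - (w - z) * d)%C <= eps * Cmod (w - z)%C).
  replace ((w - z) * d)%C with (d * (w - z))%C by ring; exact Hd.
Qed.

Lemma cder_C_derive f z d : cder f z d -> C_derive f z = d.
Proof. intros H; apply is_C_derive_unique; now apply is_derive_cder. Qed.

Lemma cder_unique f z d d' : cder f z d -> cder f z d' -> d = d'.
Proof. intros H H'; rewrite <- (cder_C_derive _ _ _ H); now apply cder_C_derive. Qed.

Lemma cdiff_cder f z : cdiff f z -> cder f z (C_derive f z).
Proof. intros [d H]; now rewrite (cder_C_derive _ _ _ H). Qed.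

Lemma ex_derive_cdiff (f : C -> C) (z : C) :
  ex_derive (K := C_AbsRing) (V := C_NormedModule) f z <-> cdiff f z.
Proof.
split; intros [d H]; exists d; now apply is_derive_cder.
Qed.

Lemma locally_ball (z : C) (P : C -> Prop) :
  locally z P <-> exists r, 0 < r /\ forall w, Cmod (w - z) < r -> P w.
Proof.
split.
- intros H; apply locally_C in H; destruct H as [r H].
  exists r; split; [apply cond_pos|]; intros w Hw; apply H; exact Hw.
- intros (r & Hr & H); apply locally_C.
  exists (mkposreal r Hr); intros w Hw; apply H; exact Hw.
Qed.

(** The difference quotient with a prescribed value at [z]. Differentiation rules become identities
    between slopes; with the derivative as that value, it is the quotient with its singularity
    removed that underlies Cauchy's formula, Schwarz's lemma and [kappa]. *)
Definition cslope (f : C -> C) (z d w : C) : C :=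
  if Ceq_dec w z then d else ((f w - f z) / (w - z))%C.

Lemma cslope_self f z d : cslope f z d z = d.
Proof. unfold cslope; destruct (Ceq_dec z z); congruence. Qed.

Lemma cslope_eq f z d w : (f w - f z = cslope f z d w * (w - z))%C.
Proof.
unfold cslope; destruct (Ceq_dec w z) as [->|N]; [ring|].
field; intros E; apply N; now apply Ceq_minus.
Qed.

(* Caratheodory: differentiability is continuity of the slope. *)
Lemma cslope_cts f z d : cder f z d <-> cts dC everywhere (cslope f z d) z.
Proof.
split; intros H e He.
- destruct (H (e / 2)) as (dl & D & Hd); [lra|].
  exists dl; split; [easy|]; intros w _ Hw; rewrite cslope_self.
  unfold cslope; destruct (Ceq_dec w z) as [->|N].
  { rewrite Cmod_sub_self; lra. }
  assert (N' : (w - z)%C <> 0) by (intros E; apply N; now apply Ceq_minus).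
  assert (P := proj1 (Cmod_gt_0 _) N').
  specialize (Hd w Hw).
  replace ((f w - f z) / (w - z) - d)%C
    with ((f w - f z - d * (w - z)) / (w - z))%C by (field; auto).
  rewrite Cmod_div by auto.
  apply Rmult_lt_reg_r with (Cmod (w - z)); [easy|].
  unfold Rdiv; rewrite Rmult_assoc, Rinv_l by lra; nra.
- destruct (H e He) as (dl & D & Hd).
  exists dl; split; [easy|]; intros w Hw.
  specialize (Hd w I Hw); rewrite cslope_self in Hd.
  rewrite cslope_eq with (d := d).
  replace (cslope f z d w * (w - z) - d * (w - z))%C
    with ((cslope f z d w - d) * (w - z))%C by ring.
  rewrite Cmod_mult; apply Rmult_le_compat_r; [apply Cmod_ge_0|lra].
Qed.

Lemma cder_of_slope (f s : C -> C) z :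
  (forall w, f w - f z = s w * (w - z))%C -> cts dC everywhere s z -> cder f z (s z).
Proof.
intros E Hs; apply cslope_cts.
apply cts_ext with (f := s); auto.
- intros w _; unfold cslope; destruct (Ceq_dec w z) as [->|N]; [easy|].
  rewrite E; field; intros E'; apply N; now apply Ceq_minus.
- now rewrite cslope_self.
Qed.

Lemma cder_cts f z d S : cder f z d -> cts dC S f z.
Proof.
intros H; apply cslope_cts in H; apply cts_sub with everywhere; [easy|].
apply cts_ext with (f := fun w => (f z + cslope f z d w * (w - z))%C).
- intros w _; rewrite <- cslope_eq; ring.
- rewrite <- cslope_eq; ring.
- apply cts_plus; [apply cts_const|].
  apply cts_mult; [easy|]; apply cts_minus; [apply cts_id|apply cts_const].
Qed.

Lemma cdiff_cts f z S : cdiff f z -> cts dC S f z.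
Proof. intros [d H]; now apply cder_cts with d. Qed.

Lemma cder_const a z : cder (fun _ => a) z 0.
Proof.
apply (cder_of_slope (fun _ => a) (fun _ => RtoC 0)); [intros; ring|apply cts_const].
Qed.

Lemma cder_id z : cder (fun w => w) z 1.
Proof.
apply (cder_of_slope (fun w => w) (fun _ => RtoC 1)); [intros; ring|apply cts_const].
Qed.

Lemma cder_plus f g z a b :
  cder f z a -> cder g z b -> cder (fun w => f w + g w)%C z (a + b).
Proof.
intros Hf Hg; apply cslope_cts in Hf; apply cslope_cts in Hg.
set (s := fun w => (cslope f z a w + cslope g z b w)%C).
replace (a + b)%C with (s z) by (unfold s; now rewrite !cslope_self).
apply cder_of_slope; [|now apply cts_plus].
intros w; unfold s.
replace (f w + g w - (f z + g z))%C with ((f w - f z) + (g w - g z))%C by ring.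
rewrite (cslope_eq f z a), (cslope_eq g z b); ring.
Qed.

Lemma cder_mult f g z a b :
  cder f z a -> cder g z b -> cder (fun w => f w * g w)%C z (a * g z + f z * b).
Proof.
intros Hf Hg; assert (Cg := cder_cts g z b everywhere Hg).
apply cslope_cts in Hf; apply cslope_cts in Hg.
set (s := fun w => (cslope f z a w * g w + f z * cslope g z b w)%C).
replace (a * g z + f z * b)%C with (s z) by (unfold s; now rewrite !cslope_self).
apply cder_of_slope.
- intros w; unfold s.
  replace (f w * g w - f z * g z)%C
    with ((f w - f z) * g w + f z * (g w - g z))%C by ring.
  rewrite (cslope_eq f z a), (cslope_eq g z b); ring.
- apply cts_plus; [now apply cts_mult|now apply cts_scal].
Qed.

Lemma cder_scal f z a k : cder f z a -> cder (fun w => k * f w)%C z (k * a).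
Proof.
intros Hf; replace (k * a)%C with (0 * f z + k * a)%C by ring.
apply (cder_mult (fun _ => k) f); [apply cder_const|easy].
Qed.

Lemma cder_opp f z a : cder f z a -> cder (fun w => - f w)%C z (- a).
Proof.
intros Hf; apply (cder_scal _ _ _ (-(1))%C) in Hf.
intros e He; destruct (Hf e He) as (dl & D & H); exists dl; split; [easy|].
intros w Hw; specialize (H w Hw).
replace (- f w - - f z - - a * (w - z))%C
  with (- (1) * f w - - (1) * f z - - (1) * a * (w - z))%C by ring; exact H.
Qed.

Lemma cder_minus f g z a b :
  cder f z a -> cder g z b -> cder (fun w => f w - g w)%C z (a - b).
Proof. intros Hf Hg; apply cder_plus; [easy|]; now apply cder_opp. Qed.

Lemma cder_comp (f g : C -> C) z a b :
  cder f (g z) a -> cder g z b -> cder (fun w => f (g w)) z (a * b).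
Proof.
intros Hf Hg; assert (Cg := cder_cts g z b everywhere Hg).
apply cslope_cts in Hf; apply cslope_cts in Hg.
set (s := fun w => (cslope f (g z) a (g w) * cslope g z b w)%C).
replace (a * b)%C with (s z) by (unfold s; now rewrite !cslope_self).
apply cder_of_slope.
- intros w; unfold s.
  rewrite (cslope_eq f (g z) a), (cslope_eq g z b); ring.
- apply cts_mult; [|easy].
  apply (cts_comp dC everywhere everywhere (cslope f (g z) a) g); auto.
Qed.

Lemma cder_inv (z : C) : z <> 0 -> cder Cinv z (- / (z * z)).
Proof.
intros Hz.
assert (P := proj1 (Cmod_gt_0 _) Hz).
assert (Hc : cts dC everywhere (fun w => - / (w * z))%C z).
{ apply cts_opp, cts_Cinv; [now apply Cmult_neq_0|].
  apply cts_mult; [apply cts_id|apply cts_const]. }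
intros e He; destruct (Hc e He) as (dl & D & H).
exists (Rmin dl (Cmod z)); split; [now apply Rmin_pos|]; intros w Hw.
assert (A1 := Rlt_le_trans _ _ _ Hw (Rmin_l _ _)).
assert (A2 := Rlt_le_trans _ _ _ Hw (Rmin_r _ _)).
assert (Hw0 : w <> 0).
{ intros ->; replace (0 - z)%C with (- z)%C in A2 by ring.
  rewrite Cmod_opp in A2; lra. }
replace (/ w - / z - - / (z * z) * (w - z))%C
  with ((- / (w * z) - - / (z * z)) * (w - z))%C by (field; auto).
rewrite Cmod_mult; apply Rmult_le_compat_r; [apply Cmod_ge_0|].
left; now apply (H w I).
Qed.

Lemma cder_Cinv (f : C -> C) z a : f z <> 0 -> cder f z a ->
  cder (fun w => / f w)%C z (- a / (f z * f z)).
Proof.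
intros Hz Hf.
replace (- a / (f z * f z))%C with (- / (f z * f z) * a)%C by (field; auto).
apply (cder_comp Cinv f); [now apply cder_inv|easy].
Qed.

Lemma cder_div (f g : C -> C) z a b : g z <> 0 -> cder f z a -> cder g z b ->
  cder (fun w => f w / g w)%C z ((a * g z - f z * b) / (g z * g z)).
Proof.
intros Hz Hf Hg.
replace ((a * g z - f z * b) / (g z * g z))%C
  with (a * / g z + f z * (- b / (g z * g z)))%C by (field; auto).
apply (cder_mult f (fun w => / g w)%C); [easy|now apply cder_Cinv].
Qed.

Lemma cder_ext_loc f g z a r : 0 < r ->
  (forall w, Cmod (w - z) < r -> f w = g w) -> cder f z a -> cder g z a.
Proof.
intros Hr E Hf e He; destruct (Hf e He) as (dl & D & H).
exists (Rmin dl r); split; [now apply Rmin_pos|]; intros w Hw.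
assert (A1 := Rlt_le_trans _ _ _ Hw (Rmin_l _ _)).
assert (A2 := Rlt_le_trans _ _ _ Hw (Rmin_r _ _)).
rewrite <- (E w A2), <- (E z) by (rewrite Cmod_sub_self; lra); auto.
Qed.

Lemma cder_eq f z a b : cder f z a -> a = b -> cder f z b.
Proof. now intros H <-. Qed.

Lemma cdiff_const a z : cdiff (fun _ => a) z.
Proof. eexists; apply cder_const. Qed.
Lemma cdiff_id z : cdiff (fun w => w) z.
Proof. eexists; apply cder_id. Qed.
Lemma cdiff_plus f g z : cdiff f z -> cdiff g z -> cdiff (fun w => f w + g w)%C z.
Proof. intros [a Ha] [b Hb]; eexists; eapply cder_plus; eauto. Qed.
Lemma cdiff_minus f g z : cdiff f z -> cdiff g z -> cdiff (fun w => f w - g w)%C z.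
Proof. intros [a Ha] [b Hb]; eexists; eapply cder_minus; eauto. Qed.
Lemma cdiff_opp f z : cdiff f z -> cdiff (fun w => - f w)%C z.
Proof. intros [a Ha]; eexists; eapply cder_opp; eauto. Qed.
Lemma cdiff_mult f g z : cdiff f z -> cdiff g z -> cdiff (fun w => f w * g w)%C z.
Proof. intros [a Ha] [b Hb]; eexists; eapply cder_mult; eauto. Qed.
Lemma cdiff_scal f z k : cdiff f z -> cdiff (fun w => k * f w)%C z.
Proof. intros [a Ha]; eexists; eapply cder_scal; eauto. Qed.
Lemma cdiff_comp (f g : C -> C) z :
  cdiff f (g z) -> cdiff g z -> cdiff (fun w => f (g w)) z.
Proof. intros [a Ha] [b Hb]; eexists; eapply cder_comp; eauto. Qed.
Lemma cdiff_div (f g : C -> C) z : g z <> 0 -> cdiff f z -> cdiff g z ->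
  cdiff (fun w => f w / g w)%C z.
Proof. intros N [a Ha] [b Hb]; eexists; eapply cder_div; eauto. Qed.
Lemma cdiff_ext_loc f g z r : 0 < r ->
  (forall w, Cmod (w - z) < r -> f w = g w) -> cdiff f z -> cdiff g z.
Proof. intros Hr E [a Ha]; exists a; eapply cder_ext_loc; eauto. Qed.

Definition openC (V : C -> Prop) : Prop :=
  forall z, V z -> exists r, 0 < r /\ forall w, Cmod (w - z) < r -> V w.

Lemma in_disk_open : openC in_disk.
Proof.
intros z Hz; exists (1 - Cmod z); split; [unfold in_disk in Hz; lra|].
intros w Hw; unfold in_disk; assert (A := Cmod_sub_le w z); lra.
Qed.

Lemma holomorphic_at_ball f z : holomorphic_at f z <->
  exists r, 0 < r /\ forall w, Cmod (w - z) < r -> cdiff f w.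
Proof.
unfold holomorphic_at; rewrite locally_ball.
split; intros (r & Hr & H); exists r; split; try exact Hr; intros w Hw.
- apply ex_derive_cdiff; exact (H w Hw).
- apply ex_derive_cdiff; exact (H w Hw).
Qed.

(** * Curves, integrals and compactness *)

Definition rder (g : R -> C) (t : R) (d : C) : Prop :=
  is_derive (fun s => Re (g s)) t (Re d) /\ is_derive (fun s => Im (g s)) t (Im d).

Lemma is_derive_eps (f : R -> R) t d : is_derive f t d <->
  forall eps, 0 < eps -> exists del, 0 < del /\ forall s, Rabs (s - t) < del ->
    Rabs (f s - f t - d * (s - t)) <= eps * Rabs (s - t).
Proof.
split.
- intros [_ H] e He.
  destruct (H t (fun P HP => HP) (mkposreal e He)) as [dl Hd].
  exists dl; split; [apply cond_pos|]; intros s Hs; specialize (Hd s Hs).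
  change (Rabs (f s - f t - (s - t) * d) <= e * Rabs (s - t)) in Hd.
  rewrite (Rmult_comm d); exact Hd.
- intros H; split; [apply @is_linear_scal_l|].
  intros x Hx eps.
  apply (is_filter_lim_locally_unique (t : R_NormedModule) x) in Hx; subst x.
  destruct (H eps (cond_pos eps)) as (dl & D & Hd).
  exists (mkposreal dl D); intros s Hs; specialize (Hd s Hs).
  change (Rabs (f s - f t - (s - t) * d) <= eps * Rabs (s - t)).
  rewrite (Rmult_comm (s - t)); exact Hd.
Qed.

Lemma rder_eps (g : R -> C) t d : rder g t d <->
  forall eps, 0 < eps -> exists del, 0 < del /\ forall s, Rabs (s - t) < del ->
    Cmod (g s - g t - d * RtoC (s - t)) <= eps * Rabs (s - t).
Proof.
unfold rder; rewrite !is_derive_eps; split.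
- intros [H1 H2] e He.
  destruct (H1 (e / 2)) as (d1 & D1 & H1'); [lra|].
  destruct (H2 (e / 2)) as (d2 & D2 & H2'); [lra|].
  exists (Rmin d1 d2); split; [now apply Rmin_pos|]; intros s Hs.
  specialize (H1' s (Rlt_le_trans _ _ _ Hs (Rmin_l _ _))).
  specialize (H2' s (Rlt_le_trans _ _ _ Hs (Rmin_r _ _))).
  apply Rle_trans with (1 := Cmod_le_Re_Im _).
  replace (Re (g s - g t - d * RtoC (s - t)))
    with (Re (g s) - Re (g t) - Re d * (s - t)).
  2:{ rewrite !re_minus, re_mult, re_RtoC, im_RtoC; ring. }
  replace (Im (g s - g t - d * RtoC (s - t)))
    with (Im (g s) - Im (g t) - Im d * (s - t)).
  2:{ rewrite !im_minus, im_mult, re_RtoC, im_RtoC; ring. }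
  lra.
- intros H; split; intros e He; destruct (H e He) as (dl & D & Hd);
    exists dl; split; auto; intros s Hs; specialize (Hd s Hs);
    apply Rle_trans with (2 := Hd).
  + replace (Re (g s) - Re (g t) - Re d * (s - t))
      with (Re (g s - g t - d * RtoC (s - t))); [apply re_le_Cmod|].
    rewrite !re_minus, re_mult, re_RtoC, im_RtoC; ring.
  + replace (Im (g s) - Im (g t) - Im d * (s - t))
      with (Im (g s - g t - d * RtoC (s - t))); [apply im_le_Cmod|].
    rewrite !im_minus, im_mult, re_RtoC, im_RtoC; ring.
Qed.

Lemma rder_cts g t d S : rder g t d -> cts dR S g t.
Proof.
rewrite rder_eps; intros H e He.
destruct (H 1) as (d1 & D1 & H1); [lra|].
set (M := 2 + Cmod d); assert (P := Cmod_ge_0 d).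
assert (HM : 0 < M) by (unfold M; lra).
exists (Rmin d1 (e / M)); split.
{ apply Rmin_pos; [easy|]; now apply Rdiv_lt_0_compat. }
intros s _ Hs; unfold dR in Hs.
specialize (H1 s (Rlt_le_trans _ _ _ Hs (Rmin_l _ _))).
assert (A := Rlt_le_trans _ _ _ Hs (Rmin_r _ _)).
replace (g s - g t)%C with ((g s - g t - d * RtoC (s - t)) + d * RtoC (s - t))%C by ring.
apply Rle_lt_trans with (1 := Cmod_triangle _ _).
rewrite Cmod_mult, Cmod_R.
apply Rle_lt_trans with (M * Rabs (s - t)).
{ assert (Q := Rabs_pos (s - t)); unfold M; nra. }
apply Rmult_lt_compat_l with (r := M) in A; [|easy].
replace (M * (e / M)) with e in A by (field; lra); exact A.
Qed.

Lemma rder_comp (f : C -> C) g t a b :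
  cder f (g t) a -> rder g t b -> rder (fun s => f (g s)) t (a * b).
Proof.
intros Hf Hg; assert (Cg := rder_cts g t b everywhere Hg).
apply cslope_cts in Hf.
assert (Cs : cts dR everywhere (fun s => cslope f (g t) a (g s)) t)
  by (apply (cts_comp dR everywhere everywhere (cslope f (g t) a) g); auto).
apply rder_eps; intros e He; rewrite rder_eps in Hg.
assert (Pa := Cmod_ge_0 a); assert (Pb := Cmod_ge_0 b).
set (M := Cmod a + Cmod b + 2).
assert (HM : 0 < M) by (unfold M; lra).
set (q := Rmin 1 (e / M)).
assert (Hq : 0 < q) by (apply Rmin_pos; [lra|]; now apply Rdiv_lt_0_compat).
assert (Hq1 : q <= 1) by apply Rmin_l.
assert (Hq2 : q * M <= e).
{ apply Rle_trans with (e / M * M); [|right; field; lra].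
  apply Rmult_le_compat_r; [lra|apply Rmin_r]. }
destruct (Hg q Hq) as (d1 & D1 & H1).
destruct (Cs q Hq) as (d2 & D2 & H2).
exists (Rmin d1 d2); split; [now apply Rmin_pos|]; intros s Hs.
specialize (H1 s (Rlt_le_trans _ _ _ Hs (Rmin_l _ _))).
specialize (H2 s I (Rlt_le_trans _ _ _ Hs (Rmin_r _ _))).
rewrite cslope_self in H2.
rewrite (cslope_eq f (g t) a).
set (k := cslope f (g t) a (g s)) in *.
replace (k * (g s - g t) - a * b * RtoC (s - t))%C
  with (k * (g s - g t - b * RtoC (s - t)) + (k - a) * (b * RtoC (s - t)))%C by ring.
apply Rle_trans with (1 := Cmod_triangle _ _).
rewrite !Cmod_mult, Cmod_R.
assert (A := Cmod_sub_le k a).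
assert (Q := Rabs_pos (s - t)).
assert (K1 : Cmod k <= Cmod a + 1) by lra.
assert (K2 : Cmod k * Cmod (g s - g t - b * RtoC (s - t))
   <= (Cmod a + 1) * (q * Rabs (s - t))).
{ apply Rmult_le_compat; try apply Cmod_ge_0; lra. }
assert (K3 : Cmod (k - a) * (Cmod b * Rabs (s - t)) <= q * (Cmod b * Rabs (s - t))).
{ apply Rmult_le_compat_r; [now apply Rmult_le_pos|lra]. }
apply Rle_trans with (q * M * Rabs (s - t)); [unfold M; nra|].
now apply Rmult_le_compat_r.
Qed.

Lemma rder_eq g t a b : rder g t a -> a = b -> rder g t b.
Proof. now intros H <-. Qed.

Lemma rder_const a t : rder (fun _ => a) t 0.
Proof. split; apply @is_derive_const. Qed.

Lemma rder_RtoC (f : R -> R) t d : is_derive f t d -> rder (fun s => RtoC (f s)) t d.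
Proof. intros H; split; simpl; [exact H|apply @is_derive_const]. Qed.

Lemma rder_id t : rder (fun s => RtoC s) t 1.
Proof. apply (rder_RtoC (fun s => s)); apply @is_derive_id. Qed.

Lemma rder_plus f g t a b :
  rder f t a -> rder g t b -> rder (fun s => f s + g s)%C t (a + b).
Proof.
intros [H1 H2] [H3 H4]; split.
- apply (is_derive_plus (fun s => Re (f s)) (fun s => Re (g s))); easy.
- apply (is_derive_plus (fun s => Im (f s)) (fun s => Im (g s))); easy.
Qed.

Lemma rder_mult f g t a b :
  rder f t a -> rder g t b -> rder (fun s => f s * g s)%C t (a * g t + f t * b).
Proof.
intros [H1 H2] [H3 H4]; split.
- apply (is_derive_ext (fun s => Re (f s) * Re (g s) - Im (f s) * Im (g s))); [easy|].
  replace (Re (a * g t + f t * b))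
    with ((Re a * Re (g t) + Re (f t) * Re b) - (Im a * Im (g t) + Im (f t) * Im b))
    by (rewrite re_plus, !re_mult; ring).
  apply (is_derive_minus (fun s => Re (f s) * Re (g s)) (fun s => Im (f s) * Im (g s)));
    apply @is_derive_mult; auto; intros; apply Rmult_comm.
- apply (is_derive_ext (fun s => Re (f s) * Im (g s) + Im (f s) * Re (g s))); [easy|].
  replace (Im (a * g t + f t * b))
    with ((Re a * Im (g t) + Re (f t) * Im b) + (Im a * Re (g t) + Im (f t) * Re b))
    by (rewrite im_plus, !im_mult; ring).
  apply (is_derive_plus (fun s => Re (f s) * Im (g s)) (fun s => Im (f s) * Re (g s)));
    apply @is_derive_mult; auto; intros; apply Rmult_comm.
Qed.

Lemma rder_line p v t : rder (fun s => p + RtoC s * v)%C t v.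
Proof.
apply (rder_eq _ _ (0 + (1 * v + RtoC t * 0))%C); [|ring].
apply rder_plus; [apply rder_const|].
apply rder_mult; [apply rder_id|apply rder_const].
Qed.

Lemma rder_ray z t : rder (fun s => RtoC s * z)%C t z.
Proof.
apply (rder_eq _ _ (1 * z + RtoC t * 0)%C); [|ring].
apply rder_mult; [apply rder_id|apply rder_const].
Qed.

Lemma rder_cis t : rder cis t (Ci * cis t).
Proof.
split.
- apply (is_derive_ext cos); [easy|].
  replace (Re (Ci * cis t)) with (- sin t) by (unfold Ci, cis; simpl; ring).
  auto_derive; auto; ring.
- apply (is_derive_ext sin); [easy|].
  replace (Im (Ci * cis t)) with (cos t) by (unfold Ci, cis; simpl; ring).
  auto_derive; auto; ring.
Qed.

Definition in_itv (a b t : R) : Prop := a <= t <= b.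

Definition rcts (a b : R) (g : R -> C) : Prop :=
  forall t, in_itv a b t -> cts dR (in_itv a b) g t.

(** Retraction of the line onto [[a, b]]. Composing with it turns continuity relative to the
    interval into two-sided continuity everywhere, which the theorems on integrals require even at
    the endpoints. *)
Definition clamp (a b t : R) : R := Rmax a (Rmin b t).

Lemma clamp_in a b t : a <= b -> in_itv a b (clamp a b t).
Proof.
intros H; split; [apply Rmax_l|]; apply Rmax_lub; [easy|apply Rmin_l].
Qed.

Lemma clamp_id a b t : in_itv a b t -> clamp a b t = t.
Proof.
intros [H1 H2]; unfold clamp; rewrite Rmin_right, Rmax_right; lra.
Qed.

Lemma clamp_lip a b s t : a <= b -> Rabs (clamp a b s - clamp a b t) <= Rabs (s - t).
Proof.
intros H; unfold clamp, Rmax, Rmin.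
destruct (Rle_dec b s); destruct (Rle_dec b t);
  repeat (match goal with |- context [Rle_dec ?x ?y] => destruct (Rle_dec x y) end);
  unfold Rabs; repeat (match goal with |- context [Rcase_abs ?x] =>
    destruct (Rcase_abs x) end); lra.
Qed.

Lemma clamp_continuous a b g : a <= b -> rcts a b g ->
  forall t, continuous (fun s => Re (g (clamp a b s))) t /\
            continuous (fun s => Im (g (clamp a b s))) t.
Proof.
intros Hab Hg t.
assert (H := Hg _ (clamp_in a b t Hab)).
split; apply (proj2 (filterlim_locally _ _)); intros [e He]; destruct (H e He) as (d & D & Hd);
  exists (mkposreal d D); intros s Hs;
  assert (A : Cmod (g (clamp a b s) - g (clamp a b t)) < e) by
   (apply Hd; [now apply clamp_in|]; apply Rle_lt_trans with (2 := Hs);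
    now apply clamp_lip);
  apply Rle_lt_trans with (2 := A).
- apply (re_le_Cmod (g (clamp a b s) - g (clamp a b t))).
- apply (im_le_Cmod (g (clamp a b s) - g (clamp a b t))).
Qed.

Definition CInt (g : R -> C) (a b : R) : C :=
  (RInt (fun t => Re (g t)) a b, RInt (fun t => Im (g t)) a b).

Lemma rcts_ex_RInt a b g : a <= b -> rcts a b g ->
  ex_RInt (fun t => Re (g t)) a b /\ ex_RInt (fun t => Im (g t)) a b.
Proof.
intros Hab Hg; split.
- apply ex_RInt_ext with (fun s => Re (g (clamp a b s))).
  + rewrite Rmin_left, Rmax_right by easy.
    intros x Hx; rewrite clamp_id; [easy|unfold in_itv; lra].
  + apply (ex_RInt_continuous (V := R_CompleteNormedModule)); intros.
    now apply clamp_continuous.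
- apply ex_RInt_ext with (fun s => Im (g (clamp a b s))).
  + rewrite Rmin_left, Rmax_right by easy.
    intros x Hx; rewrite clamp_id; [easy|unfold in_itv; lra].
  + apply (ex_RInt_continuous (V := R_CompleteNormedModule)); intros.
    now apply clamp_continuous.
Qed.

Lemma CInt_ext a b f g : a <= b -> (forall t, in_itv a b t -> f t = g t) ->
  CInt f a b = CInt g a b.
Proof.
intros Hab E; unfold CInt; f_equal; apply RInt_ext;
  rewrite Rmin_left, Rmax_right by easy; intros x Hx; rewrite E;
  auto; unfold in_itv; lra.
Qed.

Lemma CInt_plus a b f g : a <= b -> rcts a b f -> rcts a b g ->
  CInt (fun t => f t + g t)%C a b = (CInt f a b + CInt g a b)%C.
Proof.
intros Hab Hf Hg.
destruct (rcts_ex_RInt a b f Hab Hf); destruct (rcts_ex_RInt a b g Hab Hg).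
unfold CInt, Cplus; simpl; f_equal.
- now rewrite (RInt_plus (fun t => Re (f t)) (fun t => Re (g t))).
- now rewrite (RInt_plus (fun t => Im (f t)) (fun t => Im (g t))).
Qed.

Lemma CInt_scal a b k f : a <= b -> rcts a b f ->
  CInt (fun t => k * f t)%C a b = (k * CInt f a b)%C.
Proof.
intros Hab Hf.
destruct (rcts_ex_RInt a b f Hab Hf) as [E1 E2].
assert (S : forall (u : R) h, ex_RInt h a b -> RInt (fun t => u * h t) a b = u * RInt h a b).
{ intros u h Hh; now apply (RInt_scal (V := R_CompleteNormedModule) h). }
assert (X : forall (u : R) h, ex_RInt h a b -> ex_RInt (fun t => u * h t) a b).
{ intros u h Hh; now apply (ex_RInt_scal (V := R_NormedModule) h). }
apply C_ext; unfold CInt; simpl.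
- rewrite <- !S by easy.
  apply (RInt_minus (V := R_CompleteNormedModule)
    (fun t => fst k * Re (f t)) (fun t => snd k * Im (f t))); now apply X.
- rewrite <- !S by easy.
  apply (RInt_plus (V := R_CompleteNormedModule)
    (fun t => fst k * Im (f t)) (fun t => snd k * Re (f t))); now apply X.
Qed.

Lemma rcts_scal a b k f : rcts a b f -> rcts a b (fun t => k * f t)%C.
Proof. intros H t Ht; apply cts_scal; auto. Qed.

Lemma rcts_minus a b f g : rcts a b f -> rcts a b g -> rcts a b (fun t => f t - g t)%C.
Proof. intros H H' t Ht; apply cts_minus; auto. Qed.

Lemma rcts_mult a b f g : rcts a b f -> rcts a b g -> rcts a b (fun t => f t * g t)%C.
Proof. intros H H' t Ht; apply cts_mult; auto. Qed.

Lemma rcts_const a b k : rcts a b (fun _ => k).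
Proof. intros t Ht; apply cts_const. Qed.

Lemma CInt_minus a b f g : a <= b -> rcts a b f -> rcts a b g ->
  CInt (fun t => f t - g t)%C a b = (CInt f a b - CInt g a b)%C.
Proof.
intros Hab Hf Hg.
assert (Hg' : rcts a b (fun t => -(1) * g t)%C) by now apply rcts_scal.
rewrite (CInt_ext a b _ (fun t => f t + -(1) * g t)%C) by (auto; intros; ring).
rewrite CInt_plus, CInt_scal by auto; ring.
Qed.

Lemma CInt_const a b k : CInt (fun _ => k) a b = (RtoC (b - a) * k)%C.
Proof.
unfold CInt; rewrite !RInt_const; apply C_ext; simpl; unfold scal; simpl;
  unfold mult; simpl; unfold Re, Im; ring.
Qed.

Lemma CInt_Chasles a b c f : a <= b -> b <= c -> rcts a c f ->
  (CInt f a b + CInt f b c)%C = CInt f a c.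
Proof.
intros Hab Hbc Hf.
assert (H1 : rcts a b f).
{ intros t Ht; apply cts_sub with (in_itv a c); [unfold in_itv; intros; lra|].
  apply Hf; unfold in_itv in *; lra. }
assert (H2 : rcts b c f).
{ intros t Ht; apply cts_sub with (in_itv a c); [unfold in_itv; intros; lra|].
  apply Hf; unfold in_itv in *; lra. }
destruct (rcts_ex_RInt a b f Hab H1); destruct (rcts_ex_RInt b c f Hbc H2).
apply C_ext; unfold CInt; simpl.
- now apply (RInt_Chasles (V := R_CompleteNormedModule) (fun t => Re (f t))).
- now apply (RInt_Chasles (V := R_CompleteNormedModule) (fun t => Im (f t))).
Qed.

Lemma CInt_ftc a b F f : a <= b -> (forall t, in_itv a b t -> rder F t (f t)) ->
  rcts a b f -> CInt f a b = (F b - F a)%C.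
Proof.
intros Hab HF Hf.
rewrite (CInt_ext a b f (fun t => f (clamp a b t))); auto.
2:{ intros; now rewrite clamp_id. }
apply C_ext; unfold CInt; simpl; apply is_RInt_unique.
- apply (is_RInt_derive (V := R_CompleteNormedModule) (fun t => Re (F t))
    (fun t => Re (f (clamp a b t)))); rewrite Rmin_left, Rmax_right by easy.
  + intros t Ht; rewrite clamp_id by easy; now apply HF.
  + intros t Ht; now apply clamp_continuous.
- apply (is_RInt_derive (V := R_CompleteNormedModule) (fun t => Im (F t))
    (fun t => Im (f (clamp a b t)))); rewrite Rmin_left, Rmax_right by easy.
  + intros t Ht; rewrite clamp_id by easy; now apply HF.
  + intros t Ht; now apply clamp_continuous.
Qed.

(** Turns a bound on a modulus into a bound on a real part, to which monotonicity of real integrals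
    and the real mean value theorem apply. *)
Lemma rotation (z : C) : exists u : C, Cmod u = 1 /\ (u * z)%C = RtoC (Cmod z).
Proof.
destruct (Ceq_dec z 0) as [->|N].
- exists 1; rewrite Cmod_1, Cmod_0; split; [easy|ring].
- assert (P := proj1 (Cmod_gt_0 z) N).
  assert (N' : RtoC (Cmod z) <> 0) by (intros E; apply RtoC_inj in E; lra).
  exists (RtoC (Cmod z) / z)%C; split.
  + rewrite Cmod_div, Cmod_R, Rabs_pos_eq by (auto; lra); field; lra.
  + now field.
Qed.

Lemma CInt_bound a b f M : a <= b -> rcts a b f ->
  (forall t, in_itv a b t -> Cmod (f t) <= M) -> Cmod (CInt f a b) <= M * (b - a).
Proof.
intros Hab Hf HM.
destruct (rotation (CInt f a b)) as (u & Hu & E).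
assert (H := rcts_scal a b u f Hf).
rewrite <- CInt_scal in E by easy.
apply (f_equal Re) in E; rewrite re_RtoC in E; rewrite <- E; simpl.
replace (M * (b - a)) with (RInt (fun _ : R => M) a b).
2:{ rewrite RInt_const; apply Rmult_comm. }
apply RInt_le; auto.
- now apply rcts_ex_RInt in H.
- apply ex_RInt_const.
- intros x Hx; change (Re (u * f x) <= M).
  apply Rle_trans with (1 := Re_le_Cmod _).
  rewrite Cmod_mult, Hu, Rmult_1_l; apply HM; unfold in_itv; lra.
Qed.

Lemma CInt_comp_lin f u v : rcts (Rmin v (u + v)) (Rmax v (u + v)) f ->
  (RtoC u * CInt (fun t => f (u * t + v)%R) 0 1)%C = CInt f v (u + v).
Proof.
intros Hf.
assert (L : Rmin v (u + v) <= Rmax v (u + v)).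
{ apply Rle_trans with v; [apply Rmin_l|apply Rmax_l]. }
destruct (rcts_ex_RInt _ _ f L Hf) as [E1 E2].
assert (X : forall h : R -> R, ex_RInt h (Rmin v (u + v)) (Rmax v (u + v)) ->
  ex_RInt h v (u + v)).
{ intros h; unfold Rmin, Rmax; destruct (Rle_dec v (u + v)); [easy|].
  apply ex_RInt_swap. }
assert (Y : forall h : R -> R, ex_RInt h (Rmin v (u + v)) (Rmax v (u + v)) ->
  u * RInt (fun t => h (u * t + v)) 0 1 = RInt h v (u + v)).
{ intros h Hh; apply X in Hh.
  (* The change of variables divides by [u]; for [u = 0] both sides vanish. *)
  destruct (Req_dec u 0) as [->|N].
  { rewrite Rplus_0_l, RInt_point, Rmult_0_l; easy. }
  assert (Hh' : ex_RInt h (u * 0 + v) (u * 1 + v)).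
  { now rewrite Rmult_0_r, Rplus_0_l, Rmult_1_r. }
  assert (E := RInt_comp_lin (V := R_CompleteNormedModule) h u v 0 1 Hh').
  assert (Ex := ex_RInt_comp_lin (V := R_NormedModule) h u v 0 1 Hh').
  rewrite Rmult_0_r, Rplus_0_l, Rmult_1_r in E; rewrite <- E.
  change (fun y : R => scal u (h (u * y + v))) with (fun y : R => u * h (u * y + v)) in *.
  apply (ex_RInt_scal (V := R_NormedModule)) with (k := / u) in Ex.
  assert (Ex' : ex_RInt (fun y : R => h (u * y + v)) 0 1).
  { revert Ex; apply ex_RInt_ext; intros x _; unfold scal; simpl; unfold mult; simpl.
    field; easy. }
  symmetry; apply (RInt_scal (V := R_CompleteNormedModule)
    (fun y : R => h (u * y + v))); easy. }
apply C_ext; unfold CInt; simpl.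
- rewrite <- (Y (fun t => Re (f t))) by easy; ring.
- rewrite <- (Y (fun t => Im (f t))) by easy; ring.
Qed.

(** The mean value equality fails for complex values. The increment is rotated onto the positive
    real axis, and the real theorem is applied to the real part of the rotated curve. *)
Lemma mean_value_ineq a b g d v M : a <= b ->
  (forall t, in_itv a b t -> rder g t (d t)) ->
  (forall t, in_itv a b t -> Cmod (d t - v) <= M) ->
  Cmod (g b - g a - RtoC (b - a) * v) <= M * (b - a).
Proof.
intros Hab Hg HM.
destruct (rotation (g b - g a - RtoC (b - a) * v)) as (u & Hu & E).
set (h := fun t => (u * (g t + RtoC t * - v))%C).
assert (Hh : forall t, in_itv a b t -> rder h t (u * (d t - v))%C).
{ intros t Ht.
  apply (rder_eq _ _ (0 * (g t + RtoC t * - v) + u * (d t + - v))%C); [|ring].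
  apply (rder_mult (fun _ => u)); [apply rder_const|].
  apply rder_plus; [now apply Hg|]; apply rder_ray. }
destruct (MVT_gen (fun t => Re (h t)) a b (fun t => Re (u * (d t - v)))) as (c & Hc & Ec).
{ rewrite Rmin_left, Rmax_right by easy; intros x Hx; apply Hh; unfold in_itv; lra. }
{ rewrite Rmin_left, Rmax_right by easy; intros x Hx.
  apply derivable_continuous_pt; exists (Re (u * (d x - v))).
  apply is_derive_Reals; now apply Hh. }
rewrite Rmin_left, Rmax_right in Hc by easy.
apply (f_equal Re) in E; rewrite re_RtoC in E; rewrite <- E.
replace (Re (u * (g b - g a - RtoC (b - a) * v))) with (Re (h b) - Re (h a)).
2:{ rewrite <- re_minus; f_equal; unfold h; rewrite RtoC_minus; ring. }
rewrite Ec; apply Rmult_le_compat_r; [lra|].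
apply Rle_trans with (1 := Re_le_Cmod _).
rewrite Cmod_mult, Hu, Rmult_1_l; now apply HM.
Qed.

Lemma rder_zero_const a b g : a <= b ->
  (forall t, in_itv a b t -> rder g t 0) -> g b = g a.
Proof.
intros Hab Hg.
assert (H := mean_value_ineq a b g (fun _ => RtoC 0) 0 0 Hab Hg).
assert (H0 : Cmod (g b - g a - RtoC (b - a) * 0) <= 0 * (b - a)).
{ apply H; intros; rewrite Cmod_sub_self; lra. }
replace (g b - g a - RtoC (b - a) * 0)%C with (g b - g a)%C in H0 by ring.
apply Ceq_minus, Cmod_eq_0; assert (P := Cmod_ge_0 (g b - g a)); lra.
Qed.

(** * Compact subsets of the plane *)

Definition closedC (S : C -> Prop) : Prop :=
  forall p, ~ S p -> exists r, 0 < r /\ forall w, Cmod (w - p) < r -> ~ S w.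

Definition compactC (S : C -> Prop) : Prop :=
  closedC S /\ exists M, forall z, S z -> Cmod z <= M.

(* Local-to-global principle: [Q x e] is a property at scale [e]. *)
Lemma compact_uniform (S : C -> Prop) (Q : C -> R -> Prop) : compactC S ->
  (forall x e e', Q x e -> 0 < e' <= e -> Q x e') ->
  (forall p, S p -> exists e, 0 < e /\ forall x, S x -> Cmod (x - p) < e -> Q x e) ->
  exists e, 0 < e /\ forall x, S x -> Q x e.
Proof.
intros [Cl [M HM]] Mono Loc.
(* The covering theorem is about a full square, so points outside [S] need a radius too; closedness
   provides one for which the requirement is void. *)
assert (Ch : forall p, exists e, 0 < e /\ forall x, S x -> Cmod (x - p) < e -> Q x e).
{ intros p; destruct (classic (S p)) as [Sp|Np]; [now apply Loc|].
  destruct (Cl p Np) as (r & Hr & H); exists r; split; [easy|].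
  intros x Sx Hx; now destruct (H x Hx). }
pose (rad := fun p => proj1_sig (constructive_indefinite_description _ (Ch p))).
assert (Hrad : forall p, 0 < rad p /\ forall x, S x -> Cmod (x - p) < rad p -> Q x (rad p)).
{ intros p; unfold rad; now destruct (constructive_indefinite_description _ (Ch p)). }
clearbody rad.
(* The radius is halved because the square controls the two coordinates separately and [Cmod] is
   bounded by their sum. *)
assert (Pos : forall u v : R, 0 < rad (u, v) / 2).
{ intros u v; destruct (Hrad (u, v)); lra. }
destruct (compactness_value_2d (- M) M (- M) M (fun u v => mkposreal _ (Pos u v)))
  as [e He].
exists e; split; [apply cond_pos|]; intros x Sx.
assert (Bd := HM x Sx).
assert (B1 := Rle_trans _ _ _ (re_le_Cmod x) Bd).
assert (B2 := Rle_trans _ _ _ (im_le_Cmod x) Bd).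
apply Rabs_le_between in B1; apply Rabs_le_between in B2.
specialize (He (Re x) (Im x) B1 B2); apply NNPP in He.
destruct He as (u & v & _ & _ & H1 & H2 & H3); simpl in H1, H2, H3.
destruct (Hrad (u, v)) as [P HQ].
apply Mono with (rad (u, v)).
- apply HQ; [easy|]; apply Rle_lt_trans with (1 := Cmod_le_Re_Im _).
  rewrite re_minus, im_minus; simpl; simpl in H1, H2; lra.
- split; [apply cond_pos|lra].
Qed.

(** Two uses of [compact_uniform]: a scale [e] first encodes the bound [/ e], which gives a finite
    supremum [m]; if [m] were not attained, [e] would next encode a uniform gap [m - e], against the
    choice of [m]. *)
Lemma compact_max (S : C -> Prop) (f : C -> C) : compactC S -> (exists z, S z) ->
  (forall z, S z -> cts dC S f z) ->
  exists z0, S z0 /\ forall z, S z -> Re (f z) <= Re (f z0).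
Proof.
intros HS [z1 S1] Hf.
destruct (compact_uniform S (fun x e => Re (f x) <= / e) HS) as (b & Hb & Bd).
{ intros x e e' H He; apply Rle_trans with (1 := H), Rinv_le_contravar; lra. }
{ intros p Sp; destruct (Hf p Sp 1) as (d & D & Hd); [lra|].
  set (B := 1 + Rabs (Re (f p))).
  assert (HB : 0 < B) by (unfold B; generalize (Rabs_pos (Re (f p))); lra).
  exists (Rmin d (/ B)); split; [apply Rmin_pos; auto; now apply Rinv_0_lt_compat|].
  intros x Sx Hx.
  assert (A := Hd x Sx (Rlt_le_trans _ _ _ Hx (Rmin_l _ _))).
  assert (A' := Re_le_Cmod (f x - f p)); rewrite re_minus in A'.
  apply Rle_trans with B; [unfold B; generalize (Rle_abs (Re (f p))); lra|].
  rewrite <- (Rinv_inv B) at 1; apply Rinv_le_contravar; [|apply Rmin_r].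
  apply Rmin_pos; auto; now apply Rinv_0_lt_compat. }
destruct (completeness (fun y => exists z, S z /\ y = Re (f z))) as [m [Um Lm]].
{ exists (/ b); intros y (z & Sz & ->); auto. }
{ exists (Re (f z1)), z1; auto. }
assert (Le : forall z, S z -> Re (f z) <= m) by (intros z Sz; apply Um; eauto).
destruct (classic (exists z0, S z0 /\ Re (f z0) = m)) as [(z0 & S0 & E)|N].
{ exists z0; rewrite E; auto. }
assert (Lt : forall z, S z -> Re (f z) < m).
{ intros z Sz; destruct (Le z Sz) as [|E]; auto; exfalso; eauto. }
destruct (compact_uniform S (fun x e => Re (f x) <= m - e) HS) as (c & Hc & Bc).
{ intros x e e' H He; lra. }
{ intros p Sp; assert (A := Lt p Sp).
  destruct (Hf p Sp ((m - Re (f p)) / 2)) as (d & D & Hd); [lra|].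
  exists (Rmin d ((m - Re (f p)) / 2)); split; [apply Rmin_pos; lra|].
  intros x Sx Hx.
  assert (B := Hd x Sx (Rlt_le_trans _ _ _ Hx (Rmin_l _ _))).
  assert (A' := Re_le_Cmod (f x - f p)); rewrite re_minus in A'.
  generalize (Rmin_r d ((m - Re (f p)) / 2)); lra. }
exfalso; apply (Rlt_irrefl m); apply Rle_lt_trans with (m - c); [|lra].
apply Lm; intros y (z & Sz & ->); auto.
Qed.

Lemma compact_min (S : C -> Prop) (f : C -> C) : compactC S -> (exists z, S z) ->
  (forall z, S z -> cts dC S f z) ->
  exists z0, S z0 /\ forall z, S z -> Re (f z0) <= Re (f z).
Proof.
intros HS NE Hf.
destruct (compact_max S (fun z => - f z)%C HS NE) as (z0 & S0 & H).
{ intros z Sz; apply cts_opp; auto. }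
exists z0; split; [easy|]; intros z Sz; specialize (H z Sz).
rewrite !re_opp in H; lra.
Qed.

Definition cdisk (p : C) (r : R) (z : C) : Prop := Cmod (z - p) <= r.

Lemma cdisk_compact p r : compactC (cdisk p r).
Proof.
split.
- intros z Hz; apply Rnot_le_lt in Hz.
  exists (Cmod (z - p) - r); split; [lra|]; intros w Hw Hc; unfold cdisk in Hc.
  assert (A := Cmod_sub_triangle z w p); rewrite (Cmod_sub_sym z w) in A; lra.
- exists (Cmod p + r); intros z Hz; unfold cdisk in Hz.
  assert (A := Cmod_sub_le z p); lra.
Qed.

Definition circle (r : R) (z : C) : Prop := Cmod z = r.

Lemma circle_compact r : compactC (circle r).
Proof.
split.
- intros z Hz; unfold circle in Hz.
  exists (Rabs (Cmod z - r)); split; [apply Rabs_pos_lt; lra|].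
  intros w Hw Hc; unfold circle in Hc; rewrite <- Hc in Hw.
  assert (A := Cmod_sub_le w z); assert (B := Cmod_sub_le z w).
  rewrite Cmod_sub_sym in B.
  apply (Rlt_not_le _ _ Hw), Rabs_le; lra.
- exists r; intros z ->; lra.
Qed.

(** * Goursat's theorem *)

Lemma CInt_swap f a b : a <= b -> rcts a b f -> CInt f b a = (- CInt f a b)%C.
Proof.
intros Hab Hf; destruct (rcts_ex_RInt a b f Hab Hf).
assert (swap : forall h : R -> R, ex_RInt h a b -> RInt h b a = - RInt h a b).
{ intros h Hh; symmetry; now apply (opp_RInt_swap (V := R_CompleteNormedModule)). }
apply C_ext; unfold CInt; simpl; now apply swap.
Qed.

Lemma rcts_comp a b (f : C -> C) (g : R -> C) :
  (forall t, in_itv a b t -> cts dC everywhere f (g t)) -> rcts a b g ->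
  rcts a b (fun t => f (g t)).
Proof.
intros Hf Hg t Ht.
apply (cts_comp dR (in_itv a b) everywhere f g); auto; easy.
Qed.

Lemma rcts_line a b p v : rcts a b (fun t => p + RtoC t * v)%C.
Proof. intros t _; apply rder_cts with v, rder_line. Qed.

Definition seg (p q : C) (t : R) : C := (p + RtoC t * (q - p))%C.

Definition Iseg (f : C -> C) (p q : C) : C :=
  ((q - p) * CInt (fun t => f (seg p q t)) 0 1)%C.

Lemma seg_0 p q : seg p q 0 = p.
Proof. unfold seg; ring. Qed.

Lemma seg_1 p q : seg p q 1 = q.
Proof. unfold seg; ring. Qed.

Lemma seg_seg p q a b t :
  seg (seg p q a) (seg p q b) t = seg p q ((b - a) * t + a).
Proof. unfold seg; rewrite RtoC_plus, RtoC_mult, RtoC_minus; ring. Qed.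

Lemma Iseg_sub f p q a b : in_itv 0 1 a -> in_itv 0 1 b ->
  (forall t, in_itv 0 1 t -> cts dC everywhere f (seg p q t)) ->
  Iseg f (seg p q a) (seg p q b) = ((q - p) * CInt (fun t => f (seg p q t)) a b)%C.
Proof.
intros Ha Hb Hf; unfold Iseg.
rewrite (CInt_ext 0 1 _ (fun t => f (seg p q ((b - a) * t + a)))).
2:{ lra. } 2:{ intros; now rewrite seg_seg. }
replace (seg p q b - seg p q a)%C with ((q - p) * RtoC (b - a))%C
  by (unfold seg; rewrite RtoC_minus; ring).
rewrite <- Cmult_assoc; f_equal.
rewrite (CInt_comp_lin (fun t => f (seg p q t))).
- now replace (b - a + a) with b by ring.
- replace (b - a + a) with b by ring; apply rcts_comp; [|apply rcts_line].
  intros t [H1 H2]; apply Hf; unfold in_itv in *; split.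
  + apply Rle_trans with (2 := H1); apply Rmin_glb; lra.
  + apply Rle_trans with (1 := H2); apply Rmax_lub; lra.
Qed.

Lemma Iseg_mid f p q :
  (forall t, in_itv 0 1 t -> cts dC everywhere f (seg p q t)) ->
  (Iseg f p ((p + q) / 2) + Iseg f ((p + q) / 2) q)%C = Iseg f p q.
Proof.
intros Hf.
assert (E : ((p + q) / 2)%C = seg p q (1 / 2)).
{ unfold seg; rewrite RtoC_div by lra.
  field; intros X; apply (f_equal Re) in X; simpl in X; lra. }
assert (H := fun a b Ha Hb => Iseg_sub f p q a b Ha Hb Hf).
rewrite E.
assert (H1 := H 0 (1 / 2) ltac:(unfold in_itv; lra) ltac:(unfold in_itv; lra)).
assert (H2 := H (1 / 2) 1 ltac:(unfold in_itv; lra) ltac:(unfold in_itv; lra)).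
rewrite seg_0 in H1; rewrite seg_1 in H2; rewrite H1, H2.
rewrite <- Cmult_plus_distr_l, CInt_Chasles; [easy|lra|lra|].
apply rcts_comp; [easy|apply rcts_line].
Qed.

Lemma Iseg_swap f p q :
  (forall t, in_itv 0 1 t -> cts dC everywhere f (seg p q t)) ->
  Iseg f q p = (- Iseg f p q)%C.
Proof.
intros Hf.
assert (H := Iseg_sub f p q 1 0 ltac:(unfold in_itv; lra) ltac:(unfold in_itv; lra) Hf).
rewrite seg_0, seg_1 in H; rewrite H.
rewrite CInt_swap; [unfold Iseg; ring|lra|].
apply rcts_comp; [easy|apply rcts_line].
Qed.

Lemma Iseg_ftc f F p q :
  (forall t, in_itv 0 1 t -> cts dC everywhere f (seg p q t)) ->
  (forall t, in_itv 0 1 t -> cder F (seg p q t) (f (seg p q t))) ->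
  Iseg f p q = (F q - F p)%C.
Proof.
intros Hf HF; unfold Iseg.
assert (Hc : rcts 0 1 (fun t => f (seg p q t)))
  by (apply rcts_comp; [easy|apply rcts_line]).
rewrite <- CInt_scal by (auto; lra).
rewrite (CInt_ftc 0 1 (fun t => F (seg p q t))).
- now rewrite seg_0, seg_1.
- lra.
- intros t Ht; apply (rder_eq _ _ (f (seg p q t) * (q - p))%C); [|ring].
  apply rder_comp; [now apply HF|apply rder_line].
- now apply rcts_scal.
Qed.

Lemma Iseg_bound f p q M :
  (forall t, in_itv 0 1 t -> cts dC everywhere f (seg p q t)) ->
  (forall t, in_itv 0 1 t -> Cmod (f (seg p q t)) <= M) ->
  Cmod (Iseg f p q) <= M * Cmod (q - p).
Proof.
intros Hf HM; unfold Iseg; rewrite Cmod_mult, Rmult_comm.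
apply Rmult_le_compat_r; [apply Cmod_ge_0|].
replace M with (M * (1 - 0)) by ring.
apply CInt_bound; [lra| |easy].
apply rcts_comp; [easy|apply rcts_line].
Qed.

Lemma Iseg_minus f g p q :
  (forall t, in_itv 0 1 t -> cts dC everywhere f (seg p q t)) ->
  (forall t, in_itv 0 1 t -> cts dC everywhere g (seg p q t)) ->
  Iseg (fun z => f z - g z)%C p q = (Iseg f p q - Iseg g p q)%C.
Proof.
intros Hf Hg; unfold Iseg.
rewrite CInt_minus; [ring|lra| |]; apply rcts_comp; auto; apply rcts_line.
Qed.

Definition Itri (f : C -> C) (a b c : C) : C :=
  (Iseg f a b + Iseg f b c + Iseg f c a)%C.

Lemma C2_neq_0 : RtoC 2 <> 0.
Proof. intros X; apply (f_equal Re) in X; simpl in X; lra. Qed.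

Lemma Itri_subdivide f a b c :
  (forall t u, 0 <= t -> 0 <= u -> t + u <= 1 ->
     cts dC everywhere f (a + RtoC t * (b - a) + RtoC u * (c - a))%C) ->
  Itri f a b c =
   (Itri f a ((a + b) / 2) ((a + c) / 2) + Itri f ((a + b) / 2) b ((b + c) / 2)
    + Itri f ((a + c) / 2) ((b + c) / 2) c
    + Itri f ((b + c) / 2) ((a + c) / 2) ((a + b) / 2))%C.
Proof.
intros Hf.
assert (N2 := C2_neq_0).
assert (In : forall s1 u1 s2 u2, 0 <= s1 -> 0 <= u1 -> s1 + u1 <= 1 ->
  0 <= s2 -> 0 <= u2 -> s2 + u2 <= 1 -> forall p q,
  p = (a + RtoC s1 * (b - a) + RtoC u1 * (c - a))%C ->
  q = (a + RtoC s2 * (b - a) + RtoC u2 * (c - a))%C ->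
  forall t, in_itv 0 1 t -> cts dC everywhere f (seg p q t)).
{ intros s1 u1 s2 u2 H1 H2 H3 H4 H5 H6 p q -> -> t [T0 T1].
  replace (seg _ _ t) with
    (a + RtoC (s1 + t * (s2 - s1)) * (b - a) + RtoC (u1 + t * (u2 - u1)) * (c - a))%C.
  - apply Hf; nra.
  - unfold seg; rewrite !RtoC_plus, !RtoC_mult, !RtoC_minus; ring. }
assert (R2 : RtoC (1 / 2) = (1 / 2)%C) by (apply RtoC_div; lra).
unfold Itri.
rewrite <- (Iseg_mid f a b), <- (Iseg_mid f b c), <- (Iseg_mid f c a).
2:{ apply (In 0 1 0 0); try lra; ring. }
2:{ apply (In 1 0 0 1); try lra; ring. }
2:{ apply (In 0 0 1 0); try lra; ring. }
replace ((c + a) / 2)%C with ((a + c) / 2)%C by (now field).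
rewrite (Iseg_swap f ((a + b) / 2) ((b + c) / 2)).
2:{ apply (In (1/2) 0 (1/2) (1/2)); try lra; rewrite ?R2; field; auto. }
rewrite (Iseg_swap f ((a + b) / 2) ((a + c) / 2)).
2:{ apply (In (1/2) 0 0 (1/2)); try lra; rewrite ?R2; field; auto. }
rewrite (Iseg_swap f ((a + c) / 2) ((b + c) / 2)).
2:{ apply (In 0 (1/2) (1/2) (1/2)); try lra; rewrite ?R2; field; auto. }
ring.
Qed.

Lemma half_pow_small e : 0 < e -> exists n, (1 / 2) ^ n < e.
Proof.
intros He.
destruct (pow_lt_1_zero (1 / 2)) with (2 := He) as [n Hn].
{ rewrite Rabs_pos_eq; lra. }
exists n; specialize (Hn n (le_n n)).
rewrite Rabs_pos_eq in Hn; [easy|apply pow_le; lra].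
Qed.

(** The intervals of radius [(1 / 2) ^ n] around [x n] are nested; the limit is the supremum of
    their left ends. *)
Lemma dyadic_limit (x : nat -> R) :
  (forall n, Rabs (x (S n) - x n) <= (1 / 2) ^ n / 2) ->
  exists l, forall n, Rabs (x n - l) <= (1 / 2) ^ n.
Proof.
intros Hx.
assert (P : forall n, 0 < (1 / 2) ^ n) by (intros; apply pow_lt; lra).
assert (S1 : forall n k, x n - (1 / 2) ^ n <= x (n + k)%nat - (1 / 2) ^ (n + k)).
{ intros n k; induction k as [|k IH]; [rewrite Nat.add_0_r; lra|].
  rewrite Nat.add_succ_r; simpl pow; specialize (Hx (n + k)%nat).
  apply Rabs_le_between in Hx; lra. }
assert (S2 : forall n k, x (n + k)%nat + (1 / 2) ^ (n + k) <= x n + (1 / 2) ^ n).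
{ intros n k; induction k as [|k IH]; [rewrite Nat.add_0_r; lra|].
  rewrite Nat.add_succ_r; simpl pow; specialize (Hx (n + k)%nat).
  apply Rabs_le_between in Hx; lra. }
assert (S3 : forall n m, x n - (1 / 2) ^ n <= x m + (1 / 2) ^ m).
{ intros n m; specialize (S1 n m); specialize (S2 m n).
  rewrite (Nat.add_comm m n) in S2; specialize (P (n + m)%nat); lra. }
destruct (completeness (fun y => exists n, y = x n - (1 / 2) ^ n)) as [l [U L]].
{ exists (x 0%nat + (1 / 2) ^ 0); intros y [n ->]; apply S3. }
{ exists (x 0%nat - (1 / 2) ^ 0), 0%nat; easy. }
exists l; intros n.
assert (A : x n - (1 / 2) ^ n <= l) by (apply U; eauto).
assert (B : l <= x n + (1 / 2) ^ n) by (apply L; intros y [m ->]; apply S3).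
apply Rabs_le; lra.
Qed.

Section Goursat.
Variables (f : C -> C) (a u v : C).
Let T (s t : R) : C := (a + RtoC s * u + RtoC t * v)%C.
Let simplex (s t : R) : Prop := 0 <= s /\ 0 <= t /\ s + t <= 1.
Hypothesis Hf : forall s t, simplex s t -> cdiff f (T s t).

(** A triangle is coded by a corner [(s, t)] and a signed size [k] in the affine frame [(a, u, v)].
    A negative [k] describes an inverted triangle, so that all four pieces of a subdivision, the
    middle one included, have the same form. *)
Let J (x : R * R * R) : C :=
  let '(s, t, k) := x in Itri f (T s t) (T (s + k) t) (T s (t + k)).
Let size (x : R * R * R) : R := let '(s, t, k) := x in k.
Let valid (x : R * R * R) : Prop :=
  let '(s, t, k) := x in simplex s t /\ simplex (s + k) t /\ simplex s (t + k).

Let child1 (x : R * R * R) := let '(s, t, k) := x in (s, t, k / 2).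
Let child2 (x : R * R * R) := let '(s, t, k) := x in (s + k / 2, t, k / 2).
Let child3 (x : R * R * R) := let '(s, t, k) := x in (s, t + k / 2, k / 2).
Let child4 (x : R * R * R) := let '(s, t, k) := x in (s + k / 2, t + k / 2, - (k / 2)).

Lemma Goursat_edge_in s1 t1 s2 t2 w : simplex s1 t1 -> simplex s2 t2 -> in_itv 0 1 w ->
  simplex (s1 + w * (s2 - s1)) (t1 + w * (t2 - t1)).
Proof. unfold simplex, in_itv; intros; repeat split; nra. Qed.

Lemma Goursat_edge_pt s1 t1 s2 t2 w :
  seg (T s1 t1) (T s2 t2) w = T (s1 + w * (s2 - s1)) (t1 + w * (t2 - t1)).
Proof. unfold seg, T; rewrite !RtoC_plus, !RtoC_mult, !RtoC_minus; ring. Qed.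

Lemma Goursat_children x : valid x -> J x = (J (child1 x) + J (child2 x) + J (child3 x) + J (child4 x))%C.
Proof.
destruct x as [[s t] k]; intros (V1 & V2 & V3); unfold J, child1, child2, child3, child4.
rewrite Itri_subdivide.
2:{ intros w z Hw Hz Hwz; apply cdiff_cts.
  replace (_ + _ + _)%C with (T (s + w * k) (t + z * k)).
  - apply Hf; unfold simplex in *; repeat split; nra.
  - unfold T; rewrite !RtoC_plus, !RtoC_mult; ring. }
assert (N2 := C2_neq_0).
assert (R2 : RtoC (k / 2) = (k / 2)%C) by (apply RtoC_div; lra).
apply (f_equal2 Cplus); [apply (f_equal2 Cplus); [apply (f_equal2 Cplus)|]|];
  apply (f_equal3 (Itri f)); unfold T; rewrite ?RtoC_plus, ?RtoC_opp, ?R2; field; auto.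
Qed.

Lemma Goursat_J0 : J (0, 0, 1) = 0.
Proof.
apply Cmod_eq_0; destruct (Req_dec (Cmod (J (0, 0, 1))) 0) as [|N]; [easy|exfalso].
assert (P0 := Cmod_ge_0 (J (0, 0, 1))).
set (e := Cmod (J (0, 0, 1)) / 2).
assert (He : 0 < e) by (unfold e; lra).
(* The quadratic bound passes from the four children to their parent, since halving the size divides
   it by four. Hence a bad triangle has a bad child, and the descent selects one; the base triangle
   is bad because [e] is only half of its integral. *)
pose (good := fun x => Cmod (J x) <= e * (size x * size x)).
pose (next := fun x =>
  if excluded_middle_informative (good (child1 x)) then
  if excluded_middle_informative (good (child2 x)) then
  if excluded_middle_informative (good (child3 x)) then child4 x
  else child3 x else child2 x else child1 x).
assert (Step : forall x, valid x -> ~ good x -> valid (next x) /\ ~ good (next x)).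
{ intros x V Bx; split.
  - unfold next; destruct x as [[s t] k]; unfold valid, simplex in *.
    repeat destruct excluded_middle_informative; simpl; repeat split; lra.
  - unfold next; repeat destruct excluded_middle_informative; auto.
    intros g4; apply Bx; unfold good in *; rewrite Goursat_children by easy.
    apply Rle_trans with (Cmod (J (child1 x)) + Cmod (J (child2 x))
       + Cmod (J (child3 x)) + Cmod (J (child4 x))).
    { apply Rle_trans with (1 := Cmod_triangle _ _), Rplus_le_compat_r.
      apply Rle_trans with (1 := Cmod_triangle _ _), Rplus_le_compat_r.
      apply Cmod_triangle. }
    destruct x as [[s t] k]; simpl in *; lra. }
pose (st := fix st n := match n with O => (0, 0, 1) | S m => next (st m) end).
assert (Inv : forall n, valid (st n) /\ ~ good (st n)).
{ induction n as [|n IH]; [|now apply Step].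
  split; [simpl; unfold simplex; lra|].
  unfold good; change (st 0%nat) with (0, 0, 1); simpl size; unfold e.
  apply Rlt_not_le; lra. }
pose (xs := fun n => fst (fst (st n))); pose (xt := fun n => snd (fst (st n))).
assert (Sz : forall n, Rabs (size (st n)) = (1 / 2) ^ n /\
  Rabs (xs (S n) - xs n) <= Rabs (size (st n)) / 2 /\
  Rabs (xt (S n) - xt n) <= Rabs (size (st n)) / 2 /\
  Rabs (size (st (S n))) = Rabs (size (st n)) / 2).
{ assert (St : forall n, Rabs (xs (S n) - xs n) <= Rabs (size (st n)) / 2 /\
  Rabs (xt (S n) - xt n) <= Rabs (size (st n)) / 2 /\
  Rabs (size (st (S n))) = Rabs (size (st n)) / 2).
  { intros n; unfold xs, xt; change (st (S n)) with (next (st n)).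
    destruct (st n) as [[s t] k]; unfold next.
    assert (Q := Rabs_pos k).
    assert (Q' : Rabs (k / 2) = Rabs k / 2)
      by (unfold Rdiv; rewrite Rabs_mult, (Rabs_pos_eq (/ 2)); lra).
    repeat destruct excluded_middle_informative; simpl;
      replace (s - s) with 0 by ring; replace (t - t) with 0 by ring;
      replace (s + k / 2 - s) with (k / 2) by ring;
      replace (t + k / 2 - t) with (k / 2) by ring;
      rewrite ?Rabs_Ropp, ?Rabs_R0, ?Q'; lra. }
  intros n; split; [|apply St].
  induction n as [|n IH]; [simpl; apply Rabs_R1|].
  destruct (St n) as (_ & _ & ->); rewrite IH; simpl; lra. }
destruct (dyadic_limit xs) as [ls Hls].
{ intros n; destruct (Sz n) as (E & H & _); now rewrite <- E. }
destruct (dyadic_limit xt) as [lt Hlt].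
{ intros n; destruct (Sz n) as (E & _ & H & _); now rewrite <- E. }
assert (Lim : simplex ls lt).
{ assert (X : forall y, (forall n, - 2 * (1 / 2) ^ n <= y) -> 0 <= y).
  { intros y Hy; destruct (Rle_lt_dec 0 y) as [|Hn]; [easy|].
    destruct (half_pow_small (- y / 2)) as [n Hn']; [lra|].
    specialize (Hy n); lra. }
  assert (Y : forall n, simplex (xs n) (xt n)).
  { intros n; destruct (Inv n) as [V _]; unfold xs, xt.
    destruct (st n) as [[s t] k]; now destruct V. }
  repeat split.
  - apply X; intros n; destruct (Y n) as (Y1 & Y2 & Y3).
    specialize (Hls n); apply Rabs_le_between in Hls.
    assert (0 < (1 / 2) ^ n) by (apply pow_lt; lra); lra.
  - apply X; intros n; destruct (Y n) as (Y1 & Y2 & Y3).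
    specialize (Hlt n); apply Rabs_le_between in Hlt.
    assert (0 < (1 / 2) ^ n) by (apply pow_lt; lra); lra.
  - enough (0 <= 1 - (ls + lt)) by lra.
    apply X; intros n; destruct (Y n) as (Y1 & Y2 & Y3).
    specialize (Hlt n); apply Rabs_le_between in Hlt.
    specialize (Hls n); apply Rabs_le_between in Hls.
    assert (0 < (1 / 2) ^ n) by (apply pow_lt; lra); lra. }
destruct (Hf ls lt Lim) as [d Hd].
set (P := T ls lt) in *.
set (L := Cmod u + Cmod v).
assert (HL : 0 <= L).
{ unfold L; generalize (Cmod_ge_0 u) (Cmod_ge_0 v); lra. }
(* Each of the three edges will contribute at most [2 q L^2 k^2]; the total [6 q L^2 k^2] then stays
   below [e k^2], so that a small triangle near the limit point is good. *)
set (q := e / (6 * (L * L) + 1)).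
assert (HLL : 0 <= L * L) by now apply Rmult_le_pos.
assert (Hq : 0 < q) by (apply Rdiv_lt_0_compat; lra).
destruct (Hd q Hq) as (dl & D & Hdl).
destruct (half_pow_small (dl / (2 * L + 1))) as [n Hn].
{ apply Rdiv_lt_0_compat; lra. }
destruct (Inv n) as [V B]; apply B; clear B.
destruct (Sz n) as (E & _).
specialize (Hls n); specialize (Hlt n); unfold xs, xt in Hls, Hlt.
destruct (st n) as [[s t] k]; simpl in E, Hls, Hlt; rewrite <- E in Hls, Hlt.
unfold good, size, J; destruct V as (V1 & V2 & V3).
rewrite <- E in Hn.
assert (Kp := Rabs_pos k).
(* A primitive of the affine approximation of [f] at [P]. Its increments cancel around the triangle,
   which leaves only the integral of the remainder. *)
set (F := fun z => (f P * z + d * ((z - P) * (z - P)) / 2)%C).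
assert (HF : forall z, cder F z (f P + d * (z - P))%C).
{ intros z; unfold F.
  apply (cder_eq _ _ (f P * 1 + / 2 * (d * ((1 - 0) * (z - P) + (z - P) * (1 - 0))))%C).
  2:{ field; apply C2_neq_0. }
  apply cder_plus; [apply cder_scal, cder_id|].
  apply (cder_ext_loc (fun w => / 2 * (d * ((w - P) * (w - P))))%C) with (r := 1);
    [lra|intros; unfold Cdiv; ring|].
  apply cder_scal, cder_scal.
  apply (cder_mult (fun w => w - P)%C (fun w => w - P)%C);
    apply cder_minus; [apply cder_id|apply cder_const|apply cder_id|apply cder_const]. }
assert (Edge : forall s1 t1 s2 t2, simplex s1 t1 -> simplex s2 t2 ->
  Rabs (s1 - ls) <= 2 * Rabs k -> Rabs (t1 - lt) <= 2 * Rabs k ->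
  Rabs (s2 - ls) <= 2 * Rabs k -> Rabs (t2 - lt) <= 2 * Rabs k ->
  Rabs (s2 - s1) <= Rabs k -> Rabs (t2 - t1) <= Rabs k ->
  Cmod (Iseg f (T s1 t1) (T s2 t2) - (F (T s2 t2) - F (T s1 t1)))
   <= 2 * q * (L * L) * (k * k)).
{ intros s1 t1 s2 t2 A1 A2 B1 B2 B3 B4 B5 B6.
  assert (Cf : forall w, in_itv 0 1 w -> cts dC everywhere f (seg (T s1 t1) (T s2 t2) w)).
  { intros w Hw; rewrite Goursat_edge_pt; apply cdiff_cts, Hf; now apply Goursat_edge_in. }
  assert (Ca : forall w : R, in_itv 0 1 w -> cts dC everywhere (fun z => f P + d * (z - P))%C
     (seg (T s1 t1) (T s2 t2) w)).
  { intros w _; apply cts_plus; [apply cts_const|]; apply cts_scal.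
    apply cts_minus; [apply cts_id|apply cts_const]. }
  rewrite <- (Iseg_ftc (fun z => f P + d * (z - P))%C F); auto.
  rewrite <- Iseg_minus by auto.
  apply Rle_trans with (q * (2 * L * Rabs k) * Cmod (T s2 t2 - T s1 t1)).
  - apply Iseg_bound.
    { intros w Hw; apply cts_minus; auto. }
    intros w Hw; rewrite Goursat_edge_pt.
    set (s3 := s1 + w * (s2 - s1)); set (t3 := t1 + w * (t2 - t1)).
    assert (C1 : Rabs (s3 - ls) <= 2 * Rabs k).
    { unfold s3; apply Rabs_le_between in B1; apply Rabs_le_between in B3.
      unfold in_itv in Hw; apply Rabs_le; nra. }
    assert (C2 : Rabs (t3 - lt) <= 2 * Rabs k).
    { unfold t3; apply Rabs_le_between in B2; apply Rabs_le_between in B4.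
      unfold in_itv in Hw; apply Rabs_le; nra. }
    assert (Ds : Cmod (T s3 t3 - P) <= 2 * L * Rabs k).
    { replace (T s3 t3 - P)%C with (RtoC (s3 - ls) * u + RtoC (t3 - lt) * v)%C
        by (unfold P, T; rewrite !RtoC_minus; ring).
      apply Rle_trans with (1 := Cmod_triangle _ _).
      rewrite !Cmod_mult, !Cmod_R; unfold L.
      assert (Pu := Cmod_ge_0 u); assert (Pv := Cmod_ge_0 v); nra. }
    replace (f (T s3 t3) - (f P + d * (T s3 t3 - P)))%C
      with (f (T s3 t3) - f P - d * (T s3 t3 - P))%C by ring.
    apply Rle_trans with (q * Cmod (T s3 t3 - P)).
    + apply Hdl; apply Rle_lt_trans with (1 := Ds).
      apply Rle_lt_trans with ((2 * L + 1) * Rabs k); [nra|].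
      apply Rmult_lt_compat_l with (r := 2 * L + 1) in Hn; [|lra].
      replace ((2 * L + 1) * (dl / (2 * L + 1))) with dl in Hn by (field; lra); exact Hn.
    + apply Rmult_le_compat_l; lra.
  - replace (T s2 t2 - T s1 t1)%C with (RtoC (s2 - s1) * u + RtoC (t2 - t1) * v)%C
      by (unfold T; rewrite !RtoC_minus; ring).
    replace (k * k) with (Rabs k * Rabs k) by (rewrite <- Rabs_mult, Rabs_pos_eq; nra).
    apply Rle_trans with (q * (2 * L * Rabs k) * (Rabs k * L)); [|right; ring].
    apply Rmult_le_compat_l; [apply Rmult_le_pos; [lra|nra]|].
    apply Rle_trans with (1 := Cmod_triangle _ _).
    rewrite !Cmod_mult, !Cmod_R; unfold L.
    assert (Pu := Cmod_ge_0 u); assert (Pv := Cmod_ge_0 v); nra. }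
assert (Z : forall x y z w : R, x + (y - z) - w = x - w + (y - z)) by (intros; ring).
assert (Ks : Rabs (s + k - ls) <= 2 * Rabs k).
{ replace (s + k - ls) with ((s - ls) + k) by ring.
  apply Rle_trans with (1 := Rabs_triang _ _); lra. }
assert (Kt : Rabs (t + k - lt) <= 2 * Rabs k).
{ replace (t + k - lt) with ((t - lt) + k) by ring.
  apply Rle_trans with (1 := Rabs_triang _ _); lra. }
assert (E1 : Rabs (s + k - s) <= Rabs k) by (replace (s + k - s) with k by ring; lra).
assert (E2 : Rabs (t + k - t) <= Rabs k) by (replace (t + k - t) with k by ring; lra).
assert (E3 : Rabs (s - (s + k)) <= Rabs k)
  by (replace (s - (s + k)) with (- k) by ring; rewrite Rabs_Ropp; lra).
assert (E4 : Rabs (t - (t + k)) <= Rabs k)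
  by (replace (t - (t + k)) with (- k) by ring; rewrite Rabs_Ropp; lra).
assert (E5 : Rabs (s - s) <= Rabs k) by (rewrite Rminus_diag_eq, Rabs_R0; lra).
assert (E6 : Rabs (t - t) <= Rabs k) by (rewrite Rminus_diag_eq, Rabs_R0; lra).
assert (G1 := Edge s t (s + k) t V1 V2); assert (G2 := Edge (s + k) t s (t + k) V2 V3).
assert (G3 := Edge s (t + k) s t V3 V1).
unfold Itri.
set (i1 := Iseg f (T s t) _) in *; set (i2 := Iseg f (T (s + k) t) _) in *.
set (i3 := Iseg f (T s (t + k)) _) in *.
replace (i1 + i2 + i3)%C with ((i1 - (F (T (s + k) t) - F (T s t)))
  + (i2 - (F (T s (t + k)) - F (T (s + k) t))) + (i3 - (F (T s t) - F (T s (t + k)))))%C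
  by ring.
apply Rle_trans with (3 * (2 * q * (L * L) * (k * k))).
{ apply Rle_trans with (1 := Cmod_triangle _ _).
  apply Rle_trans with (1 := Rplus_le_compat_r _ _ _ (Cmod_triangle _ _)).
  assert (M1 := G1 ltac:(lra) ltac:(lra) ltac:(lra) ltac:(lra) ltac:(lra) ltac:(lra)).
  assert (M2 := G2 ltac:(lra) ltac:(lra) ltac:(lra) ltac:(lra) ltac:(lra) ltac:(lra)).
  assert (M3 := G3 ltac:(lra) ltac:(lra) ltac:(lra) ltac:(lra) ltac:(lra) ltac:(lra)).
  lra. }
assert (Eq : q * (6 * (L * L) + 1) = e) by (unfold q; field; lra).
assert (Hk : 0 <= k * k) by nra.
nra.
Qed.

End Goursat.

Lemma Goursat f a b c :
  (forall s t, 0 <= s /\ 0 <= t /\ s + t <= 1 ->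
     cdiff f (a + RtoC s * (b - a) + RtoC t * (c - a))%C) ->
  Itri f a b c = 0.
Proof.
intros Hf; assert (H := Goursat_J0 f a (b - a) (c - a) Hf).
cbv beta iota zeta in H; rewrite !Rplus_0_l in H.
replace (a + RtoC 0 * (b - a) + RtoC 0 * (c - a))%C with a in H by ring.
replace (a + RtoC 1 * (b - a) + RtoC 0 * (c - a))%C with b in H by ring.
replace (a + RtoC 0 * (b - a) + RtoC 1 * (c - a))%C with c in H by ring.
exact H.
Qed.

(** * Primitives on star-shaped domains *)

Definition star (p : C) (U : C -> Prop) : Prop :=
  openC U /\ U p /\ forall z t, U z -> in_itv 0 1 t -> U (seg p z t).

Lemma cts_eps_bound (f : C -> C) p : cts dC everywhere f p ->
  exists del, 0 < del /\ forall w, Cmod (w - p) < del -> Cmod (f w) <= Cmod (f p) + 1.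
Proof.
intros H; destruct (H 1) as (d & D & Hd); [lra|].
exists d; split; [easy|]; intros w Hw; specialize (Hd w I Hw).
assert (A := Cmod_sub_le (f w) (f p)); lra.
Qed.

Lemma small_multiples_zero (x : C) K : (forall e, 0 < e < 1 -> Cmod x <= K * e) -> x = 0.
Proof.
intros H; apply Cmod_eq_0; destruct (Req_dec (Cmod x) 0) as [|N]; [easy|exfalso].
assert (P := Cmod_ge_0 x).
assert (HK : 0 < Rabs K + 1) by (generalize (Rabs_pos K); lra).
set (e := Rmin (1 / 2) (Cmod x / (2 * (Rabs K + 1)))).
assert (He : 0 < e) by (apply Rmin_pos; [lra|]; apply Rdiv_lt_0_compat; lra).
assert (He1 : e <= 1 / 2) by apply Rmin_l.
assert (He2 : e * (2 * (Rabs K + 1)) <= Cmod x).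
{ apply Rle_trans with (Cmod x / (2 * (Rabs K + 1)) * (2 * (Rabs K + 1))); [|right; field; lra].
  apply Rmult_le_compat_r; [lra|apply Rmin_r]. }
specialize (H e ltac:(lra)).
assert (Q := Rle_abs K); nra.
Qed.

Section Primitive.
Variables (f : C -> C) (p : C) (U : C -> Prop).
Hypothesis HU : star p U.
Hypothesis Hf : forall z, U z -> z <> p -> cdiff f z.
Hypothesis Hp : cts dC everywhere f p.

Lemma primitive_cts z : U z -> cts dC everywhere f z.
Proof.
intros Uz; destruct (Ceq_dec z p) as [->|N]; [easy|]; apply cdiff_cts; auto.
Qed.

(** At [p] the integrand is only continuous, so Goursat does not apply to the whole triangle. Its
    corner at [p] is cut off at ratio [e]: the remaining quadrilateral splits into the triangles
    [pe z w] and [pe w qe], while the corner has perimeter of order [e] and [f] is bounded near [p].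
    The condition [r <= Cmod (z - p)] keeps the side from [z] to [w] away from [p]. Allowing an
    exceptional point makes the result apply to difference quotients. *)
Lemma primitive_triangle z r w : z <> p -> 0 < r -> r <= Cmod (z - p) ->
  (forall y, Cmod (y - z) < r -> U y) -> Cmod (w - z) < r ->
  (Iseg f p z + Iseg f z w)%C = Iseg f p w.
Proof.
intros Nz Hr Hr2 HB Hw.
destruct HU as (_ & Up & St).
assert (Bs : forall t, in_itv 0 1 t -> Cmod (seg z w t - z) < r).
{ intros t [T0 T1]; unfold seg.
  replace (z + RtoC t * (w - z) - z)%C with (RtoC t * (w - z))%C by ring.
  rewrite Cmod_mult, Cmod_R, Rabs_pos_eq by easy.
  assert (P := Cmod_ge_0 (w - z)); nra. }
assert (Good : forall t k, in_itv 0 1 t -> 0 < k <= 1 -> cdiff f (seg p (seg z w t) k)).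
{ intros t k Ht Hk; apply Hf.
  - apply St; [now apply HB, Bs|unfold in_itv; lra].
  - intros E; assert (E' : (RtoC k * (seg z w t - p))%C = 0).
    { unfold seg at 1 in E; apply Ceq_minus in E; rewrite <- E; ring. }
    apply (f_equal Cmod) in E'; rewrite Cmod_0, Cmod_mult, Cmod_R, Rabs_pos_eq in E' by lra.
    assert (B := Bs t Ht).
    assert (A := Cmod_sub_triangle z (seg z w t) p).
    rewrite (Cmod_sub_sym z (seg z w t)) in A.
    assert (0 < Cmod (seg z w t - p)) by lra; nra. }
assert (Uw : U w) by now apply HB.
assert (Uz : U z) by (apply HB; rewrite Cmod_sub_self; lra).
assert (Cw : forall t, in_itv 0 1 t -> cts dC everywhere f (seg p w t))
  by (intros; apply primitive_cts; auto).
assert (Cz : forall t, in_itv 0 1 t -> cts dC everywhere f (seg p z t))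
  by (intros; apply primitive_cts; auto).
destruct (cts_eps_bound f p Hp) as (d & D & Hd).
set (K := Cmod (z - p) + Cmod (w - p)).
assert (P1 := Cmod_ge_0 (z - p)); assert (P2 := Cmod_ge_0 (w - p)).
assert (HK : 0 <= K) by (unfold K; lra).
apply Ceq_minus.
set (B := Cmod (f p) + 1).
set (q := Rmin 1 (d / (K + 1))).
assert (Hq : 0 < q) by (apply Rmin_pos; [lra|]; apply Rdiv_lt_0_compat; lra).
assert (HqK : q * K < d).
{ apply Rlt_le_trans with (q * (K + 1)); [nra|].
  apply Rle_trans with (d / (K + 1) * (K + 1)); [|right; field; lra].
  apply Rmult_le_compat_r; [lra|apply Rmin_r]. }
assert (HB0 : 0 <= B) by (unfold B; generalize (Cmod_ge_0 (f p)); lra).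
apply small_multiples_zero with (B * (2 * K * q)).
intros e0 He0; set (e := e0 * q).
assert (He : 0 < e <= 1).
{ unfold e; assert (q <= 1) by apply Rmin_l; split; nra. }
assert (HeK : e * K < d).
{ apply Rle_lt_trans with (2 := HqK); unfold e; apply Rmult_le_compat_r; nra. }
assert (We : in_itv 0 1 e) by (unfold in_itv; lra).
assert (W0 : in_itv 0 1 0) by (unfold in_itv; lra).
assert (W1 : in_itv 0 1 1) by (unfold in_itv; lra).
set (pe := seg p z e); set (qe := seg p w e).
assert (Tr1 : Itri f pe z w = 0).
{ apply Goursat; intros s t (S0 & T0 & ST).
  (* The point of the triangle lies on the ray from [p] through the point of parameter [t / k] of
     the opposite side, at the fraction [k >= e] of that ray. *)
  set (k := e * (1 - s - t) + s + t).
  assert (Hk : e <= k <= 1) by (unfold k; nra).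
  replace (_ + _ + _)%C with (seg p (seg z w (t / k)) k).
  - apply Good; [|lra]; split.
    + apply Rmult_le_pos; [easy|]; left; apply Rinv_0_lt_compat; lra.
    + apply Rmult_le_reg_r with k; [lra|]; unfold Rdiv; rewrite Rmult_assoc, Rinv_l by lra.
      unfold k; nra.
  - unfold seg at 1 2.
    replace (p + RtoC k * (z + RtoC (t / k) * (w - z) - p))%C
      with (p + RtoC k * (z - p) + RtoC (k * (t / k)) * (w - z))%C
      by (rewrite RtoC_mult; ring).
    replace (k * (t / k)) with t by (field; lra).
    unfold pe, seg, k; rewrite !RtoC_plus, !RtoC_mult, !RtoC_minus; ring. }
assert (Tr2 : Itri f pe w qe = 0).
{ apply Goursat; intros s t (S0 & T0 & ST).
  set (k := e * (1 - s) + s).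
  assert (Hk : e <= k <= 1) by (unfold k; nra).
  replace (_ + _ + _)%C with (seg p (seg z w ((s + t * e) / k)) k).
  - apply Good; [|lra]; split.
    + apply Rmult_le_pos; [nra|]; left; apply Rinv_0_lt_compat; lra.
    + apply Rmult_le_reg_r with k; [lra|]; unfold Rdiv; rewrite Rmult_assoc, Rinv_l by lra.
      unfold k; nra.
  - unfold seg at 1 2.
    replace (p + RtoC k * (z + RtoC ((s + t * e) / k) * (w - z) - p))%C
      with (p + RtoC k * (z - p) + RtoC (k * ((s + t * e) / k)) * (w - z))%C
      by (rewrite RtoC_mult; ring).
    replace (k * ((s + t * e) / k)) with (s + t * e) by (field; lra).
    unfold pe, qe, seg, k; rewrite !RtoC_plus, !RtoC_mult, !RtoC_minus; ring. }
assert (S1 : (Iseg f p pe + Iseg f pe z)%C = Iseg f p z).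
{ assert (X1 := Iseg_sub f p z 0 e W0 We Cz); assert (X2 := Iseg_sub f p z e 1 We W1 Cz).
  rewrite seg_0 in X1; rewrite seg_1 in X2; fold pe in X1, X2; rewrite X1, X2.
  rewrite <- Cmult_plus_distr_l, CInt_Chasles by (try lra; (apply rcts_comp; [easy|apply rcts_line])).
  reflexivity. }
assert (S2 : (Iseg f p qe + Iseg f qe w)%C = Iseg f p w).
{ assert (X1 := Iseg_sub f p w 0 e W0 We Cw); assert (X2 := Iseg_sub f p w e 1 We W1 Cw).
  rewrite seg_0 in X1; rewrite seg_1 in X2; fold qe in X1, X2; rewrite X1, X2.
  rewrite <- Cmult_plus_distr_l, CInt_Chasles by (try lra; (apply rcts_comp; [easy|apply rcts_line])).
  reflexivity. }
assert (Near : forall y t, in_itv 0 1 t -> Cmod (y - p) <= K -> U y ->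
   in_itv 0 1 t -> Cmod (seg p (seg p y e) t - p) < d).
{ intros y t Ht Hy _ _; unfold seg.
  replace (p + RtoC t * (p + RtoC e * (y - p) - p) - p)%C
    with (RtoC (t * e) * (y - p))%C by (rewrite RtoC_mult; ring).
  unfold in_itv in Ht.
  rewrite Cmod_mult, Cmod_R, Rabs_pos_eq by nra.
  assert (Cmod (y - p) >= 0) by (apply Rle_ge, Cmod_ge_0).
  assert (t * e * Cmod (y - p) <= e * K).
  { apply Rmult_le_compat; nra. }
  lra. }
assert (Edge : forall y1 y2, (forall t, in_itv 0 1 t -> U (seg y1 y2 t)) ->
   (forall t, in_itv 0 1 t -> Cmod (seg y1 y2 t - p) < d) ->
   Cmod (y2 - y1) <= e * K -> Cmod (Iseg f y1 y2) <= B * (e * K)).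
{ intros y1 y2 HUs HN HL; apply Rle_trans with (B * Cmod (y2 - y1)).
  - apply Iseg_bound; [intros; apply primitive_cts; auto|]; intros; apply Hd; auto.
  - apply Rmult_le_compat_l; easy. }
assert (I1 : Cmod (Iseg f p pe) <= B * (e * Cmod (z - p))).
{ replace (e * Cmod (z - p)) with (Cmod (pe - p)).
  2:{ unfold pe, seg; replace (p + RtoC e * (z - p) - p)%C with (RtoC e * (z - p))%C by ring.
      rewrite Cmod_mult, Cmod_R, Rabs_pos_eq; lra. }
  apply Iseg_bound.
  - intros t Ht; apply primitive_cts, St; auto; unfold pe; auto.
  - intros t Ht; apply Hd; unfold pe; apply Near; auto; unfold K; lra. }
assert (I2 : Cmod (Iseg f p qe) <= B * (e * Cmod (w - p))).
{ replace (e * Cmod (w - p)) with (Cmod (qe - p)).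
  2:{ unfold qe, seg; replace (p + RtoC e * (w - p) - p)%C with (RtoC e * (w - p))%C by ring.
      rewrite Cmod_mult, Cmod_R, Rabs_pos_eq; lra. }
  apply Iseg_bound.
  - intros t Ht; apply primitive_cts, St; auto; unfold qe; auto.
  - intros t Ht; apply Hd; unfold qe; apply Near; auto; unfold K; lra. }
assert (Mid : forall t, seg pe qe t = seg p (seg z w t) e).
{ intros t; unfold pe, qe, seg; ring. }
assert (Cpq : forall t, in_itv 0 1 t -> cts dC everywhere f (seg pe qe t)).
{ intros t Ht; rewrite Mid; apply cdiff_cts, Good; auto; lra. }
assert (I3 : Cmod (Iseg f pe qe) <= B * (e * K)).
{ apply Rle_trans with (B * Cmod (qe - pe)).
  - apply Iseg_bound; auto.
    intros t Ht; apply Hd; rewrite Mid; unfold seg at 1.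
    replace (p + RtoC e * (seg z w t - p) - p)%C
      with (RtoC e * (RtoC (1 - t) * (z - p) + RtoC t * (w - p)))%C
      by (unfold seg; rewrite RtoC_minus; ring).
    rewrite Cmod_mult, Cmod_R, Rabs_pos_eq by lra.
    apply Rle_lt_trans with (2 := HeK), Rmult_le_compat_l; [lra|].
    apply Rle_trans with (1 := Cmod_triangle _ _).
    unfold in_itv in Ht; rewrite !Cmod_mult, !Cmod_R, !Rabs_pos_eq by lra.
    unfold K; nra.
  - apply Rmult_le_compat_l; [easy|].
    replace (qe - pe)%C with (RtoC e * ((w - p) - (z - p)))%C by (unfold pe, qe, seg; ring).
    rewrite Cmod_mult, Cmod_R, Rabs_pos_eq by lra.
    apply Rmult_le_compat_l; [lra|]; unfold K.
    apply Rle_trans with (1 := Cmod_sub_le_sum _ _); lra. }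
assert (Sw1 : Iseg f w pe = (- Iseg f pe w)%C).
{ apply Iseg_swap; intros t Ht.
  replace (seg pe w t) with (seg p (seg z w (t / (e * (1 - t) + t))) (e * (1 - t) + t)).
  - unfold in_itv in *; assert (X : e <= e * (1 - t) + t <= 1) by nra.
    apply cdiff_cts, Good; [|lra]; split.
    + apply Rmult_le_pos; [easy|]; left; apply Rinv_0_lt_compat; lra.
    + apply Rmult_le_reg_r with (e * (1 - t) + t); [lra|].
      unfold Rdiv; rewrite Rmult_assoc, Rinv_l by lra; nra.
  - set (k := e * (1 - t) + t).
    assert (X : e <= k <= 1) by (unfold k, in_itv in *; nra).
    unfold seg at 1 2.
    replace (p + RtoC k * (z + RtoC (t / k) * (w - z) - p))%C
      with (p + RtoC k * (z - p) + RtoC (k * (t / k)) * (w - z))%C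
      by (rewrite RtoC_mult; ring).
    replace (k * (t / k)) with t by (field; lra).
    unfold pe, seg, k; rewrite !RtoC_plus, !RtoC_mult, !RtoC_minus; ring. }
assert (Sw2 : Iseg f w qe = (- Iseg f qe w)%C).
{ apply Iseg_swap; intros t Ht; apply primitive_cts.
  replace (seg qe w t) with (seg p w (e * (1 - t) + t))
    by (unfold qe, seg; rewrite !RtoC_plus, !RtoC_mult, !RtoC_minus; ring).
  apply St; auto; unfold in_itv in *; nra. }
assert (Sw3 : Iseg f qe pe = (- Iseg f pe qe)%C) by now apply Iseg_swap.
unfold Itri in Tr1, Tr2; rewrite Sw1 in Tr1; rewrite Sw2, Sw3 in Tr2.
rewrite <- S1, <- S2.
replace (Iseg f p pe + Iseg f pe z + Iseg f z w - (Iseg f p qe + Iseg f qe w))%C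
  with ((Iseg f pe z + Iseg f z w + - Iseg f pe w)
    + (Iseg f pe w + - Iseg f qe w + - Iseg f pe qe)
    + (Iseg f p pe + Iseg f pe qe - Iseg f p qe))%C by ring.
rewrite Tr1, Tr2, !Cplus_0_l.
apply Rle_trans with (1 := Cmod_sub_le_sum _ _).
apply Rle_trans with (1 := Rplus_le_compat_r _ _ _ (Cmod_triangle _ _)).
apply Rle_trans with (B * (e * Cmod (z - p)) + B * (e * K) + B * (e * Cmod (w - p))); [lra|].
unfold e, K; right; ring.
Qed.

Lemma primitive_star : forall z, U z -> cder (Iseg f p) z (f z).
Proof.
intros z Uz; destruct HU as (Op & Up & St).
destruct (Op z Uz) as (r0 & Hr0 & HB0).
assert (Hdiff : exists r, 0 < r /\ (forall y, Cmod (y - z) < r -> U y) /\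
  forall w, Cmod (w - z) < r -> (Iseg f p w - Iseg f p z)%C = Iseg f z w).
{ destruct (Ceq_dec z p) as [->|N].
  - exists r0; split; [easy|split; [easy|]]; intros w Hw.
    replace (Iseg f p p) with (RtoC 0) by (unfold Iseg; ring); ring.
  - exists (Rmin r0 (Cmod (z - p))); split; [|split].
    + apply Rmin_pos; [easy|]; apply Cmod_gt_0; intros E; apply N; now apply Ceq_minus.
    + intros y Hy; apply HB0, Rlt_le_trans with (1 := Hy), Rmin_l.
    + intros w Hw; rewrite <- (primitive_triangle z (Rmin r0 (Cmod (z - p))) w); auto.
      * ring.
      * apply Rmin_pos; [easy|]; apply Cmod_gt_0; intros E; apply N; now apply Ceq_minus.
      * apply Rmin_r.
      * intros y Hy; apply HB0, Rlt_le_trans with (1 := Hy), Rmin_l. }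
destruct Hdiff as (r & Hr & HB & Hd).
intros e He; destruct (primitive_cts z Uz e He) as (d & D & Hc).
exists (Rmin d r); split; [now apply Rmin_pos|]; intros w Hw.
assert (A1 := Rlt_le_trans _ _ _ Hw (Rmin_l _ _)).
assert (A2 := Rlt_le_trans _ _ _ Hw (Rmin_r _ _)).
rewrite Hd by easy.
assert (Bs : forall t, in_itv 0 1 t -> Cmod (seg z w t - z) <= Cmod (w - z)).
{ intros t [T0 T1]; unfold seg.
  replace (z + RtoC t * (w - z) - z)%C with (RtoC t * (w - z))%C by ring.
  rewrite Cmod_mult, Cmod_R, Rabs_pos_eq by easy.
  assert (P := Cmod_ge_0 (w - z)); nra. }
assert (Cf : forall t, in_itv 0 1 t -> cts dC everywhere f (seg z w t)).
{ intros t Ht; apply primitive_cts, HB, Rle_lt_trans with (1 := Bs t Ht); easy. }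
replace (f z * (w - z))%C with (Iseg (fun _ => f z) z w).
2:{ unfold Iseg; rewrite CInt_const, Rminus_0_r; ring. }
rewrite <- Iseg_minus; auto.
2:{ intros; apply cts_const. }
apply Iseg_bound.
- intros t Ht; apply cts_minus; [now apply Cf|apply cts_const].
- intros t Ht; left; apply Hc; [easy|]; apply Rle_lt_trans with (1 := Bs t Ht); easy.
Qed.

End Primitive.

Definition odisk (p : C) (r : R) (z : C) : Prop := Cmod (z - p) < r.

Lemma odisk_open p r : openC (odisk p r).
Proof.
intros z Hz; unfold odisk in *; exists (r - Cmod (z - p)); split; [lra|].
intros w Hw; assert (A := Cmod_sub_triangle w z p); lra.
Qed.

Lemma odisk_star p r q : odisk p r q -> star q (odisk p r).
Proof.
intros Hq; split; [apply odisk_open|split; [easy|]]; intros z t Hz [T0 T1].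
unfold odisk, seg in *.
replace (q + RtoC t * (z - q) - p)%C
  with (RtoC (1 - t) * (q - p) + RtoC t * (z - p))%C by (rewrite RtoC_minus; ring).
apply Rle_lt_trans with (1 := Cmod_triangle _ _).
rewrite !Cmod_mult, !Cmod_R, !Rabs_pos_eq by lra.
destruct (Req_dec t 0) as [->|N]; [lra|].
assert (t * Cmod (z - p) < t * r) by (apply Rmult_lt_compat_l; lra); nra.
Qed.

(** * Cauchy's formula *)

Lemma cts_cslope_off f p d z S : z <> p -> cdiff f z -> cdiff (cslope f p d) z /\ cts dC S (cslope f p d) z.
Proof.
intros N Hf.
assert (N' : (z - p)%C <> 0) by (intros E; apply N; now apply Ceq_minus).
assert (H : cdiff (cslope f p d) z).
{ apply (cdiff_ext_loc (fun w => (f w - f p) / (w - p))%C) with (r := Cmod (z - p)).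
  - now apply Cmod_gt_0.
  - intros w Hw; unfold cslope; destruct (Ceq_dec w p) as [->|]; [|easy].
    rewrite Cmod_sub_sym in Hw; lra.
  - apply cdiff_div; auto.
    + apply cdiff_minus; [easy|apply cdiff_const].
    + apply cdiff_minus; [apply cdiff_id|apply cdiff_const]. }
split; [easy|now apply cdiff_cts].
Qed.

(** A quadratic remainder, uniform along the interval of integration, lets the derivative pass under
    the integral sign. *)
Lemma cder_CInt (k : C -> R -> C) (k1 : R -> C) w a b r M : a <= b -> 0 < r ->
  (forall w', Cmod (w' - w) < r -> rcts a b (k w')) -> rcts a b k1 ->
  (forall w' s, Cmod (w' - w) < r -> in_itv a b s ->
     Cmod (k w' s - k w s - k1 s * (w' - w)) <= M * (Cmod (w' - w) * Cmod (w' - w))) ->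
  cder (fun w' => CInt (k w') a b) w (CInt k1 a b).
Proof.
intros Hab Hr Hk Hk1 HM e He.
set (L := Rabs M * (b - a) + 1).
assert (HL : 0 < L).
{ unfold L; assert (P := Rabs_pos M); assert (0 <= Rabs M * (b - a)) by (apply Rmult_le_pos; lra); lra. }
exists (Rmin r (e / L)); split; [apply Rmin_pos; auto; now apply Rdiv_lt_0_compat|].
intros w' Hw.
assert (A1 := Rlt_le_trans _ _ _ Hw (Rmin_l _ _)).
assert (A2 := Rlt_le_trans _ _ _ Hw (Rmin_r _ _)).
assert (Hw0 : rcts a b (k w)) by (apply Hk; rewrite Cmod_sub_self; lra).
replace (CInt k1 a b * (w' - w))%C with ((w' - w) * CInt k1 a b)%C by ring.
rewrite <- CInt_scal by easy.
rewrite <- CInt_minus by auto.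
rewrite <- CInt_minus by auto using rcts_minus, rcts_scal.
set (x := Cmod (w' - w)) in *.
assert (Px : 0 <= x) by apply Cmod_ge_0.
apply Rle_trans with (Rabs M * (x * x) * (b - a)).
- apply CInt_bound; [easy| |].
  + apply rcts_minus; [apply rcts_minus; auto|now apply rcts_scal].
  + intros t Ht.
    replace (k w' t - k w t - (w' - w) * k1 t)%C
      with (k w' t - k w t - k1 t * (w' - w))%C by ring.
    apply Rle_trans with (1 := HM w' t A1 Ht); fold x.
    apply Rmult_le_compat_r; [nra|apply Rle_abs].
- assert (B : L * x <= e).
  { apply Rmult_lt_compat_l with (r := L) in A2; [|easy].
    replace (L * (e / L)) with e in A2 by (field; lra); lra. }
  unfold L in B; nra.
Qed.

Section CauchyKernel.
Variables (r Mk : R) (k : R -> C).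
Hypothesis Hr : 0 < r.
Hypothesis Hk : rcts 0 (2 * PI) k.
Hypothesis HMk : forall s, in_itv 0 (2 * PI) s -> Cmod (k s) <= Mk.

Definition circ (s : R) : C := (RtoC r * cis s)%C.

Lemma Cmod_cis s : Cmod (cis s) = 1.
Proof.
unfold Cmod, cis; simpl fst; simpl snd.
replace (cos s ^ 2 + sin s ^ 2) with 1; [apply sqrt_1|].
generalize (sin2_cos2 s); unfold Rsqr; nra.
Qed.

Lemma Cmod_circ s : Cmod (circ s) = r.
Proof. unfold circ; rewrite Cmod_mult, Cmod_cis, Cmod_R, Rabs_pos_eq; lra. Qed.

Lemma rder_circ s : rder circ s (Ci * circ s).
Proof.
unfold circ; apply (rder_eq _ _ (0 * cis s + RtoC r * (Ci * cis s))%C); [|ring].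
apply (rder_mult (fun _ => RtoC r)); [apply rder_const|apply rder_cis].
Qed.

Lemma rcts_circ a b : rcts a b circ.
Proof. intros s _; eapply rder_cts, rder_circ. Qed.

Lemma circ_sub s w : Cmod w < r -> r - Cmod w <= Cmod (circ s - w).
Proof.
intros Hw; assert (A := Cmod_sub_le (circ s) w); rewrite Cmod_circ in A; lra.
Qed.

Lemma circ_sub_neq s w : Cmod w < r -> (circ s - w)%C <> 0.
Proof. intros Hw; apply Cmod_gt_0; assert (A := circ_sub s w Hw); lra. Qed.

Lemma rcts_circ_inv w : Cmod w < r -> rcts 0 (2 * PI) (fun s => / (circ s - w))%C.
Proof.
intros Hw s Hs; apply cts_Cinv; [now apply circ_sub_neq|].
apply cts_minus; [now apply rcts_circ|apply cts_const].
Qed.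

(** Cauchy-type integral with an arbitrary continuous density, followed by its first two derivatives
    in [w]. In the applications the factor [Ci * circ] of the line element is part of the
    density. *)
Definition cauchy1 (w : C) : C := CInt (fun s => k s * / (circ s - w))%C 0 (2 * PI).
Definition cauchy2 (w : C) : C :=
  CInt (fun s => k s * (/ (circ s - w) * / (circ s - w)))%C 0 (2 * PI).
Definition cauchy3 (w : C) : C :=
  CInt (fun s => k s * (2 * (/ (circ s - w) * / (circ s - w) * / (circ s - w))))%C 0 (2 * PI).

Lemma two_pi_pos : 0 <= 2 * PI.
Proof. generalize PI_RGT_0; lra. Qed.

Lemma Mk_pos : 0 <= Mk.
Proof.
apply Rle_trans with (Cmod (k 0)); [apply Cmod_ge_0|]; apply HMk.
split; [lra|apply two_pi_pos].
Qed.

Lemma cauchy1_der w : Cmod w < r -> cder cauchy1 w (cauchy2 w).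
Proof.
intros Hw; set (q := r - Cmod w); assert (Hq : 0 < q) by (unfold q; lra).
assert (In : forall w', Cmod (w' - w) < q / 2 -> Cmod w' < r).
{ intros w' H; assert (A := Cmod_sub_le w' w); unfold q in H; lra. }
assert (Q := Mk_pos).
apply (cder_CInt (fun w' s => k s * / (circ s - w'))%C) with (r := q / 2) (M := Mk * (2 / (q * q * q))).
- apply two_pi_pos.
- lra.
- intros w' H; apply rcts_mult; [easy|]; now apply rcts_circ_inv, In.
- apply rcts_mult; [easy|]; apply rcts_mult; now apply rcts_circ_inv.
- intros w' s H Hs.
  assert (N := circ_sub_neq s w Hw); assert (N' := circ_sub_neq s w' (In w' H)).
  assert (B := circ_sub s w Hw); fold q in B.
  set (u := (circ s - w)%C) in *; set (h := (w' - w)%C) in *.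
  replace (circ s - w')%C with (u - h)%C in * by (unfold u, h; ring).
  replace (k s * / (u - h) - k s * / u - k s * (/ u * / u) * h)%C
    with (k s * ((h * h) * / (u * u * (u - h))))%C by (field; auto).
  rewrite Cmod_mult, Rmult_assoc.
  assert (B' := Cmod_sub_le u h).
  assert (Pu : 0 < Cmod u) by lra.
  assert (Puh : q / 2 <= Cmod (u - h)) by lra.
  apply Rmult_le_compat; auto using Cmod_ge_0.
  rewrite !Cmod_mult, Cmod_inv by (repeat apply Cmult_neq_0; auto).
  rewrite !Cmod_mult, Rmult_comm.
  apply Rmult_le_compat_r; [generalize (Cmod_ge_0 h); nra|].
  replace (2 / (q * q * q)) with (/ (q * q * (q / 2))) by (field; lra).
  apply Rinv_le_contravar; [repeat apply Rmult_lt_0_compat; lra|].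
  apply Rmult_le_compat; nra.
Qed.

Lemma cauchy2_der w : Cmod w < r -> cder cauchy2 w (cauchy3 w).
Proof.
intros Hw; set (q := r - Cmod w); assert (Hq : 0 < q) by (unfold q; lra).
assert (In : forall w', Cmod (w' - w) < q / 2 -> Cmod w' < r).
{ intros w' H; assert (A := Cmod_sub_le w' w); unfold q in H; lra. }
assert (Q := Mk_pos).
apply (cder_CInt (fun w' s => k s * (/ (circ s - w') * / (circ s - w')))%C)
  with (r := q / 2) (M := Mk * (16 / (q * q * q * q))).
- apply two_pi_pos.
- lra.
- intros w' H; apply rcts_mult; [easy|]; apply rcts_mult; now apply rcts_circ_inv, In.
- apply rcts_mult; [easy|]; apply rcts_mult; [apply rcts_const|].
  repeat apply rcts_mult; now apply rcts_circ_inv.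
- intros w' s H Hs.
  assert (N := circ_sub_neq s w Hw); assert (N' := circ_sub_neq s w' (In w' H)).
  assert (B := circ_sub s w Hw); fold q in B.
  set (u := (circ s - w)%C) in *; set (h := (w' - w)%C) in *.
  replace (circ s - w')%C with (u - h)%C in * by (unfold u, h; ring).
  replace (k s * (/ (u - h) * / (u - h)) - k s * (/ u * / u) - k s * (2 * (/ u * / u * / u)) * h)%C
    with (k s * ((h * h) * ((3 * u - 2 * h) * / (u * u * u * ((u - h) * (u - h))))))%C
    by (field; auto).
  rewrite Cmod_mult, Rmult_assoc.
  assert (B' := Cmod_sub_le u h).
  assert (Pu : 0 < Cmod u) by lra.
  assert (Puh : q / 2 <= Cmod (u - h)) by lra.
  apply Rmult_le_compat; auto using Cmod_ge_0.
  rewrite (Cmod_mult (h * h)), (Cmod_mult h h), Rmult_comm.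
  apply Rmult_le_compat_r; [generalize (Cmod_ge_0 h); nra|].
  rewrite Cmod_mult, Cmod_inv by (repeat apply Cmult_neq_0; auto).
  rewrite !Cmod_mult.
  assert (T : Cmod (3 * u - 2 * h) <= 4 * Cmod u).
  { apply Rle_trans with (1 := Cmod_sub_le_sum _ _).
    rewrite !Cmod_mult, !Cmod_R, !Rabs_pos_eq by lra; lra. }
  apply Rle_trans with (4 * Cmod u * / (Cmod u * Cmod u * Cmod u * (q / 2 * (q / 2)))).
  + apply Rmult_le_compat; auto using Cmod_ge_0.
    { left; apply Rinv_0_lt_compat; repeat apply Rmult_lt_0_compat; lra. }
    apply Rinv_le_contravar; [repeat apply Rmult_lt_0_compat; lra|].
    apply Rmult_le_compat_l; [repeat apply Rmult_le_pos; lra|].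
    apply Rmult_le_compat; lra.
  + replace (4 * Cmod u * / (Cmod u * Cmod u * Cmod u * (q / 2 * (q / 2))))
      with (16 * / (Cmod u * Cmod u * (q * q))) by (field; lra).
    replace (16 / (q * q * q * q)) with (16 * / (q * q * (q * q))) by (field; lra).
    apply Rmult_le_compat_l; [lra|].
    apply Rinv_le_contravar; [repeat apply Rmult_lt_0_compat; lra|].
    apply Rmult_le_compat_r; [nra|]; apply Rmult_le_compat; lra.
Qed.

End CauchyKernel.

Lemma circ_periodic r : circ r (2 * PI) = circ r 0.
Proof. unfold circ, cis; now rewrite cos_2PI, sin_2PI, cos_0, sin_0. Qed.

Lemma slope_primitive f p r w : odisk p r w -> hol (odisk p r) f ->
  exists P, forall z, odisk p r z -> cder P z (cslope f w (C_derive f w) z).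
Proof.
intros Hw Hf; exists (Iseg (cslope f w (C_derive f w)) w).
apply primitive_star.
- now apply odisk_star.
- intros z Hz N; now apply (cts_cslope_off f w (C_derive f w) z everywhere), Hf.
- apply cslope_cts, cdiff_cder; auto.
Qed.

(** The slope of [g] at [w] has a primitive on the disk, so its integral over the circle vanishes by
    periodicity. The winding integral on the right is left unevaluated: later it only has to be
    nonzero near the centre, where [cauchy1_unit] gives its value. *)
Lemma Cauchy_formula g R0 r w : 0 < r < R0 -> Cmod w < r -> hol (odisk 0 R0) g ->
  cauchy1 r (fun s => g (circ r s) * (Ci * circ r s))%C w
   = (g w * cauchy1 r (fun s => Ci * circ r s)%C w)%C.
Proof.
intros Hr Hw Hg.
assert (Bw : odisk 0 R0 w) by (unfold odisk; replace (w - 0)%C with w by ring; lra).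
assert (Bc : forall s, odisk 0 R0 (circ r s)).
{ intros s; unfold odisk; replace (circ r s - 0)%C with (circ r s) by ring.
  rewrite Cmod_circ; lra. }
destruct (slope_primitive g 0 R0 w Bw Hg) as [P HP].
assert (Hr' : 0 < r) by lra.
assert (T := two_pi_pos).
assert (Cg : rcts 0 (2 * PI) (fun s => g (circ r s))).
{ apply rcts_comp; [|apply rcts_circ]; intros; apply cdiff_cts; auto. }
assert (Cd : rcts 0 (2 * PI) (fun s => Ci * circ r s)%C)
  by (apply rcts_scal, rcts_circ).
assert (Ci' : rcts 0 (2 * PI) (fun s => / (circ r s - w))%C)
  by (apply rcts_circ_inv; lra).
assert (X : CInt (fun s => cslope g w (C_derive g w) (circ r s) * (Ci * circ r s))%C 0 (2 * PI) = 0).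
{ rewrite (CInt_ftc 0 (2 * PI) (fun s => P (circ r s))); auto.
  - rewrite circ_periodic; ring.
  - intros t Ht; apply rder_comp; auto using rder_circ.
  - apply rcts_mult; [|easy].
    apply rcts_comp; [|apply rcts_circ]; intros t Ht; apply cts_cslope_off; auto.
    intros E; rewrite <- E, Cmod_circ in Hw; lra. }
apply Ceq_minus; rewrite <- X; unfold cauchy1.
rewrite <- CInt_scal by (auto; now apply rcts_mult).
rewrite <- CInt_minus; auto.
- apply CInt_ext; [easy|]; intros t Ht; unfold cslope.
  destruct (Ceq_dec (circ r t) w) as [E|N].
  { rewrite <- E, Cmod_circ in Hw; lra. }
  field; intros E; apply N; now apply Ceq_minus.
- apply rcts_mult; [|easy]; now apply rcts_mult.
- apply rcts_scal; now apply rcts_mult.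
Qed.

Lemma cauchy1_unit r : 0 < r -> cauchy1 r (fun s => Ci * circ r s)%C 0 = (RtoC (2 * PI) * Ci)%C.
Proof.
intros Hr; unfold cauchy1.
rewrite (CInt_ext _ _ _ (fun _ => Ci)) by
 (try apply two_pi_pos; intros; field; apply Cmod_gt_0; rewrite ?Cmod_circ; try lra;
  replace (circ r t - 0)%C with (circ r t) by ring; rewrite Cmod_circ; lra).
now rewrite CInt_const, Rminus_0_r.
Qed.

(** Near 0 the function is the quotient of two Cauchy-type integrals, [N / J]. The derivative of
    this quotient is explicit and again differentiable, since the integrals can be differentiated
    twice. *)
Lemma cdiff_C_derive_ball0 g R0 : 0 < R0 -> hol (odisk 0 R0) g -> cdiff (C_derive g) 0.
Proof.
intros HR Hg; set (r := R0 / 2); assert (Hr : 0 < r) by (unfold r; lra).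
set (k1 := fun s => (Ci * circ r s)%C).
set (k2 := fun s => (g (circ r s) * (Ci * circ r s))%C).
assert (C1 : rcts 0 (2 * PI) k1) by (apply rcts_scal, rcts_circ).
assert (Bc : forall s, odisk 0 R0 (circ r s)).
{ intros s; unfold odisk; replace (circ r s - 0)%C with (circ r s) by ring.
  rewrite Cmod_circ; unfold r; lra. }
assert (C2 : rcts 0 (2 * PI) k2).
{ apply rcts_mult; [|easy]; apply rcts_comp; [|apply rcts_circ]; intros; apply cdiff_cts; auto. }
assert (M1 : forall s, in_itv 0 (2 * PI) s -> Cmod (k1 s) <= r).
{ intros s _; unfold k1; rewrite Cmod_mult, Cmod_Ci, Cmod_circ; lra. }
destruct (compact_max (circle r) (fun z => RtoC (Cmod (g z)))) as (z0 & Z0 & HM).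
{ apply circle_compact. }
{ exists (circ r 0); unfold circle; now apply Cmod_circ. }
{ intros z Hz; apply cts_Cmod, cdiff_cts, Hg; unfold odisk.
  replace (z - 0)%C with z by ring; unfold circle in Hz; rewrite Hz; unfold r; lra. }
simpl in HM.
assert (M2 : forall s, in_itv 0 (2 * PI) s -> Cmod (k2 s) <= Cmod (g z0) * r).
{ intros s _; unfold k2; rewrite !Cmod_mult, Cmod_Ci, Cmod_circ, Rmult_1_l by easy.
  apply Rmult_le_compat_r; [lra|]; apply HM; unfold circle; now apply Cmod_circ. }
set (N := cauchy1 r k2); set (J := cauchy1 r k1).
set (N' := cauchy2 r k2); set (J' := cauchy2 r k1).
assert (HN : forall w, Cmod w < r -> cder N w (N' w)) by (intros; eapply cauchy1_der; eauto).
assert (HJ : forall w, Cmod w < r -> cder J w (J' w)) by (intros; eapply cauchy1_der; eauto).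
assert (HN' : forall w, Cmod w < r -> cdiff N' w)
  by (intros; eexists; eapply cauchy2_der; eauto).
assert (HJ' : forall w, Cmod w < r -> cdiff J' w)
  by (intros; eexists; eapply cauchy2_der; eauto).
assert (J0 : J 0 <> 0).
{ unfold J, k1; rewrite cauchy1_unit by easy; apply Cmult_neq_0; [|apply Ci_nz].
  intros E; apply RtoC_inj in E; generalize PI_RGT_0; lra. }
assert (P0 : Cmod 0 < r) by (rewrite Cmod_0; lra).
destruct (cder_cts J 0 (J' 0) everywhere (HJ 0 P0) (Cmod (J 0))) as (d & D & Hd).
{ now apply Cmod_gt_0. }
assert (Jn : forall w, Cmod w < d -> J w <> 0).
{ intros w Hw E; specialize (Hd w I).
  replace (dC w 0) with (Cmod w) in Hd by (unfold dC; f_equal; ring).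
  specialize (Hd Hw); rewrite E in Hd.
  replace (0 - J 0)%C with (- J 0)%C in Hd by ring; rewrite Cmod_opp in Hd; lra. }
set (q := Rmin r d).
assert (Hq : 0 < q) by (now apply Rmin_pos).
assert (Hqr : q <= r) by apply Rmin_l.
assert (Hqd : q <= d) by apply Rmin_r.
assert (Eg : forall w, Cmod w < q -> (N w / J w)%C = g w).
{ intros w Hw; unfold N, J, k1, k2; rewrite (Cauchy_formula g R0); auto.
  - fold k1; field; apply Jn; lra.
  - unfold r; lra.
  - lra. }
assert (Dg : forall w, Cmod w < q ->
  cder g w ((N' w * J w - N w * J' w) / (J w * J w))%C).
{ intros w Hw.
  apply (cder_ext_loc (fun w => N w / J w)%C) with (r := q - Cmod w); [lra| |].
  - intros w' Hw'; apply Eg; assert (A := Cmod_sub_le w' w); lra.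
  - apply cder_div; [apply Jn; lra|apply HN; lra|apply HJ; lra]. }
apply (cdiff_ext_loc (fun w => (N' w * J w - N w * J' w) / (J w * J w))%C) with (r := q); auto.
- intros w Hw; replace (w - 0)%C with w in Hw by ring.
  symmetry; apply cder_C_derive; auto.
- assert (JJ : (J 0 * J 0)%C <> 0) by now apply Cmult_neq_0.
  apply cdiff_div; auto.
  + apply cdiff_minus; apply cdiff_mult; auto; eexists; eauto.
  + apply cdiff_mult; eexists; eauto.
Qed.

Theorem hol_C_derive V f : openC V -> hol V f -> hol V (C_derive f).
Proof.
intros OV Hf p Vp; destruct (OV p Vp) as (r & Hr & HB).
set (g := fun w => f (p + w)%C).
assert (Tr : forall h a z, cder h (p + z)%C a -> cder (fun w => h (p + w)%C) z a).
{ intros h a z Hh; apply (cder_eq _ _ (a * (0 + 1))%C); [|ring].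
  apply (cder_comp h (fun w => p + w)%C); [easy|].
  apply cder_plus; [apply cder_const|apply cder_id]. }
assert (Hg : hol (odisk 0 r) g).
{ intros z Hz; destruct (Hf (p + z)%C) as [a Ha].
  - apply HB; unfold odisk in Hz; replace (p + z - p)%C with (z - 0)%C by ring; easy.
  - exists a; now apply Tr. }
assert (H0 := cdiff_C_derive_ball0 g r Hr Hg).
apply (cdiff_ext_loc (fun z => C_derive g (z - p)%C)) with (r := r); auto.
- intros w Hw; apply cder_C_derive, Tr.
  replace (p + (w - p))%C with w by ring; apply cdiff_cder, Hf, HB; easy.
- apply (cdiff_comp (C_derive g) (fun z => z - p)%C).
  + now replace (p - p)%C with (RtoC 0) by ring.
  + apply cdiff_minus; [apply cdiff_id|apply cdiff_const].
Qed.

Lemma hol_of_primitive V F f : openC V -> (forall z, V z -> cder F z (f z)) -> hol V f.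
Proof.
intros OV HF z Vz; destruct (OV z Vz) as (r & Hr & HB).
apply (cdiff_ext_loc (C_derive F)) with (r := r); auto.
- intros w Hw; apply cder_C_derive; auto.
- apply (hol_C_derive V F); auto; intros w Vw; eexists; eauto.
Qed.

(** [Iseg f p] is a primitive of [f] although [f] is only continuous at [p], and the derivative of a
    holomorphic function is holomorphic. *)
Lemma removable f p r : 0 < r -> (forall z, odisk p r z -> z <> p -> cdiff f z) ->
  cts dC everywhere f p -> cdiff f p.
Proof.
intros Hr Hf Hc.
assert (Bp : odisk p r p) by (unfold odisk; rewrite Cmod_sub_self; lra).
apply (hol_of_primitive (odisk p r) (Iseg f p)); auto using odisk_open.
apply primitive_star; auto using odisk_star.
Qed.

Lemma cslope_cdiff U f p z : openC U -> hol U f -> U p -> U z ->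
  cdiff (cslope f p (C_derive f p)) z.
Proof.
intros OU Hf Up Uz.
destruct (Ceq_dec z p) as [->|N].
- destruct (OU p Up) as (r & Hr & HB); apply removable with r; auto.
  + intros w Hw N; apply (cts_cslope_off f p (C_derive f p) w everywhere); auto.
  + apply cslope_cts, cdiff_cder; auto.
- now apply (cts_cslope_off f p (C_derive f p) z everywhere), Hf.
Qed.

(** * The maximum principle and Schwarz's lemma *)

(* The mean value property, read off the periodicity of a primitive of the slope. *)
Lemma no_interior_max f p R0 e : 0 < R0 -> 0 < e -> hol (odisk p R0) f ->
  (forall z, odisk p R0 z ->
     Re (f z) + e * (Cmod z * Cmod z) <= Re (f p) + e * (Cmod p * Cmod p)) -> False.
Proof.
intros HR He Hf HM.
assert (Bp : odisk p R0 p) by (unfold odisk; rewrite Cmod_sub_self; lra).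
destruct (slope_primitive f p R0 p Bp Hf) as [P HP].
set (r := R0 / 2); assert (Hr : 0 < r) by (unfold r; lra).
set (c := fun s => (p + circ r s)%C).
assert (Bc : forall s, odisk p R0 (c s)).
{ intros s; unfold odisk, c; replace (p + circ r s - p)%C with (circ r s) by ring.
  rewrite Cmod_circ; unfold r; lra. }
assert (Dc : forall s, rder (fun s => P (c s)) s (Ci * (f (c s) - f p))%C).
{ intros s; apply (rder_eq _ _ (cslope f p (C_derive f p) (c s) * (0 + Ci * circ r s))%C).
  - apply rder_comp; [now apply HP|].
    apply rder_plus; [apply rder_const|now apply rder_circ].
  - rewrite (cslope_eq f p (C_derive f p)); unfold c; ring. }
set (x := Re p); set (y := Im p).
(* The derivative of [h] is the difference of the penalized function between the circle and the
   centre, hence nonpositive; yet [h] grows by [2 pi e r^2] over one turn, because [Im (P (c s))]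
   and the trigonometric terms are periodic. The penalty [e |z|^2] thus spares the discussion of the
   case of equality. *)
set (h := fun s => Im (P (c s)) + e * (r * r * s + 2 * r * (x * sin s - y * cos s))).
set (dh := fun s => Re (f (c s) - f p) + e * (r * r + 2 * r * (x * cos s + y * sin s))).
assert (Dh : forall s, is_derive h s (dh s)).
{ intros s; apply (is_derive_plus (fun s => Im (P (c s)))).
  - replace (Re (f (c s) - f p)) with (Im (Ci * (f (c s) - f p)))
      by (rewrite im_mult; simpl; ring).
    now apply Dc.
  - auto_derive; auto; ring. }
assert (Hd : forall s, dh s <= 0).
{ intros s; unfold dh; rewrite re_minus; assert (H := HM (c s) (Bc s)).
  replace (Cmod (c s) * Cmod (c s))
    with (Cmod p * Cmod p + (r * r + 2 * r * (x * cos s + y * sin s))) in H; [lra|].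
  rewrite !Cmod_sqr; unfold c, circ, cis, x, y.
  rewrite re_plus, im_plus, re_mult, im_mult; simpl Re; simpl Im.
  assert (T := sin2_cos2 s); unfold Rsqr in T.
  replace (r * r) with (r * r * (sin s * sin s + cos s * cos s)) by (rewrite T; ring).
  ring. }
destruct (MVT_gen h 0 (2 * PI) dh) as (t & _ & Et).
{ intros; apply Dh. }
{ intros t _; apply derivable_continuous_pt; exists (dh t); now apply is_derive_Reals. }
unfold h in Et at 1 2; unfold c in Et at 1 2; rewrite circ_periodic in Et.
rewrite cos_2PI, sin_2PI, cos_0, sin_0 in Et.
specialize (Hd t); assert (PP := PI_RGT_0).
assert (0 < e * (r * r)) by (apply Rmult_lt_0_compat; nra).
nra.
Qed.

Lemma cdisk_max_on_circle f r e : 0 < r -> 0 < e -> hol (odisk 0 r) f ->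
  (forall z, cdisk 0 r z -> cts dC (cdisk 0 r) f z) ->
  exists z0, Cmod z0 = r /\ forall z, cdisk 0 r z ->
    Re (f z) + e * (Cmod z * Cmod z) <= Re (f z0) + e * (r * r).
Proof.
intros Hr He Hf Hc.
destruct (compact_max (cdisk 0 r) (fun z => f z + RtoC e * (RtoC (Cmod z) * RtoC (Cmod z)))%C)
  as (z0 & Z0 & HM).
{ apply cdisk_compact. }
{ exists 0; unfold cdisk; rewrite Cmod_sub_self; lra. }
{ intros z Hz; apply cts_plus; [auto|]; apply cts_scal, cts_mult; apply cts_Cmod, cts_id. }
assert (HM' : forall z, cdisk 0 r z ->
  Re (f z) + e * (Cmod z * Cmod z) <= Re (f z0) + e * (Cmod z0 * Cmod z0)).
{ intros z Hz; specialize (HM z Hz); rewrite !re_plus, <- !RtoC_mult, !re_RtoC in HM; easy. }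
assert (S0 : forall z, Cmod (z - 0) = Cmod z) by (intros; f_equal; ring).
unfold cdisk in Z0; rewrite S0 in Z0.
exists z0; destruct Z0 as [Lt|Eq].
- exfalso; apply (no_interior_max f z0 (r - Cmod z0) e); auto; [lra| |].
  + intros z Hz; apply Hf; unfold odisk in *; rewrite S0.
    assert (A := Cmod_sub_le z z0); lra.
  + intros z Hz; apply HM'; unfold odisk, cdisk in *; rewrite S0.
    assert (A := Cmod_sub_le z z0); lra.
- split; [easy|]; intros z Hz; specialize (HM' z Hz); now rewrite Eq in HM'.
Qed.

(** The boundary enters only through an upper limit: in [Schwarz] the quotient [f z / z] need not
    extend continuously to the circle. *)
Lemma max_principle f M : hol in_disk f ->
  (forall p, Cmod p = 1 -> forall e, 0 < e -> exists del, 0 < del /\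
     forall z, in_disk z -> Cmod (z - p) < del -> Re (f z) < M + e) ->
  forall z, in_disk z -> Re (f z) <= M.
Proof.
intros Hf HB z1 D1.
apply le_epsilon; intros e He.
assert (S0 : forall z, Cmod (z - 0) = Cmod z) by (intros; f_equal; ring).
destruct (compact_uniform (cdisk 0 1)
  (fun x d => in_disk x -> 1 - Cmod x < d -> Re (f x) < M + e / 2)) as (d & Hd & Bd).
{ apply cdisk_compact. }
{ intros x d d' H Hd Dx Hx; apply H; auto; lra. }
{ intros p Hp; unfold cdisk in Hp; rewrite S0 in Hp; destruct Hp as [Lt|Eq].
  - exists ((1 - Cmod p) / 2); split; [lra|]; intros x _ Hx _ H.
    assert (A := Cmod_sub_le x p); lra.
  - destruct (HB p Eq (e / 2)) as (d & D & H); [lra|].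
    exists d; split; auto. }
(* The circle of radius [r] surrounds [z1] and is so close to the boundary that [Re f < M + e / 2]
   on it; the penalty [(e / 2) |z|^2] costs the other half of [e]. *)
set (r := Rmax (1 - d / 2) ((1 + Cmod z1) / 2)).
assert (P1 := Cmod_ge_0 z1); unfold in_disk in D1.
assert (R1 : (1 + Cmod z1) / 2 <= r) by apply Rmax_r.
assert (R2 : 1 - d / 2 <= r) by apply Rmax_l.
assert (R3 : r < 1) by (apply Rmax_lub_lt; lra).
destruct (cdisk_max_on_circle f r (e / 2)) as (z0 & Z0 & H0); try lra.
{ intros z Hz; apply Hf; unfold odisk in Hz; rewrite S0 in Hz; unfold in_disk; lra. }
{ intros z Hz; apply cdiff_cts, Hf; unfold cdisk in Hz; rewrite S0 in Hz; unfold in_disk; lra. }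
assert (A := H0 z1); unfold cdisk in A; rewrite S0 in A; specialize (A ltac:(lra)).
assert (B := Bd z0); unfold cdisk, in_disk in B; rewrite S0, Z0 in B.
specialize (B ltac:(lra) ltac:(lra) ltac:(lra)).
assert (r * r < 1) by nra; nra.
Qed.

Lemma max_principle_closed f M : hol in_disk f ->
  (forall z, Cmod z <= 1 -> cts dC (cdisk 0 1) f z) ->
  (forall z, Cmod z = 1 -> Re (f z) <= M) ->
  forall z, Cmod z <= 1 -> Re (f z) <= M.
Proof.
intros Hf Hc HM z [Lt|Eq]; [|now apply HM].
apply (max_principle f M); auto; intros p Hp e He.
destruct (Hc p (Req_le _ _ Hp) e He) as (d & D & H); exists d; split; auto.
intros w Hw Hwp; specialize (HM p Hp).
assert (A : Cmod (f w - f p) < e).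
{ apply H; auto; unfold cdisk; replace (w - 0)%C with w by ring; now left. }
assert (B := Re_le_Cmod (f w - f p)); rewrite re_minus in B; lra.
Qed.

Lemma Schwarz f : hol in_disk f -> f 0 = 0 ->
  (forall z, in_disk z -> Cmod (f z) <= 1) ->
  forall z, in_disk z -> Cmod (f z) <= Cmod z.
Proof.
intros Hf H0 HM z Dz.
set (h := cslope f 0 (C_derive f 0)).
assert (Hh : forall w, in_disk w -> cdiff h w).
{ intros w Hw; apply (cslope_cdiff in_disk); auto using in_disk_open.
  unfold in_disk; rewrite Cmod_0; lra. }
assert (E : forall w, f w = (h w * w)%C).
{ intros w; assert (X := cslope_eq f 0 (C_derive f 0) w); fold h in X.
  rewrite H0 in X; replace (f w) with (f w - 0)%C by ring; rewrite X; ring. }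
destruct (rotation (h z)) as (u & Hu & Eu).
enough (Cmod (h z) <= 1).
{ rewrite E, Cmod_mult; generalize (Cmod_ge_0 z); nra. }
rewrite <- (re_RtoC (Cmod (h z))), <- Eu.
apply (max_principle (fun w => u * h w)%C); auto.
{ intros w Hw; apply cdiff_scal; auto. }
intros p Hp e He.
(* Within this distance of the circle [|w| > 1 / (1 + e)], whence [|h w| <= 1 / |w| < 1 + e]. *)
exists (e / (1 + e)); split; [apply Rdiv_lt_0_compat; lra|].
intros w Hw Hwp.
apply Rle_lt_trans with (1 := Re_le_Cmod _); rewrite Cmod_mult, Hu, Rmult_1_l.
assert (A := Cmod_sub_le p w); rewrite Cmod_sub_sym, Hp in A.
assert (B := HM w Hw); rewrite E, Cmod_mult in B.
assert (C1 : e / (1 + e) * (1 + e) = e) by (field; lra).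
assert (C2 : (1 - Cmod w) * (1 + e) < e).
{ apply Rle_lt_trans with (Cmod (w - p) * (1 + e)); [apply Rmult_le_compat_r; lra|].
  rewrite <- C1 at 2; apply Rmult_lt_compat_r; lra. }
generalize (Cmod_ge_0 (h w)); nra.
Qed.

(* At a boundary maximum of [Re k] the tangential derivative vanishes and the
   radial one points outwards. *)
Lemma boundary_max k m r : 0 < r -> cder k 1 m ->
  (forall x, Cmod x <= 1 -> Cmod (x - 1) < r -> Re (k x) <= Re (k 1)) ->
  Im m = 0 /\ 0 <= Re m.
Proof.
intros Hr Hk HM.
(* A direction [v] is admissible if the closed disk contains points [1 + s v] up to an error [s^2].
   The derivative of [Re k] in such a direction is nonpositive; the directions [i], [-i] and [-1]
   give the two conclusions. *)
assert (Step : forall v, (exists d, 0 < d /\ forall s, 0 < s < d ->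
    exists x, Cmod x <= 1 /\ Cmod (x - 1 - RtoC s * v) <= s * s /\ Cmod (x - 1) <= 2 * s) ->
  Re (m * v) <= 0).
{ intros v (d & D & Hx); apply Rnot_lt_le; intros Pos.
  set (e := Re (m * v) / 4).
  destruct (Hk e) as (d1 & D1 & H1); [unfold e; lra|].
  assert (Pm := Cmod_ge_0 m).
  set (s := Rmin (Rmin (d / 2) (d1 / 4)) (Rmin (r / 4) (e / (Cmod m + 1)))).
  assert (Hs : 0 < s).
  { repeat apply Rmin_pos; try lra; apply Rdiv_lt_0_compat; unfold e; lra. }
  assert (S1 : s <= d / 2) by (eapply Rle_trans; [apply Rmin_l|apply Rmin_l]).
  assert (S2 : s <= d1 / 4) by (eapply Rle_trans; [apply Rmin_l|apply Rmin_r]).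
  assert (S3 : s <= r / 4) by (eapply Rle_trans; [apply Rmin_r|apply Rmin_l]).
  assert (S4 : s <= e / (Cmod m + 1)) by (eapply Rle_trans; [apply Rmin_r|apply Rmin_r]).
  assert (S5 : s * (Cmod m + 1) <= e).
  { apply Rle_trans with (e / (Cmod m + 1) * (Cmod m + 1)); [|right; field; lra].
    apply Rmult_le_compat_r; lra. }
  destruct (Hx s) as (x & X1 & X2 & X3); [lra|].
  assert (A := HM x X1 ltac:(lra)); specialize (H1 x ltac:(lra)).
  assert (B := re_le_Cmod (k x - k 1 - m * (x - 1))).
  apply Rle_trans with (2 := H1) in B.
  assert (B' : Re (m * (x - 1)) <= e * (2 * s)).
  { rewrite !re_minus in B; apply Rabs_le_between in B.
    assert (e * Cmod (x - 1) <= e * (2 * s)) by (apply Rmult_le_compat_l; unfold e; lra).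
    lra. }
  assert (C1 : Re (m * (RtoC s * v)) <= Re (m * (x - 1)) + Cmod m * (s * s)).
  { replace (m * (RtoC s * v))%C with (m * (x - 1) - m * (x - 1 - RtoC s * v))%C by ring.
    rewrite re_minus.
    assert (Q := re_le_Cmod (m * (x - 1 - RtoC s * v))); rewrite Cmod_mult in Q.
    apply Rabs_le_between in Q.
    assert (Cmod m * Cmod (x - 1 - RtoC s * v) <= Cmod m * (s * s))
      by (apply Rmult_le_compat_l; lra).
    lra. }
  replace (Re (m * (RtoC s * v))) with (s * (4 * e)) in C1.
  2:{ unfold e; rewrite !re_mult, im_mult, re_RtoC, im_RtoC; field. }
  assert (Cmod m * (s * s) < e * s).
  { assert (s * (s * (Cmod m + 1)) <= s * e) by (apply Rmult_le_compat_l; lra); nra. }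
  assert (0 < e) by (unfold e; lra).
  nra. }
assert (Tan : forall sg, sg * sg = 1 -> Re (m * (RtoC sg * Ci)) <= 0).
{ intros sg Hsg; apply Step; exists 1; split; [lra|]; intros s Hs.
  (* The point of the unit circle at height [sg s], at distance at most [s^2] from [1 + sg s i]. *)
  exists (RtoC (sqrt (1 - s * s)) + Ci * RtoC (sg * s))%C.
  assert (Q : 0 <= 1 - s * s) by nra.
  assert (R1 := sqrt_sqrt _ Q); assert (R0 := sqrt_pos (1 - s * s)).
  assert (R2 : sqrt (1 - s * s) <= 1) by nra.
  assert (R3 : 1 - s * s <= sqrt (1 - s * s)) by nra.
  split; [|split].
  - apply Rsqr_incr_0; [|apply Cmod_ge_0|lra]; unfold Rsqr.
    rewrite Cmod_sqr, !re_plus, !im_plus, !re_mult, !im_mult, !re_RtoC, !im_RtoC; simpl.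
    right; nra.
  - replace (_ - _ - _)%C with (RtoC (sqrt (1 - s * s) - 1))
      by (rewrite RtoC_minus, RtoC_mult; ring).
    rewrite Cmod_R, Rabs_minus_sym, Rabs_pos_eq; lra.
  - replace (_ - 1)%C with (RtoC (sqrt (1 - s * s) - 1) + Ci * RtoC (sg * s))%C
      by (rewrite RtoC_minus; ring).
    apply Rle_trans with (1 := Cmod_triangle _ _).
    rewrite Cmod_mult, Cmod_Ci, !Cmod_R, Rabs_minus_sym, (Rabs_pos_eq (1 - _)) by lra.
    rewrite Rabs_mult, (Rabs_pos_eq s) by lra.
    replace (Rabs sg) with 1 by (unfold Rabs; destruct (Rcase_abs sg); nra).
    nra. }
split.
- assert (T1 := Tan 1 ltac:(ring)); assert (T2 := Tan (-1) ltac:(ring)).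
  rewrite !re_mult, !im_mult, !re_RtoC, !im_RtoC in T1, T2; simpl in T1, T2; lra.
- enough (Re (m * - (1)) <= 0).
  { rewrite re_mult, re_opp, im_opp, re_RtoC, im_RtoC in H; lra. }
  apply Step; exists 1; split; [lra|]; intros s Hs; exists (RtoC (1 - s)); split; [|split].
  + rewrite Cmod_R, Rabs_pos_eq; lra.
  + replace (_ - _ - _)%C with (RtoC 0) by (rewrite RtoC_minus; ring).
    rewrite Cmod_0; nra.
  + replace (RtoC (1 - s) - 1)%C with (RtoC (- s)) by (rewrite RtoC_minus, RtoC_opp; ring).
    rewrite Cmod_R, Rabs_Ropp, Rabs_pos_eq; lra.
Qed.

(** * Exponential, logarithm, univalence and inverse functions *)

Definition cexp (z : C) : C := (RtoC (exp (Re z)) * cis (Im z))%C.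

Lemma Re_cexp z : Re (cexp z) = exp (Re z) * cos (Im z).
Proof. unfold cexp; rewrite re_mult, re_RtoC, im_RtoC; simpl; ring. Qed.

Lemma Im_cexp z : Im (cexp z) = exp (Re z) * sin (Im z).
Proof. unfold cexp; rewrite im_mult, re_RtoC, im_RtoC; simpl; ring. Qed.

Lemma cexp_plus z w : cexp (z + w) = (cexp z * cexp w)%C.
Proof.
apply C_ext; rewrite ?re_mult, ?im_mult, !Re_cexp, !Im_cexp, re_plus, im_plus, exp_plus.
- rewrite cos_plus; ring.
- rewrite sin_plus; ring.
Qed.

Lemma cexp_0 : cexp 0 = 1.
Proof. apply C_ext; rewrite ?Re_cexp, ?Im_cexp; simpl; rewrite exp_0, ?cos_0, ?sin_0; ring. Qed.

Lemma Cmod_cexp z : Cmod (cexp z) = exp (Re z).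
Proof.
unfold cexp; rewrite Cmod_mult, Cmod_cis, Cmod_R, Rabs_pos_eq; [ring|left; apply exp_pos].
Qed.

Lemma cexp_neq_0 z : cexp z <> 0.
Proof. apply Cmod_gt_0; rewrite Cmod_cexp; apply exp_pos. Qed.

Lemma cexp_opp z : cexp (- z) = (/ cexp z)%C.
Proof.
assert (H : (cexp (- z) * cexp z)%C = 1).
{ rewrite <- cexp_plus; replace (- z + z)%C with (RtoC 0) by ring; apply cexp_0. }
assert (N := cexp_neq_0 z).
replace (cexp (- z)) with (cexp (- z) * cexp z / cexp z)%C by (field; auto).
rewrite H; unfold Cdiv; ring.
Qed.

Lemma cexp_minus z w : cexp (z - w) = (cexp z / cexp w)%C.
Proof. unfold Cminus; rewrite cexp_plus, cexp_opp; reflexivity. Qed.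

Lemma cexp_conj z : cexp (Cconj z) = Cconj (cexp z).
Proof.
apply C_ext; rewrite ?re_conj, ?im_conj, ?Re_cexp, ?Im_cexp, re_conj, im_conj.
- now rewrite cos_neg.
- rewrite sin_neg; ring.
Qed.

(** Real calculus along the segment from 0 to [h], combined with the mean value inequality, gives
    the Taylor bound from which complex differentiability of [cexp] follows. *)
Lemma rder_cexp_ray h t : rder (fun s => cexp (RtoC s * h)) t (h * cexp (RtoC t * h)).
Proof.
split.
- apply (is_derive_ext (fun s => exp (s * Re h) * cos (s * Im h))).
  { intros s; now rewrite Re_cexp, re_mult, im_mult, re_RtoC, im_RtoC, !Rmult_0_l,
      Rminus_0_r, Rplus_0_r. }
  rewrite re_mult, Re_cexp, Im_cexp, re_mult, im_mult, re_RtoC, im_RtoC.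
  auto_derive; auto; rewrite !Rmult_0_l, Rminus_0_r, Rplus_0_r; ring.
- apply (is_derive_ext (fun s => exp (s * Re h) * sin (s * Im h))).
  { intros s; now rewrite Im_cexp, re_mult, im_mult, re_RtoC, im_RtoC, !Rmult_0_l,
      Rminus_0_r, Rplus_0_r. }
  rewrite im_mult, Re_cexp, Im_cexp, re_mult, im_mult, re_RtoC, im_RtoC.
  auto_derive; auto; rewrite !Rmult_0_l, Rminus_0_r, Rplus_0_r; ring.
Qed.

Lemma cexp_lip h : Cmod h <= 1 -> Cmod (cexp h - 1) <= 3 * Cmod h.
Proof.
intros Hh.
assert (H := mean_value_ineq 0 1 (fun s => cexp (RtoC s * h))
  (fun t => h * cexp (RtoC t * h))%C 0 (3 * Cmod h) Rle_0_1
  (fun t _ => rder_cexp_ray h t)); cbv beta in H.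
replace (cexp (RtoC 1 * h) - cexp (RtoC 0 * h) - RtoC (1 - 0) * 0)%C
  with (cexp h - 1)%C in H.
2:{ rewrite Cmult_0_l, cexp_0, Cmult_1_l; ring. }
rewrite Rminus_0_r, Rmult_1_r in H; apply H.
intros t [T0 T1]; replace (h * cexp (RtoC t * h) - 0)%C with (h * cexp (RtoC t * h))%C by ring.
rewrite Cmod_mult, Cmod_cexp, Rmult_comm.
apply Rmult_le_compat_r; [apply Cmod_ge_0|].
apply Rle_trans with (2 := exp_le_3).
assert (A := re_le_Cmod (RtoC t * h)); rewrite Cmod_mult, Cmod_R, (Rabs_pos_eq t) in A by easy.
apply Rabs_le_between in A; assert (P := Cmod_ge_0 h).
assert (B : Re (RtoC t * h) <= 1) by nra.
destruct B as [B| ->]; [left; now apply exp_increasing|lra].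
Qed.

Lemma cexp_taylor h : Cmod h <= 1 -> Cmod (cexp h - 1 - h) <= 3 * (Cmod h * Cmod h).
Proof.
intros Hh.
assert (H := mean_value_ineq 0 1 (fun s => cexp (RtoC s * h))
  (fun t => h * cexp (RtoC t * h))%C h (3 * (Cmod h * Cmod h)) Rle_0_1
  (fun t _ => rder_cexp_ray h t)); cbv beta in H.
replace (cexp (RtoC 1 * h) - cexp (RtoC 0 * h) - RtoC (1 - 0) * h)%C
  with (cexp h - 1 - h)%C in H.
2:{ rewrite Rminus_0_r, Cmult_0_l, cexp_0, Cmult_1_l; ring. }
rewrite Rminus_0_r, Rmult_1_r in H; apply H; intros t [T0 T1].
replace (h * cexp (RtoC t * h) - h)%C with (h * (cexp (RtoC t * h) - 1))%C by ring.
assert (Ph := Cmod_ge_0 h).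
assert (E : Cmod (RtoC t * h) <= Cmod h) by (rewrite Cmod_mult, Cmod_R, Rabs_pos_eq by easy; nra).
rewrite Cmod_mult; apply Rle_trans with (Cmod h * (3 * Cmod h)); [|right; ring].
apply Rmult_le_compat_l; [easy|].
apply Rle_trans with (1 := cexp_lip (RtoC t * h) ltac:(lra)); lra.
Qed.

Lemma cder_cexp z : cder cexp z (cexp z).
Proof.
intros e He; set (k := 3 * Cmod (cexp z) + 1).
assert (P := Cmod_ge_0 (cexp z)).
exists (Rmin 1 (e / k)); split; [apply Rmin_pos; [lra|]; apply Rdiv_lt_0_compat; unfold k; lra|].
intros w Hw; set (h := (w - z)%C) in *.
assert (A1 := Rlt_le_trans _ _ _ Hw (Rmin_l _ _)).
assert (A2 := Rlt_le_trans _ _ _ Hw (Rmin_r _ _)).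
replace (cexp w - cexp z - cexp z * h)%C with (cexp z * (cexp h - 1 - h))%C.
2:{ replace w with (z + h)%C by (unfold h; ring); rewrite cexp_plus; ring. }
assert (B := cexp_taylor h (Rlt_le _ _ A1)).
rewrite Cmod_mult.
apply Rle_trans with (Cmod (cexp z) * (3 * (Cmod h * Cmod h))).
{ apply Rmult_le_compat_l; easy. }
assert (K : Cmod h * k <= e).
{ apply Rle_trans with (e / k * k); [|right; field; unfold k; lra].
  apply Rmult_le_compat_r; unfold k in *; lra. }
unfold k in K; assert (Ph := Cmod_ge_0 h); nra.
Qed.

Lemma cts_cexp {T} (d : T -> T -> R) S f x : cts d S f x -> cts d S (fun y => cexp (f y)) x.
Proof.
intros; apply (cts_comp d S everywhere cexp); auto; [easy|].
eapply cder_cts, cder_cexp.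
Qed.

Lemma cder_cexp_comp f z a : cder f z a -> cder (fun w => cexp (f w)) z (cexp (f z) * a).
Proof. intros; apply (cder_comp cexp f); auto using cder_cexp. Qed.

(** The plane without the closed negative real axis, described by the denominator of the half-angle
    formula for the argument. *)
Definition slit (w : C) : Prop := 0 < Cmod w + Re w.

Lemma slit_neq_0 w : slit w -> w <> 0.
Proof. unfold slit; intros H ->; rewrite Cmod_0 in H; simpl in H; lra. Qed.

Lemma Re_pos_slit w : 0 < Re w -> slit w.
Proof. unfold slit; generalize (Cmod_ge_0 w); lra. Qed.

Lemma half_angle w : slit w -> let u := Im w / (Cmod w + Re w) in
  cos (2 * atan u) = Re w / Cmod w /\ sin (2 * atan u) = Im w / Cmod w.
Proof.
intros Hw u; unfold slit in Hw.
assert (Pw : 0 < Cmod w) by (apply Cmod_gt_0, slit_neq_0; exact Hw).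
assert (Q := Cmod_sqr w).
assert (Hu : 1 + u * u = 2 * Cmod w / (Cmod w + Re w)).
{ unfold u; apply Rmult_eq_reg_r with ((Cmod w + Re w) * (Cmod w + Re w)); [|nra].
  field_simplify; [|lra|lra]; nra. }
assert (S0 : 0 < 1 + u * u) by nra.
assert (Sq : sqrt (1 + Rsqr u) * sqrt (1 + Rsqr u) = 1 + u * u)
  by (unfold Rsqr; apply sqrt_sqrt; lra).
assert (Sp : 0 < sqrt (1 + Rsqr u)) by (apply sqrt_lt_R0; unfold Rsqr; lra).
split.
- rewrite cos_2a, cos_atan, sin_atan.
  replace (1 / sqrt (1 + Rsqr u) * (1 / sqrt (1 + Rsqr u)) -
    u / sqrt (1 + Rsqr u) * (u / sqrt (1 + Rsqr u)))
    with ((2 - (1 + u * u)) / (sqrt (1 + Rsqr u) * sqrt (1 + Rsqr u))) by (field; lra).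
  rewrite Sq, Hu; field; lra.
- rewrite sin_2a, cos_atan, sin_atan.
  replace (2 * (u / sqrt (1 + Rsqr u)) * (1 / sqrt (1 + Rsqr u)))
    with (2 * u / (sqrt (1 + Rsqr u) * sqrt (1 + Rsqr u))) by (field; lra).
  rewrite Sq, Hu; unfold u; field; lra.
Qed.

(** Replaces the case distinction on the sign of [Im w] by one expression, whose continuity is
    evident even across the positive real axis. *)
Lemma Carg_slit w : slit w -> Carg w = 2 * atan (Im w / (Cmod w + Re w)).
Proof.
intros Hw; destruct (half_angle w Hw) as [HC HS].
set (u := Im w / (Cmod w + Re w)) in *.
assert (B := atan_bound u); unfold slit in Hw.
unfold Carg; rewrite <- HC; destruct (Rlt_dec (Im w) 0) as [Hi|Hi].
- assert (Hu : u < 0) by (unfold u; apply Rdiv_neg_pos; lra).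
  apply atan_increasing in Hu; rewrite atan_0 in Hu.
  rewrite <- cos_neg, acos_cos; lra.
- assert (Hu : 0 <= u).
  { unfold u; apply Rmult_le_pos; [lra|]; left; now apply Rinv_0_lt_compat. }
  assert (0 <= atan u).
  { destruct Hu as [Hu|<-]; [|rewrite atan_0; lra].
    apply atan_increasing in Hu; rewrite atan_0 in Hu; lra. }
  rewrite acos_cos; lra.
Qed.

Lemma cexp_Clog w : slit w -> cexp (Clog w) = w.
Proof.
intros Hw; destruct (half_angle w Hw) as [HC HS].
assert (Pw : 0 < Cmod w) by (now apply Cmod_gt_0, slit_neq_0).
unfold Clog; rewrite Carg_slit by easy.
apply C_ext; rewrite ?Re_cexp, ?Im_cexp; simpl; rewrite exp_ln by easy.
- rewrite HC; field; lra.
- rewrite HS; field; lra.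
Qed.

Lemma Clog_cexp z : Rabs (Im z) < PI -> Clog (cexp z) = z.
Proof.
intros Hz; apply Rabs_lt_between in Hz.
unfold Clog, Carg; rewrite Cmod_cexp, ln_exp, Re_cexp, Im_cexp.
replace (exp (Re z) * cos (Im z) / exp (Re z)) with (cos (Im z))
  by (field; apply Rgt_not_eq, exp_pos).
assert (P := exp_pos (Re z)).
apply C_ext; simpl; [easy|].
destruct (Rlt_dec (exp (Re z) * sin (Im z)) 0) as [H|H].
- assert (Im z < 0).
  { apply Rnot_le_lt; intros H'.
    assert (0 <= sin (Im z)) by (apply sin_ge_0; lra); nra. }
  rewrite <- cos_neg, acos_cos; lra.
- assert (0 <= Im z).
  { apply Rnot_lt_le; intros H'; apply H.
    assert (sin (Im z) < 0) by (apply sin_lt_0_var; lra); nra. }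
  rewrite acos_cos; lra.
Qed.

Lemma cts_real_fun {T} (d : T -> T -> R) S (f : T -> C) (h : R -> R) x :
  continuity_pt h (Re (f x)) -> cts d S f x -> cts d S (fun y => RtoC (h (Re (f y)))) x.
Proof.
intros Hh Hf e He.
destruct (Hh e He) as (d1 & D1 & H1); simpl in H1.
destruct (Hf d1 D1) as (d2 & D2 & H2).
exists d2; split; [easy|]; intros y Sy Hy.
rewrite <- RtoC_minus, Cmod_R.
destruct (Req_dec (Re (f y)) (Re (f x))) as [->|N]; [rewrite Rminus_diag_eq, Rabs_R0; lra|].
unfold R_dist in H1; unfold Rdist in H1; apply H1; split.
- unfold D_x, no_cond; split; auto.
- apply Rle_lt_trans with (2 := H2 y Sy Hy); rewrite <- re_minus; apply re_le_Cmod.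
Qed.

Lemma slit_open : openC slit.
Proof.
intros w Hw; unfold slit in *; exists ((Cmod w + Re w) / 2); split; [lra|]; intros v Hv.
assert (A := Cmod_sub_le w v); rewrite Cmod_sub_sym in A.
assert (B := re_le_Cmod (v - w)); rewrite re_minus in B; apply Rabs_le_between in B; lra.
Qed.

Lemma Clog_cts w S : slit w -> cts dC S Clog w.
Proof.
intros Hw.
assert (Pw : 0 < Cmod w) by (now apply Cmod_gt_0, slit_neq_0).
destruct (slit_open w Hw) as (r & Hr & HB).
apply cts_loc with r; [easy|].
apply cts_ext with (f := fun v => (RtoC (ln (Re (RtoC (Cmod v))))
  + Ci * (2 * RtoC (atan (Re (RtoC (Im v) / (RtoC (Cmod v) + RtoC (Re v)))))))%C).
- assert (X : forall v, slit v ->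
   (RtoC (ln (Re (RtoC (Cmod v)))) + Ci * (2 * RtoC (atan (Re (RtoC (Im v) / (RtoC (Cmod v) + RtoC (Re v)))))))%C
   = Clog v).
  { intros v Hv; unfold slit in Hv.
    rewrite <- RtoC_plus, <- RtoC_div by lra; rewrite !re_RtoC.
    unfold Clog; rewrite Carg_slit by exact Hv; unfold Ci, RtoC, Cplus, Cmult; simpl; f_equal; ring. }
  intros v [_ Hv]; apply X; auto.
- unfold slit in Hw; rewrite <- RtoC_plus, <- RtoC_div by lra; rewrite !re_RtoC.
  unfold Clog; rewrite Carg_slit by exact Hw; unfold Ci, RtoC, Cplus, Cmult; simpl; f_equal; ring.
- apply cts_plus; [|apply cts_scal, cts_scal].
  + apply (cts_real_fun dC _ (fun v => RtoC (Cmod v)) ln); [|apply cts_Cmod, cts_id].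
    rewrite re_RtoC; apply derivable_continuous_pt; exists (/ Cmod w).
    now apply derivable_pt_lim_ln.
  + apply (cts_real_fun dC _ (fun v => (RtoC (Im v) / (RtoC (Cmod v) + RtoC (Re v)))%C) atan).
    * apply derivable_continuous_pt, derivable_pt_atan.
    * unfold slit in Hw; apply cts_div.
      -- rewrite <- RtoC_plus; intros E; apply RtoC_inj in E; lra.
      -- apply cts_Im, cts_id.
      -- apply cts_plus; [apply cts_Cmod, cts_id|apply cts_Re, cts_id].
Qed.

(** * Inverse functions and univalence *)

Lemma cder_inverse (F G : C -> C) (w d : C) r : 0 < r -> d <> 0 -> cder F (G w) d ->
  (forall v, Cmod (v - w) < r -> F (G v) = v) -> cts dC everywhere G w ->
  cder G w (/ d).
Proof.
intros Hr Nd HF HG Gc.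
apply cslope_cts in HF.
set (s := fun v => cslope F (G w) d (G v)).
assert (Hs : cts dC everywhere s w)
  by (apply (cts_comp dC everywhere everywhere (cslope F (G w) d) G); auto; easy).
assert (s0 : s w = d) by (unfold s; apply cslope_self).
assert (Pd := proj1 (Cmod_gt_0 d) Nd).
destruct (Hs (Cmod d) Pd) as (d1 & D1 & H1); rewrite s0 in H1.
assert (Hi : cts dC everywhere (fun v => / s v)%C w) by (apply cts_Cinv; [congruence|easy]).
intros e He; destruct (Hi e He) as (d2 & D2 & H2); rewrite s0 in H2.
exists (Rmin r (Rmin d1 d2)); split; [repeat apply Rmin_pos; auto|]; intros v Hv.
assert (A1 := Rlt_le_trans _ _ _ Hv (Rmin_l _ _)).
assert (A := Rlt_le_trans _ _ _ Hv (Rmin_r _ _)).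
assert (A2 := Rlt_le_trans _ _ _ A (Rmin_l _ _)).
assert (A3 := Rlt_le_trans _ _ _ A (Rmin_r _ _)).
specialize (H1 v I A2); specialize (H2 v I A3).
assert (Ns : s v <> 0).
{ intros E; rewrite E in H1; replace (0 - d)%C with (- d)%C in H1 by ring.
  rewrite Cmod_opp in H1; lra. }
assert (E : (v - w)%C = (s v * (G v - G w))%C).
{ unfold s; rewrite <- cslope_eq, !HG; auto; rewrite Cmod_sub_self; lra. }
replace (G v - G w - / d * (v - w))%C with ((/ s v - / d) * (v - w))%C.
- rewrite Cmod_mult; apply Rmult_le_compat_r; [apply Cmod_ge_0|lra].
- replace (G v - G w)%C with (/ s v * (v - w))%C; [ring|].
  rewrite E; field; auto.
Qed.

Lemma cder_Clog w : slit w -> cder Clog w (/ w).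
Proof.
intros Hw; destruct (slit_open w Hw) as (r & Hr & HB).
rewrite <- (cexp_Clog w Hw) at 2.
apply (cder_inverse cexp Clog w (cexp (Clog w)) r); auto using cexp_neq_0, cder_cexp.
- intros v Hv; apply cexp_Clog; auto.
- now apply Clog_cts.
Qed.

(** Along the segment from [x] to [y] the real part of [conj (y - x) F] has derivative
    [|y - x|^2 Re F'], so it increases strictly. *)
Lemma Noshiro_Warschawski (V : C -> Prop) (F dF : C -> C) :
  (forall x y t, V x -> V y -> in_itv 0 1 t -> V (seg x y t)) ->
  (forall z, V z -> cder F z (dF z) /\ 0 < Re (dF z)) ->
  forall x y, V x -> V y -> F x = F y -> x = y.
Proof.
intros HV HF x y Vx Vy E.
destruct (Ceq_dec x y) as [|N]; [easy|exfalso].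
set (u := Cconj (y - x)).
set (h := fun t => (u * F (seg x y t))%C).
assert (Hh : forall t, in_itv 0 1 t -> rder h t (u * (dF (seg x y t) * (y - x)))%C).
{ intros t Ht.
  apply (rder_eq _ _ (0 * F (seg x y t) + u * (dF (seg x y t) * (y - x)))%C); [|ring].
  apply (rder_mult (fun _ => u)); [apply rder_const|].
  apply rder_comp; [now apply HF, HV|apply rder_line]. }
destruct (MVT_gen (fun t => Re (h t)) 0 1 (fun t => Re (u * (dF (seg x y t) * (y - x)))))
  as (c & Hc & Ec).
{ rewrite Rmin_left, Rmax_right by lra; intros t Ht; apply Hh; unfold in_itv; lra. }
{ rewrite Rmin_left, Rmax_right by lra; intros t Ht.
  apply derivable_continuous_pt; exists (Re (u * (dF (seg x y t) * (y - x)))).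
  apply is_derive_Reals; now apply Hh. }
rewrite Rmin_left, Rmax_right in Hc by lra.
unfold h in Ec at 1 2; rewrite seg_0, seg_1, E in Ec.
destruct (HF (seg x y c) (HV x y c Vx Vy Hc)) as [_ Pos].
replace (u * (dF (seg x y c) * (y - x)))%C
  with (dF (seg x y c) * RtoC (Cmod (y - x) ^ 2))%C in Ec.
2:{ rewrite Cmod2_conj; unfold u; ring. }
rewrite re_scal_r in Ec.
assert (0 < Cmod (y - x)).
{ apply Cmod_gt_0; intros E'; apply N; symmetry; now apply Ceq_minus. }
assert (0 < Cmod (y - x) ^ 2) by (apply pow_lt; lra); nra.
Qed.

(** The distance [|f z - w|] is minimized over a small closed disk around [p]. By injectivity [f]
    stays at distance at least [mu > 0] from [f p] on the boundary, so for [|w - f p| < mu / 2] the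
    minimum is interior; were it positive, a damped Newton step would lower it. *)
Lemma local_surjectivity V f p e : openC V -> hol V f ->
  (forall z w, V z -> V w -> f z = f w -> z = w) ->
  (forall z, V z -> C_derive f z <> 0) -> V p -> 0 < e ->
  exists d, 0 < d /\ forall w, Cmod (w - f p) < d ->
    exists z, V z /\ Cmod (z - p) < e /\ f z = w.
Proof.
intros OV Hf Inj Nf Vp He.
destruct (OV p Vp) as (r0 & Hr0 & HB).
set (r := Rmin r0 e / 2).
assert (Hm : 0 < Rmin r0 e) by now apply Rmin_pos.
assert (Hr : 0 < r) by (unfold r; lra).
assert (L1 : r < r0) by (unfold r; generalize (Rmin_l r0 e); lra).
assert (L2 : r < e) by (unfold r; generalize (Rmin_r r0 e); lra).
assert (Vr : forall z, Cmod (z - p) <= r -> V z) by (intros; apply HB; lra).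
assert (T : forall z, circle r z -> Cmod (p + z - p) = r).
{ intros z Hz; replace (p + z - p)%C with z by ring; exact Hz. }
destruct (compact_min (circle r) (fun z => RtoC (Cmod (f (p + z)%C - f p)))) as (z0 & Z0 & HM).
{ apply circle_compact. }
{ exists (RtoC r); unfold circle; rewrite Cmod_R, Rabs_pos_eq; lra. }
{ intros z Hz; apply cts_Cmod, cts_minus; [|apply cts_const].
  apply (cts_comp dC (circle r) everywhere f); [easy| |].
  - apply cts_plus; [apply cts_const|apply cts_id].
  - apply cdiff_cts, Hf, Vr; rewrite T by easy; lra. }
set (mu := Cmod (f (p + z0)%C - f p)).
assert (Hmu : 0 < mu).
{ apply Cmod_gt_0; intros E; apply Ceq_minus in E; apply Inj in E; auto.
  - assert (X := T z0 Z0); rewrite E, Cmod_sub_self in X; lra.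
  - apply Vr; rewrite T by easy; lra. }
assert (HM' : forall z, Cmod (z - p) = r -> mu <= Cmod (f z - f p)).
{ intros z Hz; specialize (HM (z - p)%C Hz); simpl in HM.
  now replace (p + (z - p))%C with z in HM by ring. }
exists (mu / 2); split; [lra|]; intros w Hw.
destruct (compact_min (cdisk p r) (fun z => RtoC (Cmod (f z - w)))) as (z1 & Z1 & Hmin).
{ apply cdisk_compact. }
{ exists p; unfold cdisk; rewrite Cmod_sub_self; lra. }
{ intros z Hz; apply cts_Cmod, cts_minus; [|apply cts_const].
  apply cdiff_cts, Hf, Vr; exact Hz. }
simpl in Hmin; unfold cdisk in *.
exists z1; split; [now apply Vr|]; split; [lra|].
apply Ceq_minus; destruct (Ceq_dec (f z1 - w) 0) as [|N]; [easy|exfalso].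
assert (Pn := proj1 (Cmod_gt_0 _) N).
assert (Lp : Cmod (f z1 - w) < mu / 2).
{ apply Rle_lt_trans with (Cmod (f p - w)); [|now rewrite Cmod_sub_sym].
  apply Hmin; rewrite Cmod_sub_self; lra. }
assert (Int : Cmod (z1 - p) < r).
{ destruct Z1 as [|E]; [easy|exfalso]; assert (A := HM' z1 E).
  assert (B := Cmod_sub_triangle (f z1) w (f p)); lra. }
assert (Vz1 := Vr z1 Z1).
assert (Nd := Nf z1 Vz1); assert (Pd := proj1 (Cmod_gt_0 _) Nd).
set (d := C_derive f z1) in *.
assert (Hd : cder f z1 d) by (apply cdiff_cder, Hf; easy).
destruct (Hd (Cmod d / 2)) as (dl & D & Hdl); [lra|].
(* Newton direction: moving from [z1] by [- t v] multiplies [f - w] by [1 - t] up to an error of at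
   most half the gain. *)
set (v := ((f z1 - w) / d)%C).
assert (Pv : 0 < Cmod v) by (unfold v; rewrite Cmod_div by easy; now apply Rdiv_lt_0_compat).
set (t := Rmin (1 / 2) (Rmin (dl / (2 * Cmod v)) ((r - Cmod (z1 - p)) / (2 * Cmod v)))).
assert (Ht : 0 < t) by (repeat apply Rmin_pos; try apply Rdiv_lt_0_compat; lra).
assert (T1 : t <= 1 / 2) by apply Rmin_l.
assert (T2 : t * (2 * Cmod v) <= dl).
{ apply Rle_trans with (dl / (2 * Cmod v) * (2 * Cmod v)); [|right; field; lra].
  apply Rmult_le_compat_r; [lra|]; eapply Rle_trans; [apply Rmin_r|apply Rmin_l]. }
assert (T3 : t * (2 * Cmod v) <= r - Cmod (z1 - p)).
{ apply Rle_trans with ((r - Cmod (z1 - p)) / (2 * Cmod v) * (2 * Cmod v)); [|right; field; lra].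
  apply Rmult_le_compat_r; [lra|]; eapply Rle_trans; [apply Rmin_r|apply Rmin_r]. }
set (z2 := (z1 - RtoC t * v)%C).
assert (E2 : (z2 - z1)%C = (- (RtoC t * v))%C) by (unfold z2; ring).
assert (M2 : Cmod (z2 - z1) = t * Cmod v)
  by (rewrite E2, Cmod_opp, Cmod_mult, Cmod_R, Rabs_pos_eq; lra).
assert (A := Hmin z2).
assert (In2 : Cmod (z2 - p) <= r).
{ assert (X := Cmod_sub_triangle z2 z1 p); nra. }
specialize (A In2).
assert (B := Hdl z2 ltac:(nra)).
assert (Cv : (d * v)%C = (f z1 - w)%C) by (unfold v; field; auto).
replace (f z2 - w)%C
  with ((f z2 - f z1 - d * (z2 - z1)) + RtoC (1 - t) * (f z1 - w))%C in A.
2:{ rewrite E2; replace (d * - (RtoC t * v))%C with (- RtoC t * (d * v))%C by ring.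
    rewrite Cv, RtoC_minus; ring. }
assert (C0 := Cmod_triangle (f z2 - f z1 - d * (z2 - z1)) (RtoC (1 - t) * (f z1 - w))).
rewrite (Cmod_mult (RtoC (1 - t))), Cmod_R, Rabs_pos_eq in C0 by lra.
rewrite M2 in B.
assert (Cm : Cmod (f z1 - w) = Cmod d * Cmod v) by (rewrite <- Cmod_mult, Cv; easy).
assert (0 < t * (Cmod d * Cmod v)) by (repeat apply Rmult_lt_0_compat; lra).
nra.
Qed.

Lemma inverse_exists V f : openC V -> hol V f ->
  (forall z w, V z -> V w -> f z = f w -> z = w) ->
  (forall z, V z -> C_derive f z <> 0) ->
  openC (fun w => exists z, V z /\ f z = w) /\
  exists g, forall z, V z -> g (f z) = z /\ cder g (f z) (/ C_derive f z).
Proof.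
intros OV Hf Inj Nf; split.
- intros w (z & Vz & <-).
  destruct (local_surjectivity V f z 1 OV Hf Inj Nf Vz ltac:(lra)) as (d & D & Hd).
  exists d; split; [easy|]; intros w Hw; destruct (Hd w Hw) as (x & Vx & _ & E); eauto.
- set (g := fun w => epsilon (inhabits (RtoC 0)) (fun z => V z /\ f z = w)).
  exists g.
  assert (Gs : forall w, (exists z, V z /\ f z = w) -> V (g w) /\ f (g w) = w).
  { intros w Hw; unfold g; now apply epsilon_spec. }
  assert (Gf : forall z, V z -> g (f z) = z).
  { intros z Vz; destruct (Gs (f z)) as [V1 E1]; eauto. }
  intros z Vz; split; [auto|].
  destruct (local_surjectivity V f z 1 OV Hf Inj Nf Vz ltac:(lra)) as (d & D & Hd).
  apply (cder_inverse f g (f z) (C_derive f z) d); auto.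
  + rewrite Gf by easy; apply cdiff_cder; auto.
  + intros w Hw; destruct (Hd w Hw) as (x & Vx & _ & E); apply Gs; eauto.
  + intros e He.
    destruct (local_surjectivity V f z e OV Hf Inj Nf Vz He) as (d1 & D1 & Hd1).
    exists d1; split; [easy|]; intros w _ Hw; destruct (Hd1 w Hw) as (x & Vx & Lx & <-).
    now rewrite !Gf.
Qed.

Lemma star_0_ray U z t : star 0 U -> U z -> in_itv 0 1 t -> U (RtoC t * z)%C.
Proof.
intros (_ & _ & St) Uz Ht; assert (H := St z t Uz Ht); unfold seg in H.
now replace (0 + RtoC t * (z - 0))%C with (RtoC t * z)%C in H by ring.
Qed.

Lemma zero_derivative_const U h : star 0 U -> (forall z, U z -> cder h z 0) ->
  forall z, U z -> h z = h 0.
Proof.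
intros HU Hh z Uz.
assert (H := rder_zero_const 0 1 (fun s => h (RtoC s * z)%C) Rle_0_1).
cbv beta in H; rewrite Cmult_1_l, Cmult_0_l in H; apply H.
intros t Ht; apply (rder_eq _ _ (0 * z)%C); [|ring].
apply rder_comp; [now apply Hh, star_0_ray|apply rder_ray].
Qed.

(** [L] is a primitive of [m' / m] on the star-shaped domain, and [m exp (- L)] has derivative
    zero. *)
Lemma log_exists U (m : C -> C) : star 0 U -> hol U m -> (forall z, U z -> m z <> 0) ->
  exists L : C -> C, L 0 = 0 /\ forall z, U z ->
    cder L z (C_derive m z / m z)%C /\ m z = (m 0 * cexp (L z))%C.
Proof.
intros HU Hm Nm.
assert (OU := proj1 HU); assert (U0 := proj1 (proj2 HU)).
set (l := fun z => (C_derive m z / m z)%C).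
assert (Hl : hol U l) by (intros z Uz; apply cdiff_div; auto; now apply hol_C_derive with U).
set (L := Iseg l 0).
assert (HL : forall z, U z -> cder L z (l z)).
{ intros; apply (primitive_star l 0 U); auto; apply cdiff_cts; auto. }
assert (L0 : L 0 = 0) by (unfold L, Iseg; ring).
exists L; split; [easy|]; intros z Uz; split; [now apply HL|].
assert (H := zero_derivative_const U (fun z => m z * cexp (- L z))%C HU).
cbv beta in H; rewrite L0 in H; replace (- 0)%C with (RtoC 0) in H by ring.
rewrite cexp_0, Cmult_1_r in H.
assert (H0 : (m z * cexp (- L z))%C = m 0).
{ apply H; [|easy]; intros x Ux.
  apply (cder_eq _ _ (C_derive m x * cexp (- L x) + m x * (cexp (- L x) * - l x))%C).
  + apply (cder_mult m (fun w => cexp (- L w))); [apply cdiff_cder; auto|].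
    apply (cder_cexp_comp (fun w => - L w)%C), cder_opp; auto.
  + unfold l; field; auto. }
rewrite <- H0, <- Cmult_assoc, <- cexp_plus.
replace (- L z + L z)%C with (RtoC 0) by ring.
rewrite cexp_0; ring.
Qed.

(** * The inverse hyperbolic tangent *)

Definition slit_plane (z : C) : Prop := ~ (Im z = 0 /\ 1 <= Rabs (Re z)).

Definition mob (z : C) : C := ((1 + z) / (1 - z))%C.

Definition artanh (z : C) : C := (Clog (mob z) / 2)%C.

Definition Ctanh (x : C) : C := ((cexp (2 * x) - 1) / (cexp (2 * x) + 1))%C.

Definition strip (x : C) : Prop := Rabs (Im x) < PI / 4.

Lemma C1_minus_neq (z : C) : z <> 1 -> (1 - z)%C <> 0.
Proof. intros N E; apply N; symmetry; now apply Ceq_minus. Qed.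

Lemma C1_plus_neq (z : C) : z <> (-(1))%C -> (1 + z)%C <> 0.
Proof.
intros N E; apply N; replace z with ((1 + z) - 1)%C by ring; rewrite E; ring.
Qed.

Lemma mob_parts (z : C) : z <> 1 -> let n := Cmod (1 - z) * Cmod (1 - z) in
  0 < n /\ Re (mob z) = (1 - Cmod z * Cmod z) / n /\ Im (mob z) = 2 * Im z / n.
Proof.
intros Nz n.
assert (Nw := C1_minus_neq z Nz).
assert (P := proj1 (Cmod_gt_0 _) Nw).
assert (Pn : 0 < n) by (unfold n; nra).
assert (E : mob z = (RtoC (/ n) * ((1 + z) * Cconj (1 - z)))%C).
{ unfold mob; rewrite RtoC_inv by lra.
  replace (RtoC n) with ((1 - z) * Cconj (1 - z))%C.
  2:{ rewrite <- Cmod2_conj; unfold n; simpl; now rewrite Rmult_1_r, RtoC_mult. }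
  assert (Cconj (1 - z) <> 0) by (apply Cmod_gt_0; now rewrite Cmod_conj).
  field; repeat split; auto. }
rewrite E, re_scal_l, im_scal_l, re_mult, im_mult, re_conj, im_conj, Cmod_sqr.
rewrite !re_plus, !im_plus, re_minus, im_minus, re_RtoC, im_RtoC.
split; [easy|]; split; field; lra.
Qed.

Lemma slit_plane_mob (z : C) : slit_plane z -> z <> 1 /\ z <> (-(1))%C /\ slit (mob z).
Proof.
intros H.
assert (N1 : z <> 1) by (intros ->; apply H; simpl; rewrite Rabs_R1; lra).
assert (N2 : z <> (-(1))%C).
{ intros ->; apply H; simpl; rewrite Rabs_Ropp, Rabs_R1; lra. }
split; [easy|split; [easy|]].
destruct (mob_parts z N1) as (Pn & HR & HI).
set (n := Cmod (1 - z) * Cmod (1 - z)) in *.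
assert (Q := Cmod_sqr (mob z)); assert (P0 := Cmod_ge_0 (mob z)).
unfold slit; destruct (Rlt_dec 0 (Re (mob z))) as [Hp|Hp]; [lra|].
assert (HI0 : Im (mob z) <> 0 \/ Re (mob z) = 0).
{ destruct (Req_dec (Im z) 0) as [E|E].
  - exfalso; apply Hp; rewrite HR; apply Rdiv_lt_0_compat; [|easy].
    rewrite Cmod_sqr, E.
    assert (A : ~ 1 <= Rabs (Re z)) by (intros X; now apply H).
    assert (B := Rabs_pos (Re z)).
    replace (Re z * Re z) with (Rabs (Re z) * Rabs (Re z))
      by (rewrite <- Rabs_mult; apply Rabs_pos_eq; nra).
    nra.
  - left; rewrite HI; unfold Rdiv; intros E'; apply Rmult_integral in E'.
    destruct E' as [|E']; [lra|]; generalize (Rinv_0_lt_compat n Pn); lra. }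
destruct HI0 as [HI0|HI0].
- assert (0 < Im (mob z) * Im (mob z)) by nra; nra.
- rewrite HI0.
  assert (N3 : mob z <> 0).
  { unfold mob; apply Cmult_neq_0; [now apply C1_plus_neq|].
    apply Cmod_gt_0; rewrite Cmod_inv by now apply C1_minus_neq.
    now apply Rinv_0_lt_compat, Cmod_gt_0, C1_minus_neq. }
  apply Cmod_gt_0 in N3; lra.
Qed.

Lemma slit_plane_star : star 0 slit_plane.
Proof.
split; [|split].
- intros z Hz; destruct (Req_dec (Im z) 0) as [E|N].
  + assert (A : ~ 1 <= Rabs (Re z)) by (intros X; now apply Hz).
    exists (1 - Rabs (Re z)); split; [lra|]; intros w Hw [_ H].
    assert (B := re_le_Cmod (w - z)); rewrite re_minus in B.
    assert (D := Rabs_triang (Re w - Re z) (Re z)).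
    replace (Re w - Re z + Re z) with (Re w) in D by ring; lra.
  + exists (Rabs (Im z)); split; [now apply Rabs_pos_lt|]; intros w Hw [H _].
    assert (B := im_le_Cmod (w - z)); rewrite im_minus, H, Rminus_0_l, Rabs_Ropp in B; lra.
- intros [_ H]; simpl in H; rewrite Rabs_R0 in H; lra.
- intros z t Hz [T0 T1]; unfold seg.
  replace (0 + RtoC t * (z - 0))%C with (RtoC t * z)%C by ring.
  intros [E H]; rewrite im_scal_l in E; rewrite re_scal_l, Rabs_mult, Rabs_pos_eq in H by easy.
  assert (P := Rabs_pos (Re z)).
  apply Rmult_integral in E; destruct E as [->|E]; [lra|].
  apply Hz; split; [easy|nra].
Qed.

Lemma slit_plane_open : openC slit_plane.
Proof. apply slit_plane_star. Qed.

Lemma slit_plane_circle (z : C) : Cmod z <= 1 -> z <> 1 -> z <> (-(1))%C -> slit_plane z.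
Proof.
intros Hz N1 N2 [E H].
assert (A := re_le_Cmod z).
assert (B : Rabs (Re z) = 1) by lra.
unfold Rabs in B; destruct (Rcase_abs (Re z)).
- apply N2, C_ext; simpl; lra.
- apply N1, C_ext; simpl; lra.
Qed.

Lemma slit_plane_disk z : in_disk z -> slit_plane z.
Proof. intros Hz [_ H]; unfold in_disk in Hz; generalize (re_le_Cmod z); lra. Qed.

Lemma in_disk_star : star 0 in_disk.
Proof.
split; [apply in_disk_open|split].
- unfold in_disk; rewrite Cmod_0; lra.
- intros z t Hz [T0 T1]; unfold seg, in_disk in *.
  replace (0 + RtoC t * (z - 0))%C with (RtoC t * z)%C by ring.
  rewrite Cmod_mult, Cmod_R, Rabs_pos_eq by easy; generalize (Cmod_ge_0 z); nra.
Qed.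

Lemma cder_artanh z : slit_plane z -> cder artanh z (/ (1 - z * z)).
Proof.
intros Hz; destruct (slit_plane_mob z Hz) as (N1 & N2 & Sl).
assert (M1 := C1_minus_neq z N1); assert (M2 := C1_plus_neq z N2).
assert (Dm : cder mob z (((0 + 1) * (1 - z) - (1 + z) * (0 - 1)) / ((1 - z) * (1 - z)))%C).
{ apply (cder_div (fun z => 1 + z)%C (fun z => 1 - z)%C); [easy| |].
  - apply cder_plus; [apply cder_const|apply cder_id].
  - apply cder_minus; [apply cder_const|apply cder_id]. }
apply (cder_ext_loc (fun w => / 2 * Clog (mob w))%C) with (r := 1); [lra| |].
{ intros; unfold artanh, Cdiv; ring. }
eapply cder_eq.
- apply cder_scal, (cder_comp Clog mob); [now apply cder_Clog|exact Dm].
- unfold mob; field; repeat split; auto using C2_neq_0.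
  replace (1 - z * z)%C with ((1 - z) * (1 + z))%C by ring; now apply Cmult_neq_0.
Qed.

Lemma Ctanh_artanh z : slit_plane z -> Ctanh (artanh z) = z.
Proof.
intros Hz; destruct (slit_plane_mob z Hz) as (N1 & N2 & Sl).
unfold Ctanh; replace (2 * artanh z)%C with (Clog (mob z)).
2:{ unfold artanh; field; apply C2_neq_0. }
rewrite cexp_Clog by easy; unfold mob.
assert (M1 := C1_minus_neq z N1).
field; repeat split; auto.
replace (1 + z + (1 - z))%C with (RtoC 2) by ring; apply C2_neq_0.
Qed.

Lemma Im_artanh z : slit_plane z ->
  Im (artanh z) = atan (Im (mob z) / (Cmod (mob z) + Re (mob z))).
Proof.
intros Hz; destruct (slit_plane_mob z Hz) as (N1 & N2 & Sl).
replace (artanh z) with (RtoC (/ 2) * Clog (mob z))%C.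
2:{ unfold artanh; rewrite RtoC_inv by lra; unfold Cdiv; ring. }
rewrite im_scal_l; change (Im (Clog (mob z))) with (Carg (mob z)).
rewrite Carg_slit by easy; lra.
Qed.

Lemma artanh_strip z : in_disk z -> strip (artanh z).
Proof.
intros Hd; assert (Hz := slit_plane_disk z Hd).
unfold strip; rewrite Im_artanh by easy.
destruct (slit_plane_mob z Hz) as (N1 & N2 & Sl).
destruct (mob_parts z N1) as (Pn & HR & HI).
assert (Re_pos : 0 < Re (mob z)).
{ rewrite HR; apply Rdiv_lt_0_compat; [|easy].
  unfold in_disk in Hd; generalize (Cmod_ge_0 z); nra. }
assert (A := im_le_Cmod (mob z)); apply Rabs_le_between in A.
set (u := Im (mob z) / (Cmod (mob z) + Re (mob z))).
assert (U1 : - (1) < u < 1).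
{ unfold u; split; apply Rmult_lt_reg_r with (Cmod (mob z) + Re (mob z)); try lra;
    unfold Rdiv; rewrite Rmult_assoc, Rinv_l by lra; lra. }
apply Rabs_lt_between; rewrite <- atan_1, <- atan_opp.
split; apply atan_increasing; lra.
Qed.

(** On the circle [mob z] is purely imaginary, so its argument is [PI / 2] with the sign of [Im z]:
    the two open arcs go to the two edges of the strip. *)
Lemma Im_artanh_circle (z : C) : Cmod z = 1 -> z <> 1 -> z <> (-(1))%C ->
  (0 < Im z -> Im (artanh z) = PI / 4) /\ (Im z < 0 -> Im (artanh z) = - (PI / 4)) /\
  Im z <> 0.
Proof.
intros Hc N1 N2.
assert (Hz : slit_plane z) by (apply slit_plane_circle; auto; lra).
rewrite Im_artanh by easy.
destruct (mob_parts z N1) as (Pn & HR & HI).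
rewrite Hc in HR; replace (1 - 1 * 1) with 0 in HR by ring; rewrite Rdiv_0_l in HR.
assert (Q := Cmod_sqr (mob z)); rewrite HR in *.
set (m := Cmod (mob z)) in *; set (i := Im (mob z)) in *.
assert (P0 : 0 <= m) by apply Cmod_ge_0.
rewrite Rplus_0_r, <- atan_1, <- atan_opp.
assert (I0 := Rinv_0_lt_compat _ Pn).
split; [|split].
- intros Hi; assert (0 < i) by (rewrite HI; apply Rdiv_lt_0_compat; lra).
  f_equal; assert (m = i) by nra; rewrite H0; field; lra.
- intros Hi; assert (i < 0) by (rewrite HI; unfold Rdiv; nra).
  f_equal; assert (m = - i) by nra; rewrite H0; field; lra.
- intros E; apply Hz; split; [easy|].
  assert (S := Cmod_sqr z); rewrite Hc, E in S.
  unfold Rabs; destruct (Rcase_abs (Re z)); nra.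
Qed.

Lemma Re_cexp_pos x : strip x -> 0 < Re (cexp (2 * x)).
Proof.
unfold strip; intros H; apply Rabs_lt_between in H.
rewrite Re_cexp; apply Rmult_lt_0_compat; [apply exp_pos|].
rewrite im_scal_l; apply cos_gt_0; lra.
Qed.

Lemma cexp_plus_1_neq x : strip x -> (cexp (2 * x) + 1)%C <> 0.
Proof.
intros H E; assert (A := Re_cexp_pos x H).
apply (f_equal Re) in E; rewrite re_plus, !re_RtoC in E; lra.
Qed.

Lemma Ctanh_disk x : strip x -> in_disk (Ctanh x).
Proof.
intros H; assert (A := Re_cexp_pos x H); assert (N := cexp_plus_1_neq x H).
unfold in_disk, Ctanh; rewrite Cmod_div by easy.
assert (P := proj1 (Cmod_gt_0 _) N).
apply Rmult_lt_reg_r with (Cmod (cexp (2 * x) + 1)); [easy|].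
unfold Rdiv; rewrite Rmult_assoc, Rinv_l, Rmult_1_r, Rmult_1_l by lra.
apply Rsqr_incrst_0; try apply Cmod_ge_0; unfold Rsqr; rewrite !Cmod_sqr.
rewrite re_minus, im_minus, re_plus, im_plus, re_RtoC, im_RtoC; nra.
Qed.

Lemma cder_Ctanh x : strip x -> cder Ctanh x (1 - Ctanh x * Ctanh x).
Proof.
intros H; assert (N := cexp_plus_1_neq x H).
assert (De : cder (fun w => cexp (2 * w)) x (cexp (2 * x) * (2 * 1))%C)
  by (apply (cder_cexp_comp (fun w => 2 * w)%C), cder_scal, cder_id).
eapply cder_eq.
- apply (cder_div (fun w => cexp (2 * w) - 1)%C (fun w => cexp (2 * w) + 1)%C); [easy| |].
  + apply cder_minus; [exact De|apply cder_const].
  + apply cder_plus; [exact De|apply cder_const].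
- unfold Ctanh; field; easy.
Qed.

Lemma Clog_conj w : slit w -> Clog (Cconj w) = Cconj (Clog w).
Proof.
intros Hw.
assert (Hw' : slit (Cconj w)) by (unfold slit in *; rewrite Cmod_conj, re_conj; easy).
unfold Clog; rewrite !Carg_slit by easy; rewrite Cmod_conj, re_conj, im_conj.
apply C_ext; simpl; [easy|].
rewrite Rdiv_opp_l, atan_opp; ring.
Qed.

Lemma RtoC_conj (x : R) : Cconj (RtoC x) = RtoC x.
Proof. apply C_ext; simpl; ring. Qed.

Lemma artanh_conj z : slit_plane z -> artanh (Cconj z) = Cconj (artanh z).
Proof.
intros Hz; destruct (slit_plane_mob z Hz) as (N1 & N2 & Sl).
unfold artanh; rewrite Cdiv_conj by apply C2_neq_0.
rewrite RtoC_conj, <- Clog_conj by easy; f_equal; f_equal; unfold mob.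
rewrite Cdiv_conj by now apply C1_minus_neq.
now rewrite Cplus_conj, Cminus_conj, RtoC_conj.
Qed.

Lemma artanh_0 : artanh 0 = 0.
Proof.
unfold artanh, mob; replace ((1 + 0) / (1 - 0))%C with (cexp 0).
- rewrite Clog_cexp; [unfold Cdiv; ring|simpl; rewrite Rabs_R0; apply PI_RGT_0].
- rewrite cexp_0; replace (1 - 0)%C with (RtoC 1) by ring; field.
Qed.

Lemma ln_le_sqrt y : 0 < y -> ln y <= 2 * sqrt y.
Proof.
intros Hy; assert (S := sqrt_lt_R0 y Hy).
rewrite <- (sqrt_sqrt y) at 1 by lra.
rewrite ln_mult by easy.
assert (A := exp_ineq1_le (ln (sqrt y))); rewrite exp_ln in A by easy; lra.
Qed.

(** The logarithmic growth at 1 and -1 is weakened to that of a square root. This is crude, but the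
    factors [1 - w^2] and [4 s^3] met later still outweigh it. *)
Lemma artanh_bound (z : C) d : 0 < d <= 1 -> Cmod z <= 1 -> d <= Cmod (1 - z) ->
  d <= Cmod (1 + z) -> Cmod (artanh z) <= sqrt (2 / d) + 2.
Proof.
intros Hd Hz H1 H2.
assert (N1 : (1 - z)%C <> 0) by (apply Cmod_gt_0; lra).
assert (U1 : Cmod (1 - z) <= 2).
{ apply Rle_trans with (1 := Cmod_sub_le_sum _ _); rewrite Cmod_1; lra. }
assert (U2 : Cmod (1 + z) <= 2).
{ apply Rle_trans with (1 := Cmod_triangle _ _); rewrite Cmod_1; lra. }
unfold artanh; rewrite Cmod_div, Cmod_R, Rabs_pos_eq by (try apply C2_neq_0; lra).
assert (Pd : 0 < 2 / d) by (apply Rdiv_lt_0_compat; lra).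
assert (L := ln_le_sqrt (2 / d) Pd).
assert (A : Cmod (Clog (mob z)) <= ln (2 / d) + 4).
{ apply Rle_trans with (1 := Cmod_le_Re_Im _); apply Rplus_le_compat.
  - unfold Clog; simpl; unfold mob; rewrite Cmod_div by easy.
    unfold Rdiv; rewrite ln_mult, ln_Rinv by (try apply Rinv_0_lt_compat; lra).
    replace (ln (2 * / d)) with (ln 2 - ln d)
      by (rewrite ln_mult, ln_Rinv by (try apply Rinv_0_lt_compat; lra); ring).
    assert (B1 := ln_le _ _ (proj1 Hd) H1); assert (B2 := ln_le _ _ (proj1 Hd) H2).
    assert (B3 := ln_le (Cmod (1 - z)) 2 ltac:(lra) U1).
    assert (B4 := ln_le (Cmod (1 + z)) 2 ltac:(lra) U2).
    apply Rabs_le; lra.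
  - unfold Clog; simpl; unfold Carg.
    assert (P4 := PI_4).
    destruct (Rlt_dec _ _); [rewrite Rabs_Ropp|];
      (rewrite Rabs_pos_eq; [|apply acos_bound]); 
      apply Rle_trans with PI; auto; apply acos_bound. }
lra.
Qed.

(* The total function [artanh] has junk values at [1] and [-1]; the factor
   [1 - w^2] annihilates them. *)
Lemma artanh_weighted_cts (z : C) : Cmod z <= 1 ->
  cts dC (cdisk 0 1) (fun w => (1 - w * w) * artanh w)%C z.
Proof.
intros Hz.
assert (Sing : forall p : C, p = 1 \/ p = (-(1))%C ->
  cts dC (cdisk 0 1) (fun w => (1 - w * w) * artanh w)%C p).
{ intros p Hp e He.
  (* At distance [d] from the singular point the product is at most [2 sqrt (2 d) + 4 d]; each
     summand is below [e / 2] when [d < e^2 / 32] and [d < e / 8]. *)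
  exists (Rmin (1 / 2) (Rmin (e * e / 32) (e / 8))); split.
  { repeat apply Rmin_pos; try lra; apply Rdiv_lt_0_compat; nra. }
  intros w Kw Hw; unfold dC in Hw.
  unfold cdisk in Kw; replace (w - 0)%C with w in Kw by ring.
  assert (A1 := Rlt_le_trans _ _ _ Hw (Rmin_l _ _)).
  assert (A := Rlt_le_trans _ _ _ Hw (Rmin_r _ _)).
  assert (A2 := Rlt_le_trans _ _ _ A (Rmin_l _ _)).
  assert (A3 := Rlt_le_trans _ _ _ A (Rmin_r _ _)).
  replace ((1 - p * p) * artanh p)%C with (RtoC 0)
    by (destruct Hp as [-> | ->]; ring).
  replace ((1 - w * w) * artanh w - 0)%C with ((1 - w) * (1 + w) * artanh w)%C by ring.
  destruct (Ceq_dec w p) as [->|N].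
  { replace ((1 - p) * (1 + p) * artanh p)%C with (RtoC 0)
      by (destruct Hp as [-> | ->]; ring).
    rewrite Cmod_0; lra. }
  set (d := Cmod (w - p)) in *.
  assert (Pd : 0 < d).
  { apply Cmod_gt_0; intros E; apply N; now apply Ceq_minus. }
  assert (U1 : Cmod (1 - w) <= 2).
  { apply Rle_trans with (1 := Cmod_sub_le_sum _ _); rewrite Cmod_1; lra. }
  assert (U2 : Cmod (1 + w) <= 2).
  { apply Rle_trans with (1 := Cmod_triangle _ _); rewrite Cmod_1; lra. }
  assert (C2 : Cmod 2 = 2) by (rewrite Cmod_R, Rabs_pos_eq; lra).
  assert (Hprod : Cmod (1 - w) * Cmod (1 + w) <= 2 * d /\ d <= Cmod (1 - w) /\ d <= Cmod (1 + w)).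
  { destruct Hp as [-> | ->].
    - assert (E : Cmod (1 - w) = d) by (unfold d; apply Cmod_sub_sym).
      assert (B := Cmod_sub_le 2 (1 - w)).
      replace (2 - (1 - w))%C with (1 + w)%C in B by ring; rewrite E in *; nra.
    - assert (E : Cmod (1 + w) = d) by (unfold d; f_equal; ring).
      assert (B := Cmod_sub_le 2 (1 + w)).
      replace (2 - (1 + w))%C with (1 - w)%C in B by ring; rewrite E in *; nra. }
  destruct Hprod as (B1 & B2 & B3).
  assert (B := artanh_bound w d ltac:(lra) Kw B2 B3).
  rewrite !Cmod_mult.
  apply Rle_lt_trans with (2 * d * (sqrt (2 / d) + 2)).
  { apply Rmult_le_compat; auto using Cmod_ge_0.
    apply Rmult_le_pos; apply Cmod_ge_0. }
  assert (E : d * sqrt (2 / d) = sqrt (2 * d)).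
  { rewrite <- (sqrt_Rsqr d) at 1 by lra; rewrite <- sqrt_mult_alt by (unfold Rsqr; nra).
    f_equal; unfold Rsqr; field; lra. }
  assert (F : sqrt (2 * d) < e / 4).
  { rewrite <- (sqrt_Rsqr (e / 4)) by lra; apply sqrt_lt_1_alt; unfold Rsqr; lra. }
  replace (2 * d * (sqrt (2 / d) + 2)) with (2 * (d * sqrt (2 / d)) + 4 * d) by ring.
  rewrite E; lra. }
destruct (Ceq_dec z 1) as [E1|N1]; [apply Sing; auto|].
destruct (Ceq_dec z (-(1))) as [E2|N2]; [apply Sing; auto|].
apply cts_mult.
- apply cts_minus; [apply cts_const|apply cts_mult; apply cts_id].
- eapply cder_cts, cder_artanh, slit_plane_circle; auto.
Qed.

(** * Convexity of the level sets of the hyperbolic tangent *)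

Lemma cosh_tangent a b : cosh a + sinh a * (b - a) <= cosh b.
Proof.
unfold cosh, sinh.
assert (A := exp_ineq1_le (b - a)); assert (B := exp_ineq1_le (a - b)).
assert (P1 := exp_pos a); assert (P2 := exp_pos (- a)).
assert (E1 : exp b = exp a * exp (b - a)) by (rewrite <- exp_plus; f_equal; ring).
assert (E2 : exp (- b) = exp (- a) * exp (a - b)) by (rewrite <- exp_plus; f_equal; ring).
rewrite E1, E2; nra.
Qed.

Lemma cos_tangent a b : - (PI / 2) <= a <= PI / 2 -> - (PI / 2) <= b <= PI / 2 ->
  cos b <= cos a - sin a * (b - a).
Proof.
intros Ha Hb.
destruct (MVT_gen cos a b (fun x => - sin x)) as (c & Hc & E).
{ intros; auto_derive; auto; ring. }
{ intros; apply continuity_cos. }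
enough (sin a * (b - a) <= sin c * (b - a)) by lra.
destruct (Rle_dec a b) as [L|L].
- rewrite Rmin_left, Rmax_right in Hc by easy.
  apply Rmult_le_compat_r; [lra|].
  apply sin_incr_1; lra.
- rewrite Rmin_right, Rmax_left in Hc by lra.
  assert (sin c <= sin a) by (apply sin_incr_1; lra); nra.
Qed.

(** With [u = 2 Re x] and [v = 2 Im x] this is [|tanh x|^2 = (cosh u - cos v) / (cosh u + cos v)],
    cleared of denominators; [E] times the two factors gives [|exp (2 x) - 1|^2] and
    [|exp (2 x) + 1|^2]. *)
Lemma Cmod_Ctanh x : strip x -> let E := 2 * exp (2 * Re x) in
  Cmod (Ctanh x) * Cmod (Ctanh x) * (E * (cosh (2 * Re x) + cos (2 * Im x)))
   = E * (cosh (2 * Re x) - cos (2 * Im x)) /\ 0 < cos (2 * Im x).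
Proof.
intros H E; assert (N := cexp_plus_1_neq x H); assert (A := Re_cexp_pos x H).
assert (P := proj1 (Cmod_gt_0 _) N).
set (e := cexp (2 * x)) in *.
assert (Re e = exp (2 * Re x) * cos (2 * Im x)) by (unfold e; now rewrite Re_cexp, re_scal_l, im_scal_l).
assert (Se : Re e * Re e + Im e * Im e = exp (2 * Re x) * exp (2 * Re x)).
{ rewrite <- Cmod_sqr; unfold e; now rewrite Cmod_cexp, re_scal_l. }
assert (Ec : exp (2 * Re x) * cosh (2 * Re x) = (exp (2 * Re x) * exp (2 * Re x) + 1) / 2).
{ unfold cosh; assert (exp (2 * Re x) * exp (- (2 * Re x)) = 1)
    by (rewrite <- exp_plus, Rplus_opp_r; apply exp_0); nra. }
assert (D1 : E * (cosh (2 * Re x) + cos (2 * Im x)) = Cmod (e + 1) * Cmod (e + 1)).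
{ rewrite Cmod_sqr, re_plus, im_plus, re_RtoC, im_RtoC; unfold E; nra. }
assert (D2 : E * (cosh (2 * Re x) - cos (2 * Im x)) = Cmod (e - 1) * Cmod (e - 1)).
{ rewrite Cmod_sqr, re_minus, im_minus, re_RtoC, im_RtoC; unfold E; nra. }
split.
- rewrite D1, D2; unfold Ctanh; fold e; rewrite Cmod_div by easy; field; lra.
- generalize (exp_pos (2 * Re x)); nra.
Qed.

(* [level_normal x = sinh (2 x)] is [2 z / (1 - z^2)] at [z = Ctanh x], hence an
   outer normal at [x] of the level set of [|Ctanh|]. *)
Definition level_normal (x : C) : C := ((cexp (2 * x) - cexp (- (2 * x))) / 2)%C.

Lemma level_normal_parts x :
  Re (level_normal x) = sinh (2 * Re x) * cos (2 * Im x) /\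
  Im (level_normal x) = cosh (2 * Re x) * sin (2 * Im x).
Proof.
assert (E : level_normal x = (RtoC (/ 2) * (cexp (2 * x) - cexp (- (2 * x))))%C).
{ unfold level_normal; rewrite RtoC_inv by lra; unfold Cdiv; ring. }
rewrite E, re_scal_l, im_scal_l, re_minus, im_minus, !Re_cexp, !Im_cexp.
rewrite re_opp, im_opp, re_scal_l, im_scal_l, cos_neg, sin_neg.
unfold sinh, cosh; split; field.
Qed.

(** On the strip [|tanh|] is an increasing function of the quotient of [cosh (2 Re x)], which is
    convex, by [cos (2 Im x)], which is concave and positive. Its sublevel sets are therefore
    convex, and the tangent inequalities for [cosh] and [cos] at [x] separate them by the normal. *)
Lemma level_sets_convex x a : strip x -> strip a ->
  Cmod (Ctanh a) < Cmod (Ctanh x) -> Re ((a - x) * Cconj (level_normal x)) < 0.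
Proof.
intros Hx Ha Hlt.
destruct (Cmod_Ctanh x Hx) as [Ex Cx]; destruct (Cmod_Ctanh a Ha) as [Ea Ca].
destruct (level_normal_parts x) as [NR NI].
rewrite re_mult, re_conj, im_conj, NR, NI, re_minus, im_minus.
unfold strip in *; apply Rabs_lt_between in Hx; apply Rabs_lt_between in Ha.
assert (T1 := cosh_tangent (2 * Re x) (2 * Re a)).
assert (T2 := cos_tangent (2 * Im x) (2 * Im a) ltac:(lra) ltac:(lra)).
assert (P1 := exp_pos (2 * Re x)); assert (P2 := exp_pos (2 * Re a)).
assert (Q1 := Cmod_ge_0 (Ctanh a)).
set (hx := cosh (2 * Re x)) in *; set (ha := cosh (2 * Re a)) in *.
set (cx := cos (2 * Im x)) in *; set (ca := cos (2 * Im a)) in *.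
set (sx := sinh (2 * Re x)) in *; set (kx := sin (2 * Im x)) in *.
set (tx := Cmod (Ctanh x) * Cmod (Ctanh x)) in *.
set (ta := Cmod (Ctanh a) * Cmod (Ctanh a)) in *.
assert (Ht : ta < tx) by (unfold ta, tx; nra).
assert (Hx1 : 0 < hx) by (unfold hx, cosh; generalize (exp_pos (2 * Re x)) (exp_pos (- (2 * Re x))); lra).
assert (Ha1 : 0 < ha) by (unfold ha, cosh; generalize (exp_pos (2 * Re a)) (exp_pos (- (2 * Re a))); lra).
assert (Ex' : tx * (hx + cx) = hx - cx).
{ apply Rmult_eq_reg_l with (2 * exp (2 * Re x)); [|lra]; rewrite <- Ex; ring. }
assert (Ea' : ta * (ha + ca) = ha - ca).
{ apply Rmult_eq_reg_l with (2 * exp (2 * Re a)); [|lra]; rewrite <- Ea; ring. }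
(* The comparison of moduli becomes a comparison of the quotients [cosh / cos], after
   cross-multiplication. *)
assert (Cr : ha * cx < ca * hx).
{ assert ((ha - ca) * (hx + cx) < (hx - cx) * (ha + ca)); [|nra].
  rewrite <- Ex', <- Ea'.
  replace (ta * (ha + ca) * (hx + cx)) with (ta * ((ha + ca) * (hx + cx))) by ring.
  replace (tx * (hx + cx) * (ha + ca)) with (tx * ((ha + ca) * (hx + cx))) by ring.
  apply Rmult_lt_compat_r; [|easy]; apply Rmult_lt_0_compat; lra. }
assert (U1 : cx * (hx + sx * (2 * Re a - 2 * Re x)) <= cx * ha)
  by (apply Rmult_le_compat_l; lra).
assert (U2 : hx * ca <= hx * (cx - kx * (2 * Im a - 2 * Im x)))
  by (apply Rmult_le_compat_l; lra).
nra.
Qed.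

Lemma level_normal_tanh x : strip x ->
  (level_normal x * (1 - Ctanh x * Ctanh x))%C = (2 * Ctanh x)%C.
Proof.
intros H; assert (N := cexp_plus_1_neq x H); assert (N0 := cexp_neq_0 (2 * x)).
unfold level_normal, Ctanh; rewrite cexp_opp; field; repeat split; auto using C2_neq_0.
Qed.

(** * Legendre's chi function and the class of normalized functions *)

Definition dprod {T1 T2 : Type} (d1 : T1 -> T1 -> R) (d2 : T2 -> T2 -> R)
  (x y : T1 * T2) : R := d1 (fst x) (fst y) + d2 (snd x) (snd y).

Definition distance {T : Type} (d : T -> T -> R) : Prop :=
  forall x y, 0 <= d x y /\ d x x = 0.

Lemma distance_dC : distance dC.
Proof. intros x y; split; [apply Cmod_ge_0|apply dC_self]. Qed.

Lemma distance_dR : distance dR.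
Proof.
intros x y; split; [apply Rabs_pos|unfold dR; now rewrite Rminus_diag_eq, Rabs_R0].
Qed.

Lemma distance_dprod {T1 T2} (d1 : T1 -> T1 -> R) (d2 : T2 -> T2 -> R) :
  distance d1 -> distance d2 -> distance (dprod d1 d2).
Proof.
intros H1 H2 [x1 x2] [y1 y2]; unfold dprod; simpl.
destruct (H1 x1 y1), (H2 x2 y2); split; lra.
Qed.

Section Products.
Context {T1 T2 : Type} (d1 : T1 -> T1 -> R) (d2 : T2 -> T2 -> R).
Hypotheses (H1 : distance d1) (H2 : distance d2).

Lemma cts_fst (S : T1 * T2 -> Prop) (S1 : T1 -> Prop) (f : T1 -> C) x :
  (forall y, S y -> S1 (fst y)) -> cts d1 S1 f (fst x) ->
  cts (dprod d1 d2) S (fun y => f (fst y)) x.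
Proof.
intros HS Hf e He; destruct (Hf e He) as (d & D & Hd); exists d; split; [easy|].
intros y Sy Hy; apply Hd; auto; unfold dprod in Hy.
destruct (H2 (snd y) (snd x)); lra.
Qed.

Lemma cts_snd (S : T1 * T2 -> Prop) (S2 : T2 -> Prop) (f : T2 -> C) x :
  (forall y, S y -> S2 (snd y)) -> cts d2 S2 f (snd x) ->
  cts (dprod d1 d2) S (fun y => f (snd y)) x.
Proof.
intros HS Hf e He; destruct (Hf e He) as (d & D & Hd); exists d; split; [easy|].
intros y Sy Hy; apply Hd; auto; unfold dprod in Hy.
destruct (H1 (fst y) (fst x)); lra.
Qed.

Lemma cts_section (S1 : T1 -> Prop) (S2 : T2 -> Prop) (f : T1 * T2 -> C) x p :
  S2 p -> cts (dprod d1 d2) (fun y => S1 (fst y) /\ S2 (snd y)) f (x, p) ->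
  cts d1 S1 (fun y => f (y, p)) x.
Proof.
intros Sp Hf e He; destruct (Hf e He) as (d & D & Hd); exists d; split; [easy|].
intros y Sy Hy; apply Hd; [easy|]; unfold dprod; simpl.
destruct (H2 p p); lra.
Qed.

End Products.

Lemma segment_compact a b : compactC (fun z => Im z = 0 /\ in_itv a b (Re z)).
Proof.
split.
- intros p Hp.
  destruct (Req_dec (Im p) 0) as [E|N].
  + assert (Hr : Re p < a \/ b < Re p).
    { destruct (Rlt_dec (Re p) a), (Rlt_dec b (Re p)); auto.
      exfalso; apply Hp; unfold in_itv; split; lra. }
    destruct Hr as [Hr|Hr].
    * exists (a - Re p); split; [lra|]; intros w Hw [_ [H _]].
      assert (A := re_le_Cmod (w - p)); rewrite re_minus in A.
      apply Rabs_le_between in A; lra.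
    * exists (Re p - b); split; [lra|]; intros w Hw [_ [_ H]].
      assert (A := re_le_Cmod (w - p)); rewrite re_minus in A.
      apply Rabs_le_between in A; lra.
  + exists (Rabs (Im p)); split; [now apply Rabs_pos_lt|]; intros w Hw [H _].
    assert (A := im_le_Cmod (w - p)); rewrite im_minus, H, Rminus_0_l, Rabs_Ropp in A; lra.
- exists (Rabs a + Rabs b); intros z [H [Ha Hb]].
  apply Rle_trans with (1 := Cmod_le_Re_Im z); rewrite H, Rabs_R0, Rplus_0_r.
  apply Rabs_le; generalize (Rle_abs a) (Rle_abs b) (Rle_abs (- a)) (Rle_abs (- b));
    rewrite !Rabs_Ropp; generalize (Rabs_pos a) (Rabs_pos b); lra.
Qed.

(** Only the interval of integration has to be compact: joint continuity at each [(t, p0)] becomes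
    uniform in [t]. The interval is embedded in the plane as a segment, so that [compact_uniform]
    applies, and the parameter space stays arbitrary. *)
Lemma CInt_param_cts {P : Type} (dp : P -> P -> R) (S : P -> Prop) (k : P -> R -> C) a b p0 :
  a <= b -> distance dp -> S p0 ->
  (forall p t, S p -> in_itv a b t ->
     cts (dprod dR dp) (fun x => in_itv a b (fst x) /\ S (snd x))
       (fun x => k (snd x) (fst x)) (t, p)) ->
  cts dp S (fun p => CInt (k p) a b) p0.
Proof.
intros Hab Hdp S0 Hk e He.
assert (Hr : forall p, S p -> rcts a b (k p)).
{ intros p Sp t Ht.
  apply (cts_section dR dp Hdp (in_itv a b) S (fun x => k (snd x) (fst x)) t p); auto. }
set (q := e / (2 * (b - a + 1))).
assert (Hq : 0 < q) by (apply Rdiv_lt_0_compat; lra).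
destruct (compact_uniform (fun z => Im z = 0 /\ in_itv a b (Re z))
  (fun x d => forall p, S p -> dp p p0 < d -> Cmod (k p (Re x) - k p0 (Re x)) <= q))
  as (d & D & Hd).
{ apply segment_compact. }
{ intros x d d' H Hd p Sp Hp; apply H; auto; lra. }
{ intros x [_ Hx].
  destruct (Hk p0 (Re x) S0 Hx (q / 2)) as (d & D & H); [lra|].
  exists (d / 2); split; [lra|]; intros y [_ Wy] Hy p Sp Hp.
  assert (Hxy : dR (Re y) (Re x) < d / 2).
  { unfold dR; rewrite <- re_minus; apply Rle_lt_trans with (2 := Hy), re_le_Cmod. }
  assert (A := H (Re y, p) (conj Wy Sp)); unfold dprod in A; simpl in A.
  assert (B := H (Re y, p0) (conj Wy S0)); unfold dprod in B; simpl in B.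
  destruct (Hdp p0 p0) as [_ E0]; rewrite E0 in B.
  specialize (A ltac:(lra)); specialize (B ltac:(lra)).
  apply Rle_trans with (1 := Cmod_sub_triangle _ (k p0 (Re x)) _).
  rewrite (Cmod_sub_sym (k p0 (Re x))); lra. }
exists d; split; [easy|]; intros p Sp Hp.
rewrite <- CInt_minus by auto.
apply Rle_lt_trans with (q * (b - a)).
- apply CInt_bound; auto using rcts_minus.
  intros t Ht; apply (Hd (RtoC t)); auto; simpl; auto.
- assert (q * (b - a + 1) = e / 2) by (unfold q; field; lra); nra.
Qed.

Lemma CInt_conj a b f : a <= b -> rcts a b f ->
  CInt (fun t => Cconj (f t)) a b = Cconj (CInt f a b).
Proof.
intros Hab Hf; destruct (rcts_ex_RInt a b f Hab Hf).
apply C_ext; unfold CInt; simpl; [easy|].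
now apply (RInt_opp (V := R_CompleteNormedModule) (fun t => Im (f t))).
Qed.

(** [artanh z / z] with the value 1 at 0. Since [rhs c z = 1 + c artanh z], the derivative of the
    exponent of the extremal function must be [c kappa]. *)
Definition kappa : C -> C := cslope artanh 0 1.

Lemma artanh_kappa z : artanh z = (kappa z * z)%C.
Proof.
assert (H := cslope_eq artanh 0 1 z); fold kappa in H; rewrite artanh_0 in H.
replace (artanh z) with (artanh z - 0)%C by ring; rewrite H; ring.
Qed.

Lemma cder_artanh_0 : cder artanh 0 1.
Proof.
eapply cder_eq; [apply cder_artanh, slit_plane_star|].
replace (1 - 0 * 0)%C with (RtoC 1) by ring; field.
Qed.

Lemma kappa_hol : hol slit_plane kappa.
Proof.
intros z Hz; unfold kappa.
rewrite <- (cder_C_derive _ _ _ cder_artanh_0).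
apply (cslope_cdiff slit_plane); auto using slit_plane_open.
- intros w Hw; eexists; now apply cder_artanh.
- apply slit_plane_star.
Qed.

Lemma kappa_conj z : slit_plane z -> kappa (Cconj z) = Cconj (kappa z).
Proof.
intros Hz; unfold kappa, cslope.
destruct (Ceq_dec z 0) as [->|N].
- rewrite RtoC_conj; destruct (Ceq_dec 0 0); [|easy]; now rewrite RtoC_conj.
- destruct (Ceq_dec (Cconj z) 0) as [E|_].
  { exfalso; apply N; rewrite <- (Cconj_conj z), E; apply RtoC_conj. }
  rewrite artanh_0, artanh_conj by easy.
  assert ((z - 0)%C <> 0) by (now replace (z - 0)%C with z by ring).
  rewrite Cdiv_conj, !Cminus_conj, RtoC_conj; easy.
Qed.

(* The substitution [1 - s^4] absorbs the logarithmic singularities of [kappa]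
   at [1] and [-1], so that the integrand is continuous on the closed disk. *)
Definition chi2_integrand (z : C) (s : R) : C :=
  (RtoC (4 * s ^ 3) * z * kappa (RtoC (1 - s ^ 4) * z))%C.

(** The primitive of [artanh w / w] that vanishes at 0, whose series is the sum of
    [z^(2k+1) / (2k+1)^2]; it is an integral over [t] in [[0, 1]] after the substitution
    [t = 1 - s^4]. *)
Definition chi2 (z : C) : C := CInt (chi2_integrand z) 0 1.

Lemma pow4_in_itv s : in_itv 0 1 s -> 0 <= s ^ 4 <= 1.
Proof.
intros [H1 H2]; split; [now apply pow_le|].
rewrite <- (pow1 4); now apply pow_incr.
Qed.

(** The point [w = (1 - s^4) z] is at distance at least [s^4] from 1 and -1, so [artanh w] is of
    order at most [s^-2], against the factor [s^3]. *)
Lemma chi2_integrand_small z s : Cmod z <= 1 -> 0 <= s <= 1 / 2 -> Cmod (chi2_integrand z s) <= 32 * s.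
Proof.
intros Hz [[Hs|<-] Hs2].
2:{ unfold chi2_integrand; replace (4 * 0 ^ 3) with 0 by ring.
  replace (0 * z * kappa (RtoC (1 - 0 ^ 4) * z))%C with (RtoC 0) by ring.
  rewrite Cmod_0; lra. }
assert (P2 : 0 < s * s) by nra.
assert (P4 : 0 < s ^ 4) by (apply pow_lt; lra).
assert (E4 : s ^ 4 = (s * s) * (s * s)) by ring.
assert (L2 : s * s <= 1 / 4) by nra.
assert (L4 : s ^ 4 <= 1 / 2) by (rewrite E4; nra).
set (w := (RtoC (1 - s ^ 4) * z)%C).
assert (Mw : Cmod w <= 1 - s ^ 4).
{ unfold w; rewrite Cmod_mult, Cmod_R, Rabs_pos_eq by lra; nra. }
assert (B : Cmod (artanh w) <= sqrt (2 / s ^ 4) + 2).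
{ apply artanh_bound; [lra|lra| |].
  - assert (X := Cmod_sub_le 1 w); rewrite Cmod_1 in X; lra.
  - assert (X := Cmod_sub_le 1 (- w)); rewrite Cmod_1, Cmod_opp in X.
    replace (1 - - w)%C with (1 + w)%C in X by ring; lra. }
assert (Sq : sqrt (2 / s ^ 4) <= 2 / (s * s)).
{ rewrite <- (sqrt_Rsqr (2 / (s * s))).
  2:{ left; apply Rdiv_lt_0_compat; lra. }
  apply sqrt_le_1_alt; unfold Rsqr; rewrite E4.
  apply Rmult_le_reg_r with ((s * s) * (s * s)); [nra|].
  field_simplify; lra. }
replace (chi2_integrand z s) with (RtoC (4 * s ^ 3 / (1 - s ^ 4)) * artanh w)%C.
2:{ unfold chi2_integrand; fold w; rewrite artanh_kappa.
  unfold w at 2; replace (RtoC (4 * s ^ 3 / (1 - s ^ 4)) * (kappa w * (RtoC (1 - s ^ 4) * z)))%C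
    with (RtoC (4 * s ^ 3 / (1 - s ^ 4) * (1 - s ^ 4)) * z * kappa w)%C
    by (rewrite (RtoC_mult _ (1 - s ^ 4)); ring).
  do 3 f_equal; field; lra. }
assert (P3 : 0 < s ^ 3) by (apply pow_lt; lra).
rewrite Cmod_mult, Cmod_R, Rabs_pos_eq.
2:{ left; apply Rdiv_lt_0_compat; lra. }
apply Rle_trans with (8 * s ^ 3 * (2 / (s * s) + 2)).
- apply Rmult_le_compat; try apply Cmod_ge_0.
  + left; apply Rdiv_lt_0_compat; lra.
  + apply Rmult_le_reg_r with (1 - s ^ 4); [lra|].
    unfold Rdiv; rewrite Rmult_assoc, Rinv_l by lra; nra.
  + lra.
- replace (8 * s ^ 3 * (2 / (s * s) + 2)) with (16 * s + 16 * s * (s * s)) by (field; lra).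
  nra.
Qed.

Lemma cts_pow {T} (d : T -> T -> R) S f x n : cts d S f x -> cts d S (fun y => (f y) ^ n)%C x.
Proof.
intros H; induction n as [|n IH]; simpl; [apply cts_const|now apply cts_mult].
Qed.

Lemma cts_chi2_integrand {T} (d : T -> T -> R) S (t : T -> R) (z : T -> C) x :
  cts d S (fun y => RtoC (t y)) x -> cts d S z x ->
  slit_plane (RtoC (1 - t x ^ 4) * z x) -> cts d S (fun y => chi2_integrand (z y) (t y)) x.
Proof.
intros Ht Hz Hs; unfold chi2_integrand.
assert (Hw : cts d S (fun y => RtoC (1 - t y ^ 4) * z y)%C x).
{ apply cts_mult; [|easy].
  apply cts_ext with (f := fun y => (1 - RtoC (t y) ^ 4)%C);
    [intros; now rewrite RtoC_minus, RtoC_pow|now rewrite RtoC_minus, RtoC_pow|].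
  apply cts_minus; [apply cts_const|now apply cts_pow]. }
apply cts_mult; [apply cts_mult; [|easy]|].
- apply cts_ext with (f := fun y => (4 * RtoC (t y) ^ 3)%C);
    [intros; now rewrite RtoC_mult, RtoC_pow|now rewrite RtoC_mult, RtoC_pow|].
  apply cts_scal, cts_pow, Ht.
- apply (cts_comp d S everywhere kappa (fun y => RtoC (1 - t y ^ 4) * z y)%C); [easy|easy|].
  now apply cdiff_cts, kappa_hol.
Qed.

(** For [t > 0] the argument of [kappa] stays in the open disk. At [t = 0] it may be 1 or -1, and
    the uniform bound of [chi2_integrand_small] gives the limit 0. *)
Lemma chi2_integrand_jointly_cts p t : cdisk 0 1 p -> in_itv 0 1 t ->
  cts (dprod dR dC) (fun x => in_itv 0 1 (fst x) /\ cdisk 0 1 (snd x))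
    (fun x => chi2_integrand (snd x) (fst x)) (t, p).
Proof.
intros Hp Ht.
assert (S0 : forall z, Cmod (z - 0) = Cmod z) by (intros; f_equal; ring).
destruct (proj1 Ht) as [Pt|E0].
- apply (cts_chi2_integrand (dprod dR dC) _ (fun x => fst x) (fun x => snd x)); simpl.
  + apply (cts_fst dR dC distance_dC _ everywhere (fun s => RtoC s)); [easy|apply cts_RtoC].
  + apply (cts_snd dR dC distance_dR _ everywhere (fun s => s)); [easy|apply cts_id].
  + apply slit_plane_disk; unfold in_disk; assert (B := pow4_in_itv t Ht).
    unfold cdisk in Hp; rewrite S0 in Hp.
    assert (0 < t ^ 4) by (apply pow_lt; lra).
    change (t * (t * (t * (t * 1)))) with (t ^ 4).
    rewrite Cmod_mult, Cmod_R, Rabs_pos_eq by lra; generalize (Cmod_ge_0 p); nra.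
- subst t; intros e He.
  exists (Rmin (1 / 2) (e / 64)); split; [apply Rmin_pos; lra|].
  intros [s z] [Hs Hz] Hd; simpl in *; unfold dprod in Hd; simpl in Hd.
  assert (A1 := Rlt_le_trans _ _ _ Hd (Rmin_l _ _)).
  assert (A2 := Rlt_le_trans _ _ _ Hd (Rmin_r _ _)).
  destruct (distance_dC z p) as [Pd _].
  unfold dR in *; rewrite Rminus_0_r, Rabs_pos_eq in A1, A2 by apply Hs.
  replace (chi2_integrand p 0) with (RtoC 0).
  2:{ unfold chi2_integrand; replace (4 * 0 ^ 3) with 0 by ring; ring. }
  replace (chi2_integrand z s - 0)%C with (chi2_integrand z s) by ring.
  unfold cdisk in Hz; rewrite S0 in Hz.
  apply Rle_lt_trans with (32 * s); [|lra].
  apply chi2_integrand_small; [easy|]; destruct Hs; lra.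
Qed.

Lemma chi2_cts z : cdisk 0 1 z -> cts dC (cdisk 0 1) chi2 z.
Proof.
intros Hz; unfold chi2; apply CInt_param_cts; auto using chi2_integrand_jointly_cts, distance_dC; lra.
Qed.

Lemma rcts_chi2_integrand z : slit_plane z -> rcts 0 1 (chi2_integrand z).
Proof.
intros Hz t Ht; apply (cts_chi2_integrand dR _ (fun s => s) (fun _ => z)).
- apply cts_RtoC.
- apply cts_const.
- apply star_0_ray; auto using slit_plane_star.
  assert (B := pow4_in_itv t Ht); unfold in_itv; lra.
Qed.

Lemma chi2_primitive z : slit_plane z -> chi2 z = Iseg kappa 0 z.
Proof.
intros Hz; set (A0 := Iseg kappa 0).
assert (HA : forall w, slit_plane w -> cder A0 w (kappa w)).
{ intros w Hw; apply (primitive_star kappa 0 slit_plane); auto using slit_plane_star.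
  - intros; now apply kappa_hol.
  - apply cdiff_cts, kappa_hol, slit_plane_star. }
unfold chi2.
rewrite (CInt_ftc 0 1 (fun s => - A0 (RtoC (1 - s ^ 4) * z))%C).
- replace (1 - 1 ^ 4) with 0 by ring; replace (1 - 0 ^ 4) with 1 by ring.
  rewrite Cmult_0_l, Cmult_1_l.
  replace (A0 0) with (RtoC 0) by (unfold A0, Iseg; ring); ring.
- lra.
- intros t Ht.
  assert (B := pow4_in_itv t Ht).
  assert (Hw : slit_plane (RtoC (1 - t ^ 4) * z))
    by (apply star_0_ray; auto using slit_plane_star; unfold in_itv; lra).
  apply (rder_eq _ _ (-(1) * (kappa (RtoC (1 - t ^ 4) * z) *
    (RtoC (- (4 * t ^ 3)) * z + RtoC (1 - t ^ 4) * 0)))%C).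
  2:{ unfold chi2_integrand; rewrite RtoC_opp; ring. }
  apply (rder_comp (fun w => - w)%C (fun s => A0 (RtoC (1 - s ^ 4) * z)%C)).
  { apply cder_opp, cder_id. }
  apply (rder_comp A0); [now apply HA|].
  apply (rder_mult (fun s => RtoC (1 - s ^ 4))); [|apply rder_const].
  apply rder_RtoC; auto_derive; auto; simpl; ring.
- now apply rcts_chi2_integrand.
Qed.

Lemma cder_chi2 z : slit_plane z -> cder chi2 z (kappa z).
Proof.
intros Hz; destruct (slit_plane_open z Hz) as (r & Hr & HB).
apply (cder_ext_loc (Iseg kappa 0)) with (r := r); auto.
- intros; rewrite chi2_primitive; auto.
- apply (primitive_star kappa 0 slit_plane); auto using slit_plane_star.
  + intros; now apply kappa_hol.
  + apply cdiff_cts, kappa_hol, slit_plane_star.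
Qed.

Lemma chi2_0 : chi2 0 = 0.
Proof.
rewrite chi2_primitive by apply slit_plane_star; unfold Iseg; ring.
Qed.

Lemma chi2_conj z : cdisk 0 1 z -> chi2 (Cconj z) = Cconj (chi2 z).
Proof.
intros Hz; unfold chi2; rewrite <- CInt_conj.
2:{ lra. }
2:{ intros t Ht; apply (cts_section dR dC distance_dC (in_itv 0 1) (cdisk 0 1)
      (fun x => chi2_integrand (snd x) (fst x)) t z Hz); auto using chi2_integrand_jointly_cts. }
apply CInt_ext; [lra|]; intros t Ht; unfold chi2_integrand.
destruct (proj1 Ht) as [Pt|<-].
2:{ replace (4 * 0 ^ 3) with 0 by ring; rewrite !Cmult_0_l; now rewrite RtoC_conj. }
assert (B := pow4_in_itv t Ht).
assert (0 < t ^ 4) by (apply pow_lt; lra).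
rewrite !Cmult_conj, !RtoC_conj; f_equal.
rewrite <- kappa_conj; [now rewrite Cmult_conj, RtoC_conj|].
apply slit_plane_disk; unfold in_disk.
unfold cdisk in Hz; replace (z - 0)%C with z in Hz by ring.
rewrite Cmod_mult, Cmod_R, Rabs_pos_eq by lra; generalize (Cmod_ge_0 z); nra.
Qed.

(** This is [f / (z f')] for [f' = exp a] and [f 0 = 0], with the divisions by [z] and by [f']
    carried out under the integral. The formula makes sense at 0, and on the closed disk whenever
    [a] is continuous there. *)
Definition G (a : C -> C) (z : C) : C :=
  CInt (fun t => cexp (a (RtoC t * z)%C - a z)) 0 1.

Lemma cexp_ray_primitive U a z : star 0 U -> hol U a -> U z ->
  cder (Iseg (fun w => cexp (a w)) 0) z (cexp (a z)) /\
  Iseg (fun w => cexp (a w)) 0 z = (z * cexp (a z) * G a z)%C.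
Proof.
intros HU Ha Uz.
assert (Hc : hol U (fun w => cexp (a w))).
{ intros w Uw; destruct (Ha w Uw) as [d Hd]; eexists; apply (cder_cexp_comp a); exact Hd. }
split.
- apply (primitive_star (fun w => cexp (a w)) 0 U); auto.
  apply cdiff_cts, Hc, HU.
- unfold Iseg, G.
  replace (z * cexp (a z) * CInt (fun t => cexp (a (RtoC t * z)%C - a z)) 0 1)%C
    with (z * (cexp (a z) * CInt (fun t => cexp (a (RtoC t * z)%C - a z)) 0 1))%C by ring.
  replace (z - 0)%C with z by ring; f_equal.
  rewrite <- CInt_scal.
  + apply CInt_ext; [lra|]; intros t Ht; rewrite <- cexp_plus.
    f_equal; unfold seg; replace (0 + RtoC t * (z - 0))%C with (RtoC t * z)%C by ring; ring.
  + lra.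
  + intros t Ht; apply cts_cexp, cts_minus; [|apply cts_const].
    apply (cts_comp dR (in_itv 0 1) everywhere a); [easy| |].
    * apply rder_cts with z, rder_ray.
    * apply cdiff_cts, Ha, star_0_ray; auto.
Qed.

Lemma G_0 a : G a 0 = 1.
Proof.
unfold G; rewrite (CInt_ext 0 1 _ (fun _ => RtoC 1)).
- rewrite CInt_const; rewrite Rminus_0_r; ring.
- lra.
- intros t _; rewrite Cmult_0_r; replace (a 0 - a 0)%C with (RtoC 0) by ring; apply cexp_0.
Qed.

(** With [m = f / z], holomorphic at 0 as a slope, [G a = m exp (- a)]; the equation is the
    derivative of [f = z m] multiplied by [exp (- a)]. In particular 0 is not exceptional. *)
Lemma G_ode U a z : star 0 U -> hol U a -> U z ->
  cdiff (G a) z /\ (z * C_derive (G a) z + (1 + z * C_derive a z) * G a z)%C = 1.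
Proof.
intros HU Ha Uz.
set (f := Iseg (fun w => cexp (a w)) 0).
assert (Hf : forall w, U w -> cder f w (cexp (a w)))
  by (intros; now apply (cexp_ray_primitive U)).
assert (f0 : f 0 = 0) by (unfold f, Iseg; ring).
assert (U0 := proj1 (proj2 HU)); assert (OU := proj1 HU).
set (m := cslope f 0 (C_derive f 0)).
assert (Em : forall w, f w = (m w * w)%C).
{ intros w; assert (X := cslope_eq f 0 (C_derive f 0) w); fold m in X.
  rewrite f0 in X; replace (f w) with (f w - 0)%C by ring; rewrite X; ring. }
assert (EG : forall w, U w -> (m w * cexp (- a w))%C = G a w).
{ intros w Uw; assert (N := cexp_neq_0 (a w)); rewrite cexp_opp.
  destruct (Ceq_dec w 0) as [->|Nw].
  - unfold m; rewrite cslope_self, (cder_C_derive _ _ _ (Hf 0 U0)), G_0; field; auto.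
  - assert (X := proj2 (cexp_ray_primitive U a w HU Ha Uw)); fold f in X.
    rewrite Em in X.
    replace (m w) with (m w * w / w)%C by (field; auto); rewrite X; field; auto. }
assert (Hm : cdiff m z).
{ apply (cslope_cdiff U); auto; intros w Uw; eexists; now apply Hf. }
destruct Hm as [m' Hm]; destruct (Ha z Uz) as [a' Ha'].
destruct (OU z Uz) as (r & Hr & HB).
assert (HG : cder (G a) z (m' * cexp (- a z) + m z * (cexp (- a z) * - a'))%C).
{ apply (cder_ext_loc (fun w => m w * cexp (- a w))%C) with (r := r); auto.
  apply (cder_mult m (fun w => cexp (- a w))); [easy|].
  now apply (cder_cexp_comp (fun w => - a w)%C), cder_opp. }
split; [eexists; exact HG|].
rewrite (cder_C_derive _ _ _ HG), (cder_C_derive _ _ _ Ha'), <- EG by easy.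
assert (Hfz : (m' * z + m z * 1)%C = cexp (a z)).
{ apply (cder_unique f z); [|now apply Hf].
  apply (cder_ext_loc (fun w => m w * w)%C) with (r := 1); [lra|now intros|].
  apply cder_mult; [easy|apply cder_id]. }
assert (N := cexp_neq_0 (a z)).
transitivity (cexp (a z) * cexp (- a z))%C; [rewrite <- Hfz; ring|].
rewrite cexp_opp; field; auto.
Qed.

Lemma class_repr f : class_A1 f -> (forall z, in_disk z -> C_derive f z <> 0) ->
  exists a : C -> C, a 0 = 0 /\ hol in_disk a /\ forall z, in_disk z ->
    C_derive f z = cexp (a z) /\ f z = (z * cexp (a z) * G a z)%C /\
    phi f z = (1 + z * C_derive a z)%C.
Proof.
intros (Hf & f0 & f1) Nf.
assert (Hf' : hol in_disk f) by (intros z Hz; apply ex_derive_cdiff; exact (Hf z Hz)).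
destruct (log_exists in_disk (C_derive f) in_disk_star) as (a & a0 & Ha); auto.
{ apply hol_C_derive; auto using in_disk_open. }
assert (Ha' : hol in_disk a) by (intros z Hz; eexists; now apply Ha).
exists a; split; [easy|split; [easy|]].
assert (E1 : forall z, in_disk z -> C_derive f z = cexp (a z)).
{ intros z Hz; destruct (Ha z Hz) as [_ E]; rewrite E, f1; ring. }
intros z Hz; split; [auto|split].
- assert (X := zero_derivative_const in_disk
    (fun w => f w - Iseg (fun w => cexp (a w)) 0 w)%C in_disk_star).
  assert (E : (f z - Iseg (fun w => cexp (a w)) 0 z)%C
     = (f 0 - Iseg (fun w => cexp (a w)) 0 0)%C).
  { apply X; [|easy]; intros w Hw.
    apply (cder_eq _ _ (C_derive f w - cexp (a w))%C).
    - apply cder_minus; [now apply cdiff_cder, Hf'|].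
      now apply (cexp_ray_primitive in_disk a w in_disk_star).
    - rewrite E1 by easy; ring. }
  rewrite <- (proj2 (cexp_ray_primitive in_disk a z in_disk_star Ha' Hz)).
  rewrite f0 in E; apply Ceq_minus; rewrite E; unfold Iseg; ring.
- unfold phi; destruct (Ha z Hz) as [D _]; rewrite (cder_C_derive _ _ _ D).
  unfold Cdiv; ring.
Qed.

Lemma class_build (a : C -> C) : a 0 = 0 -> hol in_disk a ->
  exists f, class_A1 f /\ forall z, in_disk z ->
    C_derive f z = cexp (a z) /\ f z = (z * cexp (a z) * G a z)%C /\
    phi f z = (1 + z * C_derive a z)%C.
Proof.
intros a0 Ha; set (f := Iseg (fun w => cexp (a w)) 0).
assert (Hf : forall w, in_disk w -> cder f w (cexp (a w)))
  by (intros; now apply (cexp_ray_primitive in_disk a w in_disk_star)).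
assert (D0 : in_disk 0) by (unfold in_disk; rewrite Cmod_0; lra).
exists f; split.
{ split; [|split].
  - intros z Hz; apply ex_derive_cdiff; eexists; exact (Hf z Hz).
  - unfold f, Iseg; ring.
  - rewrite (cder_C_derive _ _ _ (Hf 0 D0)), a0; apply cexp_0. }
intros z Hz; split; [apply cder_C_derive; auto|split].
- now apply (cexp_ray_primitive in_disk a z in_disk_star).
- destruct (in_disk_open z Hz) as (r & Hr & HB).
  assert (H2 : cder (C_derive f) z (cexp (a z) * C_derive a z)%C).
  { apply (cder_ext_loc (fun w => cexp (a w))) with (r := r); auto.
    - intros w Hw; symmetry; apply cder_C_derive; auto.
    - apply (cder_cexp_comp a), cdiff_cder; auto. }
  unfold phi; rewrite (cder_C_derive _ _ _ H2), (cder_C_derive _ _ _ (Hf z Hz)).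
  assert (N := cexp_neq_0 (a z)); field; auto.
Qed.

(** * Starlikeness criteria *)

Lemma cexp_RtoC_Ci r : cexp (RtoC r * Ci) = cis r.
Proof.
assert (E1 : Re (RtoC r * Ci) = 0) by (simpl; ring).
assert (E2 : Im (RtoC r * Ci) = r) by (simpl; ring).
unfold cexp; rewrite E1, E2, exp_0; ring.
Qed.

Lemma cexp_surjective (z : C) : z <> 0 -> exists x, cexp x = z /\ Re x = ln (Cmod z).
Proof.
intros N; destruct (classic (slit z)) as [S|S].
- exists (Clog z); split; [now apply cexp_Clog|easy].
- assert (S' : slit (- z)).
  { unfold slit in *; rewrite Cmod_opp, re_opp.
    assert (P := proj1 (Cmod_gt_0 z) N); lra. }
  exists (Clog (- z) + RtoC PI * Ci)%C; split.
  + rewrite cexp_plus, cexp_Clog by easy.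
    rewrite cexp_RtoC_Ci; replace (cis PI) with (- (1))%C; [ring|].
    unfold cis; rewrite cos_PI, sin_PI; apply C_ext; simpl; ring.
  + rewrite re_plus, re_mult; unfold Clog; simpl; rewrite Cmod_opp; ring.
Qed.

Lemma cexp_eq_1 w : cexp w = 1 -> exists k : Z, w = (RtoC (2 * (IZR k * PI)) * Ci)%C.
Proof.
intros E.
assert (H1 : Re w = 0).
{ apply (f_equal Cmod) in E; rewrite Cmod_cexp, Cmod_1, <- exp_0 in E; now apply exp_inv. }
assert (H2 := f_equal Re E); rewrite Re_cexp, H1, exp_0, re_RtoC, Rmult_1_l in H2.
replace (Im w) with (2 * (Im w / 2)) in H2 by field.
rewrite cos_2a_sin in H2.
assert (H3 : sin (Im w / 2) = 0) by nra.
apply sin_eq_0_0 in H3; destruct H3 as [k Hk]; exists k.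
apply C_ext; rewrite ?re_mult, ?im_mult, ?re_RtoC, ?im_RtoC; simpl; lra.
Qed.

Lemma cexp_period z k : cexp (z + RtoC (2 * (IZR k * PI)) * Ci) = cexp z.
Proof.
rewrite cexp_plus, cexp_RtoC_Ci.
assert (S : sin (IZR k * PI) = 0) by (apply sin_eq_0_1; eauto).
unfold cis; rewrite cos_2a_sin, sin_2a, S.
replace (1 - 2 * 0 * 0, 2 * 0 * cos (IZR k * PI)) with (RtoC 1); [ring|].
apply C_ext; simpl; ring.
Qed.

Lemma Re_inv_pos (w : C) : 0 < Re w -> 0 < Re (/ w).
Proof.
intros H; assert (N : w <> 0) by (intros ->; simpl in H; lra).
assert (P := proj1 (Cmod_gt_0 w) N); assert (Q := Cmod_sqr w).
simpl; apply Rdiv_lt_0_compat; [exact H|].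
unfold Re, Im in Q; nra.
Qed.

Lemma increasing_at_left h s0 p : is_derive h s0 p -> 0 < p ->
  exists d, 0 < d /\ forall s, s0 - d < s < s0 -> h s < h s0.
Proof.
rewrite is_derive_eps; intros H Hp; destruct (H (p / 2)) as (d & D & Hd); [lra|].
exists d; split; [easy|]; intros s Hs.
specialize (Hd s); rewrite Rabs_left in Hd by lra; specialize (Hd ltac:(lra)).
apply Rabs_le_between in Hd; nra.
Qed.

Lemma is_derive_Cmod2 (u : R -> C) s d : rder u s d ->
  is_derive (fun t => Cmod (u t) * Cmod (u t)) s (2 * Re (Cconj (u s) * d)).
Proof.
intros [H1 H2].
apply (is_derive_ext (fun t => Re (u t) * Re (u t) + Im (u t) * Im (u t))).
{ intros t; symmetry; apply Cmod_sqr. }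
replace (2 * Re (Cconj (u s) * d))
  with ((Re d * Re (u s) + Re (u s) * Re d) + (Im d * Im (u s) + Im (u s) * Im d))
  by (rewrite re_mult, re_conj, im_conj; ring).
apply (is_derive_plus (fun t => Re (u t) * Re (u t)) (fun t => Im (u t) * Im (u t)));
  apply @is_derive_mult; auto; intros; apply Rmult_comm.
Qed.

Lemma Cmod_decreases_left u s0 d : rder u s0 d -> 0 < Re (Cconj (u s0) * d) ->
  exists e, 0 < e /\ forall s, s0 - e < s < s0 -> Cmod (u s) < Cmod (u s0).
Proof.
intros Hu Hd; apply is_derive_Cmod2 in Hu.
destruct (increasing_at_left _ _ _ Hu) as (e & He & H); [lra|].
exists e; split; [easy|]; intros s Hs; specialize (H s Hs); cbv beta in H.
generalize (Cmod_ge_0 (u s)) (Cmod_ge_0 (u s0)); nra.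
Qed.

Lemma Cmod_increases_left u s0 d : rder u s0 d -> Re (Cconj (u s0) * d) < 0 ->
  exists e, 0 < e /\ forall s, s0 - e < s < s0 -> Cmod (u s0) < Cmod (u s).
Proof.
intros Hu Hd; apply is_derive_Cmod2 in Hu.
assert (Hu' : is_derive (fun t => - (Cmod (u t) * Cmod (u t))) s0 (- (2 * Re (Cconj (u s0) * d))))
  by (apply (is_derive_opp (fun t => Cmod (u t) * Cmod (u t))); exact Hu).
destruct (increasing_at_left _ _ _ Hu') as (e & He & H); [lra|].
exists e; split; [easy|]; intros s Hs; specialize (H s Hs); cbv beta in H.
generalize (Cmod_ge_0 (u s)) (Cmod_ge_0 (u s0)); nra.
Qed.

Lemma compact_image_closed S f w : compactC S -> (forall z, S z -> cts dC S f z) ->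
  (forall e, 0 < e -> exists z, S z /\ Cmod (f z - w) < e) -> exists z, S z /\ f z = w.
Proof.
intros HS Hf Hw.
destruct (compact_min S (fun z => RtoC (Cmod (f z - w)))) as (z0 & S0 & H0); auto.
{ destruct (Hw 1) as (z & Sz & _); [lra|]; eauto. }
{ intros z Sz; apply cts_Cmod, cts_minus; [auto|apply cts_const]. }
simpl in H0; exists z0; split; [easy|]; apply Ceq_minus, Cmod_eq_0.
destruct (Req_dec (Cmod (f z0 - w)) 0) as [|N]; [easy|exfalso].
assert (P := Cmod_ge_0 (f z0 - w)).
destruct (Hw (Cmod (f z0 - w))) as (z & Sz & Hz); [lra|].
specialize (H0 z Sz); lra.
Qed.

Section Criteria.
Variables (f a : C -> C).
Hypotheses (Cf : class_A1 f) (a0 : a 0 = 0) (Ha : hol in_disk a).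
Hypothesis Hfa : forall z, in_disk z ->
  C_derive f z = cexp (a z) /\ f z = (z * cexp (a z) * G a z)%C.

Lemma class_A1_hol : hol in_disk f.
Proof. intros z Hz; apply ex_derive_cdiff; exact (proj1 Cf z Hz). Qed.

Lemma criteria_derive_neq z : in_disk z -> C_derive f z <> 0.
Proof. intros Hz; rewrite (proj1 (Hfa z Hz)); apply cexp_neq_0. Qed.

(** If [u] is the preimage of [s w] under [f], the derivative of [|u|^2] in [s] is
    [2 Re (conj u u')], and this formula evaluates it: the sign of [Re (G a z)] decides whether
    shrinking an image point moves its preimage towards the origin. *)
Lemma criteria_slope z s : in_disk z ->
  (Cconj z * (f z * RtoC s / C_derive f z))%C
    = (RtoC (s * (Cmod z * Cmod z)) * G a z)%C.
Proof.
intros Hz; destruct (Hfa z Hz) as [E1 E2]; rewrite E1, E2.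
assert (N := cexp_neq_0 (a z)).
replace (RtoC (s * (Cmod z * Cmod z))) with (RtoC s * (z * Cconj z))%C.
- field; auto.
- rewrite <- Cmod2_conj, RtoC_mult; simpl; rewrite Rmult_1_r; reflexivity.
Qed.

(* [zeta + log (f (e^zeta) / e^zeta)] has derivative [1 / G] on the left half-plane. *)
Lemma Re_G_pos_injective : (forall z, in_disk z -> 0 < Re (G a z)) ->
  forall z w, in_disk z -> in_disk w -> f z = f w -> z = w.
Proof.
intros HG.
assert (NG : forall z, in_disk z -> G a z <> 0).
{ intros z Hz E; assert (X := HG z Hz); rewrite E in X; simpl in X; lra. }
assert (D0 : in_disk 0) by (unfold in_disk; rewrite Cmod_0; lra).
set (m := fun z => (cexp (a z) * G a z)%C).
assert (Dm : forall z, in_disk z -> cdiff m z).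
{ intros z Hz; apply cdiff_mult.
  - destruct (Ha z Hz) as [d Hd]; eexists; apply (cder_cexp_comp a); exact Hd.
  - now apply (G_ode in_disk a z in_disk_star). }
assert (Nm : forall z, in_disk z -> m z <> 0).
{ intros z Hz; apply Cmult_neq_0; [apply cexp_neq_0|auto]. }
assert (Fm : forall z, in_disk z -> f z = (z * m z)%C).
{ intros z Hz; rewrite (proj2 (Hfa z Hz)); unfold m; ring. }
assert (m0 : m 0 = 1) by (unfold m; rewrite a0, cexp_0, G_0; ring).
destruct (log_exists in_disk m in_disk_star Dm Nm) as (L & L0 & HL).
assert (EL : forall z, in_disk z -> m z = cexp (L z)).
{ intros z Hz; rewrite (proj2 (HL z Hz)), m0; ring. }
assert (Dl : forall z, in_disk z -> (1 + z * (C_derive m z / m z))%C = (/ G a z)%C).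
{ intros z Hz.
  assert (X : C_derive f z = (1 * m z + z * C_derive m z)%C).
  { destruct (in_disk_open z Hz) as (r & Hr & HB).
    apply cder_C_derive, (cder_ext_loc (fun w => w * m w)%C) with (r := r); auto.
    - intros w Hw; symmetry; auto.
    - apply cder_mult; [apply cder_id|]; apply cdiff_cder; auto. }
  rewrite (proj1 (Hfa z Hz)) in X.
  assert (N1 := Nm z Hz); assert (N2 := NG z Hz); assert (N3 := cexp_neq_0 (a z)).
  replace (1 + z * (C_derive m z / m z))%C with ((1 * m z + z * C_derive m z) / m z)%C
    by (field; auto).
  rewrite <- X; unfold m; field; auto. }
set (F := fun x => (x + L (cexp x))%C).
assert (Hx : forall x, Re x < 0 -> in_disk (cexp x)).
{ intros x Hx; unfold in_disk; rewrite Cmod_cexp, <- exp_0; now apply exp_increasing. }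
assert (NW : forall x y, Re x < 0 -> Re y < 0 -> F x = F y -> x = y).
{ apply (Noshiro_Warschawski (fun x => Re x < 0) F (fun x => / G a (cexp x))%C).
  - intros x y t H1 H2 [T0 T1]; unfold seg; rewrite re_plus, re_scal_l, re_minus; nra.
  - intros x H; split; [|now apply Re_inv_pos, HG, Hx].
    rewrite <- Dl by auto.
    apply (cder_eq _ _ (1 + C_derive m (cexp x) / m (cexp x) * cexp x)%C); [|ring].
    apply cder_plus; [apply cder_id|].
    apply (cder_comp L cexp); [now apply HL, Hx|apply cder_cexp]. }
intros z w Hz Hw E; rewrite !Fm in E by easy.
destruct (Ceq_dec z 0) as [->|Nz].
{ destruct (Ceq_dec w 0) as [->|Nw]; [easy|].
  exfalso; apply (Cmult_neq_0 w (m w)); auto; rewrite <- E; ring. }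
destruct (Ceq_dec w 0) as [->|Nw].
{ exfalso; apply (Cmult_neq_0 z (m z)); auto; rewrite E; ring. }
destruct (cexp_surjective z Nz) as (x & Ex & Rx).
destruct (cexp_surjective w Nw) as (y & Ey & Ry).
assert (LN : forall v, in_disk v -> v <> 0 -> ln (Cmod v) < 0).
{ intros v Hv N; rewrite <- ln_1; apply ln_increasing; [now apply Cmod_gt_0|exact Hv]. }
assert (H1 : cexp (F x - F y) = 1).
{ unfold F; rewrite cexp_minus, !cexp_plus, Ex, Ey, <- !EL, E by easy.
  field; split; auto. }
destruct (cexp_eq_1 _ H1) as [k Hk].
(* [F] commutes with translations by multiples of [2 pi i]. Shifting [y] by the period turns the
   congruence between [F x] and [F y] into an equality without changing [cexp y]. *)
rewrite <- Ex, <- Ey, <- (cexp_period y k); f_equal.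
apply NW.
- rewrite Rx; auto.
- rewrite re_plus, re_scal_l; simpl; rewrite Rmult_0_r, Rplus_0_r, Ry; auto.
- apply Ceq_minus; unfold F at 2; rewrite cexp_period.
  replace (F x - (y + RtoC (2 * (IZR k * PI)) * Ci + L (cexp y)))%C
    with (F x - F y - RtoC (2 * (IZR k * PI)) * Ci)%C by (unfold F; ring).
  rewrite Hk; ring.
Qed.

(** If [t w] had no preimage, consider the least [s1 >= t] for which [s1 w] has one in the closed
    disk of radius [|z1|]. Positivity makes the modulus of the preimage decrease just to the left of
    [s1], so smaller values of [s] also qualify. The restriction to a closed disk is what makes the
    least value attained. *)
Lemma starlike_of_Re_G_pos : (forall z, in_disk z -> 0 < Re (G a z)) -> starlike f.
Proof.
intros HG; assert (Inj := Re_G_pos_injective HG).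
assert (Hf := class_A1_hol).
destruct (inverse_exists in_disk f in_disk_open Hf Inj criteria_derive_neq) as (Op & g & Hg).
assert (D0 : in_disk 0) by (unfold in_disk; rewrite Cmod_0; lra).
assert (f0 : f 0 = 0) by apply Cf.
split; [easy|split; [exact Inj|split; [|split]]].
- intros w Hw; apply locally_ball; apply Op; exact Hw.
- exists 0; auto.
- intros w t (z1 & D1 & <-) Ht.
  apply NNPP; intros Nt.
  assert (Nw : f z1 <> 0).
  { intros E; apply Nt; exists 0; rewrite E, f0; split; [easy|ring]. }
  set (w := f z1) in *; set (r := Cmod z1).
  assert (S0 : forall z, Cmod (z - 0) = Cmod z) by (intros; f_equal; ring).
  assert (Kd : forall z, cdisk 0 r z -> in_disk z).
  { intros z Hz; unfold cdisk in Hz; rewrite S0 in Hz; unfold in_disk in *; unfold r in Hz; lra. }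
  pose (E := fun s => t <= s <= 1 /\ exists z, cdisk 0 r z /\ f z = (RtoC s * w)%C).
  (* The infimum of [E], taken as the supremum of the opposite set. *)
  destruct (completeness (fun x => E (- x))) as [l [Ub Lb]].
  { exists (- t); intros x [Hx _]; lra. }
  { exists (-1); split; [unfold in_itv in *; lra|]; exists z1; split.
    - unfold cdisk; rewrite S0; unfold r; lra.
    - replace (- -1) with 1 by ring; unfold w; ring. }
  set (s1 := - l).
  assert (Low : forall s, E s -> s1 <= s).
  { intros s Hs; assert (X : - s <= l) by (apply Ub; now rewrite Ropp_involutive); unfold s1; lra. }
  assert (Pw := proj1 (Cmod_gt_0 w) Nw).
  assert (Es1 : E s1).
  { assert (B1 : t <= s1).
    { enough (l <= - t) by (unfold s1; lra); apply Lb; intros x [Hx _]; lra. }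
    assert (B2 : s1 <= 1).
    { apply Low; split; [unfold in_itv in *; lra|]; exists z1; split;
        [unfold cdisk; rewrite S0; unfold r; lra|unfold w; ring]. }
    split; [lra|].
    apply compact_image_closed; auto using cdisk_compact.
    { intros z Hz; apply cdiff_cts, Hf; auto. }
    intros e He.
    assert (X : exists s, E s /\ s < s1 + e / Cmod w).
    { apply NNPP; intros N.
      assert (0 < e / Cmod w) by now apply Rdiv_lt_0_compat.
      assert (l <= l - e / Cmod w); [|lra].
      apply Lb; intros x Hx; apply Rnot_lt_le; intros Hlt.
      apply N; exists (- x); split; [exact Hx|unfold s1; lra]. }
    destruct X as (s & Hs & Lt); assert (Ge := Low s Hs).
    destruct Hs as (_ & z & Hz & Ez); exists z; split; [easy|].
    rewrite Ez; replace (RtoC s * w - RtoC s1 * w)%C with (RtoC (s - s1) * w)%C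
      by (rewrite RtoC_minus; ring).
    rewrite Cmod_mult, Cmod_R, Rabs_pos_eq by lra.
    apply Rlt_le_trans with (e / Cmod w * Cmod w); [apply Rmult_lt_compat_r; lra|].
    right; field; lra. }
  destruct Es1 as (Hs1 & z0 & Hz0 & Ez0).
  assert (Dz0 := Kd z0 Hz0).
  assert (Lt : t < s1).
  { destruct (proj1 Hs1) as [|E1]; [easy|exfalso]; apply Nt; exists z0.
    rewrite E1; auto. }
  assert (Pt : 0 <= t) by apply Ht.
  assert (Nz0 : z0 <> 0).
  { intros ->; rewrite f0 in Ez0; symmetry in Ez0; revert Ez0; apply Cmult_neq_0; auto.
    intros X; apply RtoC_inj in X; lra. }
  assert (Ew : w = (f z0 * RtoC (/ s1))%C).
  { rewrite Ez0, RtoC_inv by lra; field; intros X; apply RtoC_inj in X; lra. }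
  destruct (Hg z0 Dz0) as [Gz0 Gd].
  assert (Du : rder (fun s => g (RtoC s * w)%C) s1 (/ C_derive f z0 * w)).
  { apply (rder_comp g (fun s => RtoC s * w)%C); [now rewrite <- Ez0|apply rder_ray]. }
  destruct (Cmod_decreases_left _ _ _ Du) as (e & He & Hdec).
  { rewrite <- Ez0, Gz0.
    replace (Cconj z0 * (/ C_derive f z0 * w))%C
      with (Cconj z0 * (f z0 * RtoC (/ s1) / C_derive f z0))%C
      by (rewrite Ew; unfold Cdiv; ring).
    rewrite criteria_slope, re_scal_l by easy.
    assert (P1 := proj1 (Cmod_gt_0 z0) Nz0).
    apply Rmult_lt_0_compat; [|now apply HG].
    apply Rmult_lt_0_compat; [apply Rinv_0_lt_compat; lra|nra]. }
  destruct (Op (RtoC s1 * w)%C) as (q & Hq & HB); [eauto|].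
  set (s := Rmax ((t + s1) / 2) (Rmax (s1 - e / 2) (s1 - q / (2 * Cmod w)))).
  assert (Pq : 0 < q / (2 * Cmod w)) by (apply Rdiv_lt_0_compat; lra).
  assert (Ls : s < s1) by (repeat apply Rmax_lub_lt; lra).
  assert (G1 : (t + s1) / 2 <= s) by apply Rmax_l.
  assert (G2 : s1 - e / 2 <= s) by (eapply Rle_trans; [|apply Rmax_r]; apply Rmax_l).
  assert (G3 : s1 - q / (2 * Cmod w) <= s) by (eapply Rle_trans; [|apply Rmax_r]; apply Rmax_r).
  destruct (HB (RtoC s * w)%C) as (z2 & D2 & E2).
  { replace (RtoC s * w - RtoC s1 * w)%C with (RtoC (s - s1) * w)%C by (rewrite RtoC_minus; ring).
    rewrite Cmod_mult, Cmod_R, Rabs_minus_sym, Rabs_pos_eq by lra.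
    apply Rle_lt_trans with (q / (2 * Cmod w) * Cmod w); [apply Rmult_le_compat_r; lra|].
    replace (q / (2 * Cmod w) * Cmod w) with (q / 2) by (field; lra); lra. }
  assert (X := Hdec s ltac:(lra)); cbv beta in X.
  rewrite <- E2, <- Ez0, Gz0, (proj1 (Hg z2 D2)) in X.
  assert (Bad : s1 <= s); [|lra].
  apply Low; split; [lra|]; exists z2; split; [|easy].
  unfold cdisk in Hz0 |- *; rewrite S0 in Hz0 |- *; lra.
Qed.

(** For [0 <= s <= 1] the map sending [z] to the preimage of [s f z] is a self-map of the disk that
    fixes 0, so by Schwarz's lemma it does not increase the modulus. A negative [Re (G a z1)] would
    make it increase at [z1] for [s] slightly below 1. *)
Lemma Re_G_nonneg_of_starlike : starlike f -> forall z, in_disk z -> 0 <= Re (G a z).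
Proof.
intros (_ & Inj & _ & _ & Sc) z1 D1.
apply Rnot_lt_le; intros Neg.
assert (Hf := class_A1_hol).
destruct (inverse_exists in_disk f in_disk_open Hf Inj criteria_derive_neq) as (Op & g & Hg).
assert (f0 : f 0 = 0) by apply Cf.
assert (D0 : in_disk 0) by (unfold in_disk; rewrite Cmod_0; lra).
destruct (Hg z1 D1) as [G1 Gd].
assert (Nz : z1 <> 0).
{ intros ->; rewrite G_0 in Neg; simpl in Neg; lra. }
assert (Du : rder (fun s => g (RtoC s * f z1)%C) 1 (/ C_derive f z1 * f z1)).
{ apply (rder_comp g (fun s => RtoC s * f z1)%C); [now rewrite Cmult_1_l|apply rder_ray]. }
destruct (Cmod_increases_left _ _ _ Du) as (e & He & Hinc).
{ rewrite Cmult_1_l, G1.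
  replace (Cconj z1 * (/ C_derive f z1 * f z1))%C
    with (Cconj z1 * (f z1 * RtoC 1 / C_derive f z1))%C by (unfold Cdiv; ring).
  rewrite criteria_slope, re_scal_l by easy.
  assert (P1 := proj1 (Cmod_gt_0 z1) Nz).
  assert (P2 : 0 < Cmod z1 * Cmod z1) by now apply Rmult_lt_0_compat.
  rewrite Rmult_1_l; set (q := Cmod z1 * Cmod z1) in *; nra. }
set (s := Rmax (1 / 2) (1 - e / 2)).
assert (S1 : s < 1) by (apply Rmax_lub_lt; lra).
assert (S2 : 1 / 2 <= s) by apply Rmax_l.
assert (S3 : 1 - e / 2 <= s) by apply Rmax_r.
assert (X := Hinc s ltac:(lra)); cbv beta in X; rewrite Cmult_1_l, G1 in X.
assert (Im : forall z, in_disk z -> exists x, in_disk x /\ f x = (RtoC s * f z)%C).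
{ intros z Hz; apply Sc; [exists z; auto|lra]. }
assert (Y := Schwarz (fun z => g (RtoC s * f z)%C)).
apply (Rlt_irrefl (Cmod z1)); apply Rlt_le_trans with (1 := X); apply Y; auto.
- intros z Hz; destruct (Im z Hz) as (x & Dx & Ex).
  apply (cdiff_comp g (fun z => RtoC s * f z)%C).
  + rewrite <- Ex; eexists; now apply Hg.
  + apply cdiff_scal; auto.
- rewrite f0, Cmult_0_r.
  assert (Z := proj1 (Hg 0 D0)); now rewrite f0 in Z.
- intros z Hz; destruct (Im z Hz) as (x & Dx & Ex).
  rewrite <- Ex, (proj1 (Hg x Dx)); now left.
Qed.

End Criteria.

(** * The extremal functions *)

(** The exponent [log f'] of the function [f] with [phi f = rhs c]; see [ca_phi]. *)
Definition ca (c : R) (z : C) : C := (RtoC c * chi2 z)%C.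

Definition gc (c : R) : C -> C := G (ca c).

Lemma rhs_artanh c z : rhs c z = (1 + RtoC c * artanh z)%C.
Proof.
unfold rhs, artanh, mob; rewrite RtoC_div by lra; field; apply C2_neq_0.
Qed.

Lemma ca_cder c z : slit_plane z -> cder (ca c) z (RtoC c * kappa z).
Proof. intros Hz; now apply cder_scal, cder_chi2. Qed.

Lemma ca_hol c : hol slit_plane (ca c).
Proof. intros z Hz; eexists; now apply ca_cder. Qed.

Lemma ca_0 c : ca c 0 = 0.
Proof. unfold ca; rewrite chi2_0; ring. Qed.

Lemma ca_phi c z : slit_plane z -> (1 + z * C_derive (ca c) z)%C = rhs c z.
Proof.
intros Hz; rewrite (cder_C_derive _ _ _ (ca_cder c z Hz)), rhs_artanh, artanh_kappa; ring.
Qed.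

Lemma gc_cdiff c z : slit_plane z -> cdiff (gc c) z.
Proof. intros Hz; apply (G_ode slit_plane); auto using slit_plane_star, ca_hol. Qed.

Lemma gc_ode c z : slit_plane z -> (z * C_derive (gc c) z + rhs c z * gc c z)%C = 1.
Proof.
intros Hz; rewrite <- ca_phi by easy.
apply (G_ode slit_plane); auto using slit_plane_star, ca_hol.
Qed.

Lemma gc_0 c : gc c 0 = 1.
Proof. apply G_0. Qed.

Definition unit_disk : C -> Prop := cdisk 0 1.

Lemma unit_disk_Cmod z : unit_disk z <-> Cmod z <= 1.
Proof. unfold unit_disk, cdisk; replace (z - 0)%C with z by ring; easy. Qed.

Lemma unit_disk_ray z t : unit_disk z -> in_itv 0 1 t -> unit_disk (RtoC t * z).
Proof.
rewrite !unit_disk_Cmod; intros Hz [T0 T1].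
rewrite Cmod_mult, Cmod_R, Rabs_pos_eq by easy; generalize (Cmod_ge_0 z); nra.
Qed.

Lemma in_disk_unit_disk z : in_disk z -> unit_disk z.
Proof. rewrite unit_disk_Cmod; now left. Qed.

Definition gc_integrand (x : R * C) (t : R) : C :=
  cexp (ca (fst x) (RtoC t * snd x) - ca (fst x) (snd x)).

Lemma gc_integrand_cts (x : R * C) t : unit_disk (snd x) -> in_itv 0 1 t ->
  cts (dprod dR (dprod dR dC)) (fun y => in_itv 0 1 (fst y) /\ unit_disk (snd (snd y)))
    (fun y => gc_integrand (snd y) (fst y)) (t, x).
Proof.
intros Hx Ht; unfold gc_integrand, ca.
assert (D2 := distance_dprod _ _ distance_dR distance_dC).
set (S := fun y : R * (R * C) => in_itv 0 1 (fst y) /\ unit_disk (snd (snd y))).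
assert (Ct : cts (dprod dR (dprod dR dC)) S (fun y => RtoC (fst y)) (t, x)).
{ apply (cts_fst dR (dprod dR dC) D2 S everywhere (fun s => RtoC s)); [easy|apply cts_RtoC]. }
assert (Cc : cts (dprod dR (dprod dR dC)) S (fun y => RtoC (fst (snd y))) (t, x)).
{ apply (cts_snd dR (dprod dR dC) distance_dR S everywhere (fun y => RtoC (fst y))); [easy|].
  apply (cts_fst dR dC distance_dC everywhere everywhere (fun s => RtoC s)); [easy|apply cts_RtoC]. }
assert (Cz : cts (dprod dR (dprod dR dC)) S (fun y => snd (snd y)) (t, x)).
{ apply (cts_snd dR (dprod dR dC) distance_dR S everywhere (fun y => snd y)); [easy|].
  apply (cts_snd dR dC distance_dR everywhere everywhere (fun s => s)); [easy|apply cts_id]. }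
apply cts_cexp, cts_minus; apply cts_mult; auto.
- apply (cts_comp _ S unit_disk chi2 (fun y => (RtoC (fst y) * snd (snd y))%C)).
  + intros y [H1 H2]; now apply unit_disk_ray.
  + now apply cts_mult.
  + apply chi2_cts; now apply unit_disk_ray.
- apply (cts_comp _ S unit_disk chi2 (fun y => snd (snd y))); auto.
  + now intros y [_ H].
  + now apply chi2_cts.
Qed.

(** Continuity in the pair, up to the circle, is what makes positivity on the closed disk stable
    under small changes of [c] and nonnegativity stable under limits. *)
Lemma gc_jointly_cts c z : unit_disk z ->
  cts (dprod dR dC) (fun x => unit_disk (snd x)) (fun x => gc (fst x) (snd x)) (c, z).
Proof.
intros Hz.
apply (CInt_param_cts (dprod dR dC) (fun x => unit_disk (snd x)) gc_integrand 0 1 (c, z)).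
- lra.
- apply distance_dprod; [apply distance_dR|apply distance_dC].
- easy.
- intros; now apply gc_integrand_cts.
Qed.

Lemma gc_cts c z : unit_disk z -> cts dC unit_disk (gc c) z.
Proof.
intros Hz e He; destruct (gc_jointly_cts c z Hz e He) as (d & D & H).
exists d; split; [easy|]; intros w Hw Hd; apply (H (c, w) Hw); unfold dprod; simpl.
destruct (distance_dR c c) as [_ ->]; lra.
Qed.

Lemma gc_rcts c z : unit_disk z ->
  rcts 0 1 (fun t => cexp (ca c (RtoC t * z) - ca c z)).
Proof.
intros Hz t Ht; apply (cts_section dR (dprod dR dC)
  (distance_dprod _ _ distance_dR distance_dC) (in_itv 0 1) (fun x => unit_disk (snd x))
  (fun y => gc_integrand (snd y) (fst y)) t (c, z)); auto.
now apply gc_integrand_cts.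
Qed.

Lemma ca_conj c z : unit_disk z -> ca c (Cconj z) = Cconj (ca c z).
Proof. intros Hz; unfold ca; now rewrite Cmult_conj, RtoC_conj, chi2_conj. Qed.

Lemma gc_conj c z : unit_disk z -> gc c (Cconj z) = Cconj (gc c z).
Proof.
intros Hz; unfold gc, G; rewrite <- CInt_conj.
- apply CInt_ext; [lra|]; intros t Ht.
  rewrite <- cexp_conj, Cminus_conj, <- !ca_conj by auto using unit_disk_ray.
  now rewrite Cmult_conj, RtoC_conj.
- lra.
- now apply gc_rcts.
Qed.

Lemma ca_real c x : unit_disk (RtoC x) -> Im (ca c (RtoC x)) = 0.
Proof.
intros Hx; assert (E := ca_conj c _ Hx); rewrite RtoC_conj in E.
apply (f_equal Im) in E; rewrite im_conj in E; lra.
Qed.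

Lemma CInt_Re_pos a b f : a < b -> rcts a b f ->
  (forall t, in_itv a b t -> 0 < Re (f t)) -> 0 < Re (CInt f a b).
Proof.
intros Hab Hf Hp.
rewrite (CInt_ext a b f (fun t => f (clamp a b t))) by
  (try lra; intros; now rewrite clamp_id).
simpl; apply RInt_gt_0; [easy| |].
- intros t Ht; apply Hp, clamp_in; lra.
- intros t Ht; apply (clamp_continuous a b f ltac:(lra) Hf t).
Qed.

(** The exponent is real on the real axis, so the integrand is positive there. This excludes 1 and
    -1, where [rhs c] is singular, from every boundary argument. *)
Lemma gc_real_pos c x : unit_disk (RtoC x) -> 0 < Re (gc c (RtoC x)) /\ Im (gc c (RtoC x)) = 0.
Proof.
intros Hx; split.
- apply CInt_Re_pos; [lra|now apply gc_rcts|]; intros t Ht.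
  rewrite Re_cexp, im_minus.
  rewrite (ca_real c x Hx), <- RtoC_mult, ca_real, Rminus_0_r, cos_0, Rmult_1_r.
  + apply exp_pos.
  + rewrite RtoC_mult; now apply unit_disk_ray.
- assert (E := gc_conj c _ Hx); rewrite RtoC_conj in E.
  apply (f_equal Im) in E; rewrite im_conj in E; lra.
Qed.

(** With [p = f 0 > 0] the Cayley transform [(f - p) / (f + p)] maps the disk into the closed disk
    and vanishes at 0; Schwarz's lemma makes its modulus strictly less than 1. *)
Lemma Re_pos_of_nonneg f : hol in_disk f -> (forall z, in_disk z -> 0 <= Re (f z)) ->
  0 < Re (f 0) -> Im (f 0) = 0 -> forall z, in_disk z -> 0 < Re (f z).
Proof.
intros Hf Nn P0 I0 z Hz.
set (p := Re (f 0)) in *.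
assert (E0 : f 0 = RtoC p) by (apply C_ext; simpl; auto).
assert (Lt : forall w, in_disk w -> Cmod (f w - RtoC p) <= Cmod (f w + RtoC p) /\ 0 < Cmod (f w + RtoC p)).
{ intros w Hw; assert (X := Nn w Hw).
  assert (Q1 := Cmod_sqr (f w - RtoC p)); assert (Q2 := Cmod_sqr (f w + RtoC p)).
  rewrite re_minus, im_minus, re_RtoC, im_RtoC in Q1.
  rewrite re_plus, im_plus, re_RtoC, im_RtoC in Q2.
  assert (R1 := Cmod_ge_0 (f w - RtoC p)); assert (R2 := Cmod_ge_0 (f w + RtoC p)); nra. }
assert (H := Schwarz (fun w => (f w - RtoC p) / (f w + RtoC p))%C).
assert (B : Cmod ((f z - RtoC p) / (f z + RtoC p)) <= Cmod z).
{ apply H; auto.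
  - intros w Hw; apply cdiff_div.
    + apply Cmod_gt_0; now apply Lt.
    + apply cdiff_minus; [auto|apply cdiff_const].
    + apply cdiff_plus; [auto|apply cdiff_const].
  - rewrite E0; unfold Cdiv; ring.
  - intros w Hw; destruct (Lt w Hw) as [L1 L2].
    rewrite Cmod_div by now apply Cmod_gt_0.
    apply Rmult_le_reg_r with (Cmod (f w + RtoC p)); [easy|].
    unfold Rdiv; rewrite Rmult_assoc, Rinv_l by lra; lra. }
destruct (Lt z Hz) as [_ L2].
rewrite Cmod_div in B by now apply Cmod_gt_0.
assert (B2 : Cmod (f z - RtoC p) < Cmod (f z + RtoC p)).
{ unfold in_disk in Hz.
  replace (Cmod (f z - RtoC p))
    with (Cmod (f z - RtoC p) / Cmod (f z + RtoC p) * Cmod (f z + RtoC p)) by (field; lra).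
  nra. }
assert (Q1 := Cmod_sqr (f z - RtoC p)); assert (Q2 := Cmod_sqr (f z + RtoC p)).
rewrite re_minus, im_minus, re_RtoC, im_RtoC in Q1.
rewrite re_plus, im_plus, re_RtoC, im_RtoC in Q2.
assert (R1 := Cmod_ge_0 (f z - RtoC p)); nra.
Qed.

Lemma gc_inv_ode c z : slit_plane z -> gc c z <> 0 ->
  cder (fun w => / gc c w)%C z (- C_derive (gc c) z / (gc c z * gc c z)) /\
  (z * (- C_derive (gc c) z / (gc c z * gc c z)))%C = ((rhs c z - / gc c z) * / gc c z)%C.
Proof.
intros Hz N; split.
- apply cder_Cinv; [easy|]; now apply cdiff_cder, gc_cdiff.
- assert (E := gc_ode c z Hz).
  set (g := gc c z) in *; set (g' := C_derive (gc c) z) in *.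
  replace (z * (- g' / (g * g)))%C with (- (z * g') / (g * g))%C by (field; auto).
  replace (z * g')%C with (1 - rhs c z * g)%C by (rewrite <- E; ring).
  field; auto.
Qed.

Lemma Im_rhs c z : Im (rhs c z) = c * Im (artanh z).
Proof. rewrite rhs_artanh, im_plus, im_scal_l, im_RtoC; ring. Qed.

(** Differentiating the equation at 0 gives [2 g'(0) + c = 0]. This is where the value [1 / 2] of
    [Bfun] at 0 comes from. *)
Lemma gc_derive_0 c : C_derive (gc c) 0 = RtoC (- c / 2).
Proof.
assert (S0 : slit_plane 0) by apply slit_plane_star.
destruct (slit_plane_open 0 S0) as (r & Hr & HB).
assert (Hd : hol slit_plane (C_derive (gc c))).
{ apply hol_C_derive; [apply slit_plane_open|intros z Hz; now apply gc_cdiff]. }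
destruct (Hd 0 S0) as [d2 Hd2].
assert (D1 := cdiff_cder _ _ (gc_cdiff c 0 S0)).
assert (Dr : cder (rhs c) 0 (RtoC c)).
{ apply (cder_ext_loc (fun w => 1 + RtoC c * artanh w)%C) with (r := 1); [lra| |].
  - intros; now rewrite rhs_artanh.
  - apply (cder_eq _ _ (0 + RtoC c * 1)%C); [|ring].
    apply cder_plus; [apply cder_const|]; apply cder_scal, cder_artanh_0. }
set (g1 := C_derive (gc c) 0) in *.
assert (E : ((1 * g1 + 0 * d2) + (RtoC c * gc c 0 + rhs c 0 * g1))%C = 0).
{ apply (cder_unique (fun _ => RtoC 1) 0); [|apply cder_const].
  apply (cder_ext_loc (fun w => w * C_derive (gc c) w + rhs c w * gc c w)%C) with (r := r); auto.
  - intros w Hw; now apply gc_ode, HB.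
  - apply cder_plus.
    + apply (cder_mult (fun w => w)); [apply cder_id|easy].
    + now apply cder_mult. }
rewrite gc_0, rhs_artanh, artanh_0 in E.
replace (RtoC (- c / 2)) with (- RtoC c / 2)%C.
2:{ rewrite <- RtoC_opp, <- RtoC_div by lra; easy. }
replace g1 with ((1 * g1 + 0 * d2 + (RtoC c * 1 + (1 + RtoC c * 0) * g1)) / 2 - RtoC c / 2)%C
  by (field; apply C2_neq_0).
rewrite E; field; apply C2_neq_0.
Qed.

(** * Subordination to the extremal function *)

Lemma Re_neq_0 (w : C) : 0 < Re w -> w <> 0.
Proof. intros H ->; simpl in H; lra. Qed.

Section Subordination.
Variable c : R.
Hypothesis Hc : 0 < c.
Hypothesis Hpos : forall z, unit_disk z -> 0 < Re (gc c z).

Lemma sub_gc_neq z : unit_disk z -> gc c z <> 0.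
Proof. intros; now apply Re_neq_0, Hpos. Qed.

Lemma circle_slit_plane (z : C) : Cmod z = 1 -> z <> 1 -> z <> (-(1))%C -> slit_plane z.
Proof. intros; apply slit_plane_circle; auto; lra. Qed.

(** Let [q = / gc c] and let [z0] maximize [Im q] on the circle, hence on the closed disk. If [z0]
    is not real, [boundary_max] gives [z0 q'(z0) = i m] with [m >= 0], and the equation becomes
    [q = rhs - i m gc] at [z0]. So [Im q <= Im rhs], because [Re gc] is positive. *)
Lemma Im_inv_gc_le z : Cmod z = 1 -> Im (/ gc c z) <= PI * c / 4.
Proof.
assert (Kc : forall w, Cmod w = 1 -> unit_disk w) by (intros; apply unit_disk_Cmod; lra).
set (q := fun w => (/ gc c w)%C).
assert (Cq : forall w, unit_disk w -> cts dC unit_disk (fun w => - Ci * q w)%C w).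
{ intros w Hw; apply cts_scal, cts_Cinv; [now apply sub_gc_neq|now apply gc_cts]. }
assert (ReI : forall w, Re (- Ci * w) = Im w) by (intros; unfold Re, Im; simpl; ring).
destruct (compact_max (circle 1) (fun w => - Ci * q w)%C) as (z0 & Z0 & HM).
{ apply circle_compact. }
{ exists 1; apply Cmod_1. }
{ intros w Hw; apply cts_sub with unit_disk; [exact Kc|]; apply Cq, Kc, Hw. }
intros Hz; change (Im (q z) <= PI * c / 4).
apply Rle_trans with (Im (q z0)).
{ specialize (HM z Hz); now rewrite !ReI in HM. }
apply Rnot_lt_le; intros Big.
assert (Pc : 0 < PI * c / 4).
{ assert (P := PI_RGT_0); apply Rdiv_lt_0_compat; [|lra]; now apply Rmult_lt_0_compat. }
assert (Real : forall x, unit_disk (RtoC x) -> Im (q (RtoC x)) = 0).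
{ intros x Hx; destruct (gc_real_pos c x Hx) as [P1 P2].
  unfold q; replace (gc c (RtoC x)) with (RtoC (Re (gc c (RtoC x)))) by (apply C_ext; simpl; auto).
  rewrite <- RtoC_inv by lra; reflexivity. }
assert (N1 : z0 <> 1).
{ intros ->; rewrite (Real 1 (Kc _ Z0)) in Big; lra. }
assert (N2 : z0 <> (-(1))%C).
{ intros ->; assert (X := Real (Ropp 1)); rewrite RtoC_opp in X.
  rewrite (X (Kc _ Z0)) in Big; lra. }
assert (S0 := circle_slit_plane z0 Z0 N1 N2).
assert (K0 := Kc z0 Z0); assert (Nq := sub_gc_neq z0 K0).
destruct (gc_inv_ode c z0 S0 Nq) as [Dq Eq].
set (d := (- C_derive (gc c) z0 / (gc c z0 * gc c z0))%C) in *.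
assert (Max : forall w, Cmod w <= 1 -> Im (q w) <= Im (q z0)).
{ intros w Hw; rewrite <- (ReI (q w)).
  apply (max_principle_closed (fun w => - Ci * q w)%C); auto.
  - intros x Hx; apply cdiff_scal; assert (Hx' := in_disk_unit_disk x Hx).
    eexists; apply (gc_inv_ode c x); [now apply slit_plane_disk|now apply sub_gc_neq].
  - intros x Hx; apply Cq; now apply unit_disk_Cmod.
  - intros x Hx; rewrite ReI; specialize (HM x Hx); now rewrite !ReI in HM. }
destruct (boundary_max (fun x => - Ci * q (z0 * x)%C)%C (- Ci * (d * z0)) 1) as [B1 B2]; [lra| | |].
- apply cder_scal; apply (cder_comp q (fun x => z0 * x)%C).
  + now rewrite Cmult_1_r.
  + apply (cder_eq _ _ (z0 * 1)%C); [apply cder_scal, cder_id|ring].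
- intros x Hx _; rewrite !ReI, Cmult_1_r; apply Max.
  rewrite Cmod_mult; unfold circle in Z0; rewrite Z0; lra.
- set (m := Re (- Ci * (d * z0))) in *.
  assert (Em : (z0 * d)%C = (Ci * RtoC m)%C).
  { replace (Ci * RtoC m)%C with (Ci * (- Ci * (d * z0)))%C.
    - replace (Ci * (- Ci * (d * z0)))%C with (- (Ci * Ci) * (d * z0))%C by ring.
      replace (Ci * Ci)%C with (- (1))%C by (apply C_ext; simpl; ring); ring.
    - f_equal; apply C_ext; unfold m; simpl in B1 |- *; auto. }
  rewrite Em in Eq.
  assert (X : q z0 = (rhs c z0 - Ci * RtoC m * gc c z0)%C).
  { rewrite Eq; unfold q; field; auto. }
  apply (f_equal Im) in X; rewrite im_minus, Im_rhs in X.
  replace (Im (Ci * RtoC m * gc c z0)) with (m * Re (gc c z0)) in X by (simpl; ring).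
  assert (Hg := Hpos z0 K0).
  destruct (Im_artanh_circle z0 Z0 N1 N2) as (I1 & I2 & I3).
  assert (Ia : Im (artanh z0) <= PI / 4).
  { assert (P := PI_RGT_0); destruct (Rlt_dec 0 (Im z0)); [rewrite I1; lra|rewrite I2; lra]. }
  assert (0 <= m * Re (gc c z0)) by (apply Rmult_le_pos; lra).
  nra.
Qed.

Lemma Im_inv_gc_bound z : Cmod z = 1 -> Rabs (Im (/ gc c z)) <= PI * c / 4.
Proof.
intros Hz; apply Rabs_le; split; [|now apply Im_inv_gc_le].
assert (Kz : unit_disk z) by (apply unit_disk_Cmod; lra).
assert (H := Im_inv_gc_le (Cconj z)); rewrite Cmod_conj in H; specialize (H Hz).
rewrite gc_conj, <- Cinv_conj, im_conj in H; [lra|now apply sub_gc_neq|easy].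
Qed.

(* The continuous extension to the closed disk of
   [- (gc' / gc) (1 - z^2) / c]; see [Bfun_disk]. *)
Definition Bfun (z : C) : C :=
  if Ceq_dec z 0 then RtoC (1 / 2) else
  (((1 - z * z) * artanh z + (1 - z * z) * (1 - / gc c z) / RtoC c) / z)%C.

Lemma c_neq_0 : RtoC c <> 0.
Proof. intros E; apply RtoC_inj in E; lra. Qed.

Lemma Bfun_disk z : in_disk z ->
  Bfun z = (- (C_derive (gc c) z / gc c z) * (1 - z * z) / RtoC c)%C.
Proof.
intros Hz; assert (Nc := c_neq_0).
assert (Kz := in_disk_unit_disk z Hz); assert (Ng := sub_gc_neq z Kz).
assert (N2 := C2_neq_0).
unfold Bfun; destruct (Ceq_dec z 0) as [->|N].
- rewrite gc_derive_0, gc_0, !RtoC_div, RtoC_opp by lra; field; auto.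
- assert (E := gc_ode c z (slit_plane_disk z Hz)); rewrite rhs_artanh in E.
  set (g := gc c z) in *; set (g' := C_derive (gc c) z) in *.
  replace (artanh z) with ((1 - z * g' - g) / (RtoC c * g))%C.
  + field; auto.
  + rewrite <- E; field; auto.
Qed.

Lemma Bfun_hol : hol in_disk Bfun.
Proof.
intros z Hz; destruct (in_disk_open z Hz) as (r & Hr & HB).
apply (cdiff_ext_loc (fun z => / RtoC c * (- (C_derive (gc c) z / gc c z) * (1 - z * z)))%C)
  with (r := r); auto.
- intros w Hw; rewrite Bfun_disk by auto; unfold Cdiv; ring.
- apply cdiff_scal, cdiff_mult.
  + apply cdiff_opp, cdiff_div.
    * now apply sub_gc_neq, in_disk_unit_disk.
    * apply (hol_C_derive slit_plane); [apply slit_plane_open| |now apply slit_plane_disk].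
      intros w Hw; now apply gc_cdiff.
    * now apply gc_cdiff, slit_plane_disk.
  + apply cdiff_minus; [apply cdiff_const|apply cdiff_mult; apply cdiff_id].
Qed.

Lemma Bfun_cts z : unit_disk z -> cts dC unit_disk Bfun z.
Proof.
intros Kz; destruct (Ceq_dec z 0) as [->|N].
{ apply cdiff_cts, Bfun_hol; unfold in_disk; rewrite Cmod_0; lra. }
assert (P := proj1 (Cmod_gt_0 z) N).
apply cts_loc with (Cmod z); [easy|].
set (S := fun w => unit_disk w /\ Cmod (w - z) < Cmod z).
apply cts_ext with (f := fun z =>
  (((1 - z * z) * artanh z + (1 - z * z) * (1 - / gc c z) / RtoC c) / z)%C).
- intros w [_ Hw]; unfold Bfun; destruct (Ceq_dec w 0) as [->|]; [|easy].
  replace (0 - z)%C with (- z)%C in Hw by ring; rewrite Cmod_opp in Hw; lra.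
- unfold Bfun; destruct (Ceq_dec z 0); [contradiction|easy].
- assert (C1 : cts dC S (fun w => 1 - w * w)%C z)
    by (apply cts_minus; [apply cts_const|apply cts_mult; apply cts_id]).
  apply cts_div; [easy| |apply cts_id].
  apply cts_plus.
  + apply cts_sub with unit_disk; [now intros y [H _]|].
    apply artanh_weighted_cts; now apply unit_disk_Cmod.
  + apply cts_div; [apply c_neq_0| |apply cts_const].
    apply cts_mult; [easy|]; apply cts_minus; [apply cts_const|].
    apply cts_Cinv; [now apply sub_gc_neq|].
    apply cts_sub with unit_disk; [now intros y [H _]|now apply gc_cts].
Qed.

(* On the circle [(1 - z^2) / z = - 2 i Im z], and [Im (rhs c z)] is
   [pi c / 4] with the sign of [Im z]. *)
Lemma Re_Bfun_circle z : Cmod z = 1 -> 0 <= Re (Bfun z).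
Proof.
intros Hz; unfold Bfun.
destruct (Ceq_dec z 0) as [->|N]; [rewrite Cmod_0 in Hz; lra|].
assert (Nc := c_neq_0).
destruct (Ceq_dec z 1) as [->|N1].
{ replace (_ / _)%C with (RtoC 0); [simpl; lra|].
  replace (1 - 1 * 1)%C with (RtoC 0) by ring; unfold Cdiv; ring. }
destruct (Ceq_dec z (-(1))%C) as [->|N2].
{ replace (_ / _)%C with (RtoC 0); [simpl; lra|].
  replace (1 - - (1) * - (1))%C with (RtoC 0) by ring; unfold Cdiv; ring. }
assert (Ezz : (z * Cconj z)%C = 1) by (rewrite <- Cmod2_conj, Hz, pow1; easy).
replace (((1 - z * z) * artanh z + (1 - z * z) * (1 - / gc c z) / RtoC c) / z)%C
  with (RtoC (/ c) * ((rhs c z - / gc c z) * (Cconj z - z)))%C.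
2:{ rewrite RtoC_inv by lra; rewrite rhs_artanh.
  replace (Cconj z) with (/ z)%C.
  2:{ replace (/ z)%C with (/ z * (z * Cconj z))%C by (rewrite Ezz; ring); field; auto. }
  field; repeat split; auto; apply sub_gc_neq, unit_disk_Cmod; lra. }
rewrite re_scal_l; apply Rmult_le_pos; [left; now apply Rinv_0_lt_compat|].
rewrite re_mult, !im_minus, !re_minus, re_conj, im_conj, Im_rhs.
assert (B := Im_inv_gc_bound z Hz); apply Rabs_le_between in B.
destruct (Im_artanh_circle z Hz N1 N2) as (I1 & I2 & I3).
set (i := Im (/ gc c z)) in *; set (y := Im z) in *.
replace (Re z - Re z) with 0 by ring.
destruct (Rlt_dec 0 y) as [Hy|Hy].
- rewrite I1 by easy; nra.
- rewrite I2 by lra; nra.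
Qed.

Lemma Re_Bfun_pos z : in_disk z -> 0 < Re (Bfun z).
Proof.
apply Re_pos_of_nonneg.
- apply Bfun_hol.
- intros w Hw.
  assert (H := max_principle_closed (fun x => - Bfun x)%C 0).
  assert (X : Re (- Bfun w) <= 0); [|rewrite re_opp in X; lra].
  apply H.
  + intros x Hx; now apply cdiff_opp, Bfun_hol.
  + intros x Hx; apply cts_opp, Bfun_cts; now apply unit_disk_Cmod.
  + intros x Hx; rewrite re_opp; assert (Y := Re_Bfun_circle x Hx); lra.
  + left; exact Hw.
- unfold Bfun; destruct (Ceq_dec 0 0); [simpl; lra|easy].
- unfold Bfun; destruct (Ceq_dec 0 0); [easy|easy].
Qed.

Lemma gc_derive_neq z : in_disk z -> C_derive (gc c) z <> 0.
Proof.
intros Hz E; assert (H := Re_Bfun_pos z Hz); rewrite Bfun_disk, E in H by easy.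
replace (- (0 / gc c z) * (1 - z * z) / RtoC c)%C with (RtoC 0) in H by (unfold Cdiv; ring).
simpl in H; lra.
Qed.

(* On the strip, [- log (gc (tanh x))] has derivative [c * Bfun (tanh x)]. *)
Lemma gc_injective z w : in_disk z -> in_disk w -> gc c z = gc c w -> z = w.
Proof.
intros Hz Hw E.
assert (NW := Noshiro_Warschawski strip (fun x => - Clog (gc c (Ctanh x)))%C
  (fun x => RtoC c * Bfun (Ctanh x))%C).
rewrite <- (Ctanh_artanh z), <- (Ctanh_artanh w) by now apply slit_plane_disk.
apply (f_equal Ctanh), (NW); [| |now apply artanh_strip|now apply artanh_strip|].
- intros x y t Hx Hy [T0 T1]; unfold strip, seg in *.
  rewrite im_plus, im_scal_l, im_minus.
  apply Rabs_lt_between in Hx; apply Rabs_lt_between in Hy.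
  apply Rabs_lt_between; destruct (Rle_dec (Im x) (Im y)); split; nra.
- intros x Hx; assert (Dx := Ctanh_disk x Hx).
  split; [|rewrite re_scal_l; apply Rmult_lt_0_compat; [easy|now apply Re_Bfun_pos]].
  assert (Kx := in_disk_unit_disk _ Dx); assert (Ng := sub_gc_neq _ Kx).
  apply (cder_eq _ _ (- (/ gc c (Ctanh x) * (C_derive (gc c) (Ctanh x) * (1 - Ctanh x * Ctanh x))))%C).
  + apply cder_opp; apply (cder_comp Clog (fun x => gc c (Ctanh x))).
    * now apply cder_Clog, Re_pos_slit, Hpos.
    * apply (cder_comp (gc c) Ctanh); [|now apply cder_Ctanh].
      now apply cdiff_cder, gc_cdiff, slit_plane_disk.
  + rewrite Bfun_disk by easy; field; split; auto using c_neq_0.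
- now rewrite !Ctanh_artanh, E by now apply slit_plane_disk.
Qed.

Section Comparison.
Variable a : C -> C.
Hypotheses (Ha : hol in_disk a) (a0 : a 0 = 0).
Hypothesis Hphi : forall z, in_disk z -> Rabs (Im (z * C_derive a z)) < PI * c / 4.

(** The function [(phi - 1) / c], which the hypothesis maps into the strip. For [phi = rhs c] it is
    [artanh], so [Ctanh (Y z)] is the Schwarz function expressing the subordination of [phi] to
    [rhs c]. *)
Let Y (z : C) : C := (z * C_derive a z / RtoC c)%C.

Lemma sub_Y_strip z : in_disk z -> strip (Y z).
Proof.
intros Hz; assert (H := Hphi z Hz); unfold strip, Y.
replace (z * C_derive a z / RtoC c)%C with (RtoC (/ c) * (z * C_derive a z))%C
  by (rewrite RtoC_inv by lra; unfold Cdiv; ring).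
rewrite im_scal_l, Rabs_mult, Rabs_pos_eq by (left; now apply Rinv_0_lt_compat).
apply Rmult_lt_reg_l with c; [easy|].
rewrite <- Rmult_assoc, Rinv_r, Rmult_1_l by lra; lra.
Qed.

Lemma sub_Schwarz_Y z : in_disk z -> Cmod (Ctanh (Y z)) <= Cmod z.
Proof.
apply (Schwarz (fun z => Ctanh (Y z))).
- intros w Hw; apply (cdiff_comp Ctanh Y).
  + eexists; now apply cder_Ctanh, sub_Y_strip.
  + apply cdiff_div; [apply c_neq_0| |apply cdiff_const].
    apply cdiff_mult; [apply cdiff_id|].
    apply (hol_C_derive in_disk); auto using in_disk_open.
- unfold Y; replace (0 * C_derive a 0 / RtoC c)%C with (RtoC 0) by (unfold Cdiv; ring).
  unfold Ctanh; rewrite Cmult_0_r, cexp_0; unfold Cdiv; ring.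
- intros w Hw; left; now apply Ctanh_disk, sub_Y_strip.
Qed.

Let h : C -> C := G a.

Lemma sub_h_ode z : in_disk z ->
  cdiff h z /\ (z * C_derive h z + (1 + z * C_derive a z) * h z)%C = 1.
Proof. intros Hz; now apply (G_ode in_disk a z in_disk_star). Qed.

Lemma sub_inverse : openC (fun w => exists z, in_disk z /\ gc c z = w) /\
  exists g, forall z, in_disk z -> g (gc c z) = z /\ cder g (gc c z) (/ C_derive (gc c) z).
Proof.
apply inverse_exists.
- apply in_disk_open.
- intros z Hz; now apply gc_cdiff, slit_plane_disk.
- intros; now apply gc_injective.
- exact gc_derive_neq.
Qed.

(** After normalization [u x = omega (z0 x) / omega z0] satisfies [|u x| <= |x|] by Schwarz's lemma,
    so [Re (u x / x)] is maximal at 1. The derivative of this quotient at 1 is [m - 1], and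
    [boundary_max] makes it real and nonnegative. *)
Lemma Jack (omega : C -> C) (z0 : C) : z0 <> 0 -> omega z0 <> 0 -> cdiff omega z0 ->
  (forall z, Cmod z < Cmod z0 -> cdiff omega z) -> omega 0 = 0 ->
  (forall z, Cmod z <= Cmod z0 -> Cmod (omega z) <= Cmod (omega z0)) ->
  exists m, 1 <= m /\ (z0 * C_derive omega z0)%C = (RtoC m * omega z0)%C.
Proof.
intros Nz No D0 Dd o0 Hm.
set (zeta := omega z0) in *.
assert (Pz := proj1 (Cmod_gt_0 z0) Nz); assert (Po := proj1 (Cmod_gt_0 zeta) No).
set (u := fun x => (/ zeta * omega (z0 * x)%C)%C).
assert (Eu : forall x, Cmod (u x) = Cmod (omega (z0 * x)%C) / Cmod zeta).
{ intros x; unfold u; rewrite Cmod_mult, Cmod_inv by easy; unfold Rdiv; ring. }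
assert (U1 : forall x, Cmod x <= 1 -> Cmod (u x) <= 1).
{ intros x Hx; rewrite Eu; apply Rmult_le_reg_r with (Cmod zeta); [easy|].
  unfold Rdiv; rewrite Rmult_assoc, Rinv_l, Rmult_1_r, Rmult_1_l by lra.
  apply Hm; rewrite Cmod_mult; nra. }
assert (U2 : forall x, Cmod x <= 1 -> Cmod (u x) <= Cmod x).
{ intros x [Hx|Hx]; [|rewrite Hx; apply U1; lra].
  apply (Schwarz u); auto.
  - intros w Hw; apply cdiff_scal; apply (cdiff_comp omega (fun x => z0 * x)%C).
    + apply Dd; rewrite Cmod_mult; unfold in_disk in Hw; nra.
    + apply cdiff_scal, cdiff_id.
  - unfold u; rewrite Cmult_0_r, o0; ring.
  - intros w Hw; apply U1; now left. }
set (d := C_derive omega z0).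
assert (Du : cder u 1 (/ zeta * (d * z0))).
{ apply cder_scal; apply (cder_comp omega (fun x => z0 * x)%C).
  - rewrite Cmult_1_r; now apply cdiff_cder.
  - apply (cder_eq _ _ (z0 * 1)%C); [apply cder_scal, cder_id|ring]. }
assert (u1 : u 1 = 1) by (unfold u; rewrite Cmult_1_r; fold zeta; field; auto).
assert (One := C1_nz).
destruct (boundary_max (fun x => u x / x)%C (/ zeta * (d * z0) - 1) 1) as [B1 B2].
- lra.
- apply (cder_eq _ _ ((/ zeta * (d * z0) * 1 - u 1 * 1) / (1 * 1))%C).
  + apply (cder_div u (fun x => x)); auto using cder_id.
  + rewrite u1; field; auto.
- intros x Hx Hx1.
  assert (Nx : x <> 0).
  { intros ->; replace (0 - 1)%C with (- (1))%C in Hx1 by ring.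
    rewrite Cmod_opp, Cmod_1 in Hx1; lra. }
  assert (Px := proj1 (Cmod_gt_0 x) Nx).
  rewrite u1; replace (1 / 1)%C with (RtoC 1) by (field; auto).
  apply Rle_trans with (1 := Re_le_Cmod _); rewrite Cmod_div by easy; simpl.
  apply Rmult_le_reg_r with (Cmod x); [easy|].
  unfold Rdiv; rewrite Rmult_assoc, Rinv_l, Rmult_1_r, Rmult_1_l by lra; now apply U2.
- set (m := (/ zeta * (d * z0))%C) in *.
  rewrite im_minus, im_RtoC in B1; rewrite re_minus, re_RtoC in B2.
  exists (Re m); split; [lra|].
  replace (RtoC (Re m)) with m by (apply C_ext; rewrite ?re_RtoC, ?im_RtoC; lra).
  unfold m; field; auto.
Qed.

(** Within radius [rho] the values of [h] lie in the image of [gc c], so the composite [omega] of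
    [g] with [h] can be used there before [h] is known to stay in that image everywhere. If
    [|omega z|] exceeded [|z|], Jack's lemma would apply at a maximum of [|omega|] over a closed
    disk, and the convexity of the level sets would be violated. *)
Lemma subordination_bound g rho :
  (forall z, in_disk z -> g (gc c z) = z /\ cder g (gc c z) (/ C_derive (gc c) z)) ->
  rho <= 1 -> (forall z, Cmod z < rho -> exists x, in_disk x /\ gc c x = h z) ->
  forall z, Cmod z < rho -> Cmod (g (h z)) <= Cmod z.
Proof.
intros Hg Hrho Hin z1 Hz1.
set (omega := fun z => g (h z)).
assert (Dsk : forall z, Cmod z < rho -> in_disk z) by (intros; unfold in_disk; lra).
assert (Om : forall z, Cmod z < rho -> in_disk (omega z) /\ gc c (omega z) = h z /\
  cder omega z (/ C_derive (gc c) (omega z) * C_derive h z)%C).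
{ intros z Hz; destruct (Hin z Hz) as (x & Dx & Ex).
  assert (E : omega z = x) by (unfold omega; rewrite <- Ex; now apply Hg).
  rewrite E; split; [easy|split; [easy|]].
  apply (cder_comp g h).
  - rewrite <- Ex; now apply Hg.
  - apply cdiff_cder; now apply sub_h_ode, Dsk. }
apply Rnot_lt_le; intros Viol; change (Cmod z1 < Cmod (omega z1)) in Viol.
assert (S0 : forall z, Cmod (z - 0) = Cmod z) by (intros; f_equal; ring).
destruct (compact_max (cdisk 0 (Cmod z1)) (fun z => RtoC (Cmod (omega z)))) as (z0 & K0 & HM).
{ apply cdisk_compact. }
{ exists z1; unfold cdisk; rewrite S0; lra. }
{ intros z Hz; unfold cdisk in Hz; rewrite S0 in Hz.
  apply cts_Cmod; eapply cder_cts; apply Om; lra. }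
assert (HM' : forall z, Cmod z <= Cmod z1 -> Cmod (omega z) <= Cmod (omega z0)).
{ intros z Hz; apply HM; unfold cdisk; now rewrite S0. }
unfold cdisk in K0; rewrite S0 in K0.
assert (V0 : Cmod z0 < Cmod (omega z0)) by (specialize (HM' z1 ltac:(lra)); lra).
assert (P0 := Cmod_ge_0 z0); assert (P1 := Cmod_ge_0 z1).
assert (D0 : in_disk 0) by (unfold in_disk; rewrite Cmod_0; lra).
assert (o0 : omega 0 = 0).
{ unfold omega, h; rewrite G_0, <- (gc_0 c); now apply Hg. }
assert (Nz : z0 <> 0) by (intros ->; rewrite o0, Cmod_0 in V0; lra).
assert (L0 : Cmod z0 < rho) by lra.
destruct (Om z0 L0) as (Dz & Eh & Do).
assert (No : omega z0 <> 0) by (apply Cmod_gt_0; lra).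
destruct (Jack omega z0 Nz No) as (m & Hm & Em); auto.
{ eexists; exact Do. }
{ intros z Hz; eexists; apply Om; lra. }
{ intros z Hz; apply HM'; lra. }
rewrite (cder_C_derive _ _ _ Do) in Em.
set (zeta := omega z0) in *.
assert (Dz0 := Dsk z0 L0).
destruct (sub_h_ode z0 Dz0) as [_ Oh].
assert (Og := gc_ode c zeta (slit_plane_disk zeta Dz)); rewrite rhs_artanh in Og.
rewrite <- Eh in Oh.
assert (Ng := sub_gc_neq zeta (in_disk_unit_disk zeta Dz)).
assert (Nd := gc_derive_neq zeta Dz); assert (Nc := c_neq_0).
assert (SY := sub_Y_strip z0 Dz0); assert (Sx := artanh_strip zeta Dz).
set (x0 := artanh zeta) in *.
assert (Tx : Ctanh x0 = zeta) by (apply Ctanh_artanh; now apply slit_plane_disk).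
assert (Conv := level_sets_convex x0 (Y z0) Sx SY).
rewrite Tx in Conv; assert (SY2 := sub_Schwarz_Y z0 Dz0); specialize (Conv ltac:(lra)).
set (N := level_normal x0) in *.
assert (EN : (N * (1 - zeta * zeta))%C = (2 * zeta)%C).
{ rewrite <- Tx at 1 2 3; now apply level_normal_tanh. }
assert (N2 := C2_neq_0).
(* As [h z0 = gc c zeta], subtracting the equations of [h] at [z0] and of [gc c] at [zeta] leaves
   [c (Y z0 - x0) gc = zeta gc' - z0 h'], and [z0 h' = m zeta gc'] by Jack. Writing [2 zeta] as
   [N (1 - zeta^2)] brings in [Bfun], whose real part is positive: [Y z0] does not lie on the inner
   side of the tangent at [x0], contrary to [Conv]. *)
assert (Key : (Y z0 - x0)%C = (RtoC ((m - 1) / 2) * (N * Bfun zeta))%C).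
{ rewrite Bfun_disk by easy.
  set (g0 := gc c zeta) in *; set (g1 := C_derive (gc c) zeta) in *; set (h1 := C_derive h z0) in *.
  replace (N * (- (g1 / g0) * (1 - zeta * zeta) / RtoC c))%C
    with (- (g1 / g0) * (N * (1 - zeta * zeta)) / RtoC c)%C by (field; auto).
  rewrite EN, RtoC_div, RtoC_minus by lra.
  assert (Eh1 : (z0 * h1)%C = (RtoC m * zeta * g1)%C).
  { replace (z0 * h1)%C with (z0 * (/ g1 * h1) * g1)%C by (field; auto); rewrite Em; ring. }
  replace (Y z0) with ((1 - z0 * h1 - g0) / (RtoC c * g0))%C.
  2:{ unfold Y; rewrite <- Oh; field; auto. }
  replace x0 with ((1 - zeta * g1 - g0) / (RtoC c * g0))%C.
  2:{ rewrite <- Og; field; auto. }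
  rewrite Eh1; field; auto. }
rewrite Key in Conv.
replace (RtoC ((m - 1) / 2) * (N * Bfun zeta) * Cconj N)%C
  with (RtoC ((m - 1) / 2 * (Cmod N * Cmod N)) * Bfun zeta)%C in Conv.
2:{ rewrite (RtoC_mult ((m - 1) / 2)).
  replace (RtoC (Cmod N * Cmod N)) with (N * Cconj N)%C
    by (rewrite <- Cmod2_conj; simpl; now rewrite Rmult_1_r).
  ring. }
rewrite re_scal_l in Conv; assert (HB := Re_Bfun_pos zeta Dz).
assert (0 <= (m - 1) / 2 * (Cmod N * Cmod N)).
{ apply Rmult_le_pos; [lra|]; apply Rmult_le_pos; apply Cmod_ge_0. }
nra.
Qed.

(** It suffices that [h] stays in the image of [gc c]. At a point [z2] of least modulus where it
    leaves, the bound on smaller radii puts [h (t z2)] in the image of the closed disk of radius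
    [|z2|]. That image is compact, so it contains the limit [h z2] as well. *)
Theorem subordination z : in_disk z -> 0 < Re (G a z).
Proof.
destruct sub_inverse as [Op [g Hg]].
pose (Img := fun w => exists x, in_disk x /\ gc c x = w).
enough (All : forall z, in_disk z -> Img (h z)).
{ intros Hz; destruct (All z Hz) as (x & Dx & Ex); fold h; rewrite <- Ex.
  now apply Hpos, in_disk_unit_disk. }
clear z; intros z1 D1; apply NNPP; intros N1.
assert (S0 : forall z, Cmod (z - 0) = Cmod z) by (intros; f_equal; ring).
(* This set is closed because the image of [gc c] is open, so an element of least modulus exists. *)
set (E := fun z => Cmod z <= Cmod z1 /\ ~ Img (h z)).
unfold in_disk in D1.
destruct (compact_min E (fun z => RtoC (Cmod z))) as (z2 & [L2 N2] & Hmin).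
{ split.
  - intros p Hp; destruct (Rle_lt_dec (Cmod p) (Cmod z1)) as [Lp|Lp].
    + assert (Ip : Img (h p)) by (apply NNPP; intros X; apply Hp; split; auto).
      destruct (Op (h p) Ip) as (e & He & HB).
      assert (Dp : in_disk p) by (unfold in_disk; lra).
      destruct (cdiff_cts h p everywhere (proj1 (sub_h_ode p Dp)) e He) as (d & Hd & HC).
      exists d; split; [easy|]; intros w Hw [_ X]; apply X, HB, HC; [easy|exact Hw].
    + exists (Cmod p - Cmod z1); split; [lra|]; intros w Hw [X _].
      assert (B := Cmod_sub_le p w); rewrite Cmod_sub_sym in B; lra.
  - exists (Cmod z1); intros z [X _]; easy. }
{ exists z1; split; [lra|easy]. }
{ intros z _; apply cts_Cmod, cts_id. }
simpl in Hmin.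
assert (In2 : forall z, Cmod z < Cmod z2 -> Img (h z)).
{ intros z Hz; apply NNPP; intros X.
  assert (Ez : E z) by (split; [lra|exact X]); specialize (Hmin z Ez); lra. }
assert (Bd := subordination_bound g (Cmod z2) Hg ltac:(lra) In2).
assert (P2 := Cmod_ge_0 z2).
assert (Nz2 : 0 < Cmod z2).
{ destruct P2 as [|E2]; [easy|exfalso]; symmetry in E2; apply Cmod_eq_0 in E2; subst z2.
  apply N2; exists 0; unfold h; rewrite G_0, gc_0; split; [|easy].
  unfold in_disk; rewrite Cmod_0; lra. }
assert (D2 : in_disk z2) by (unfold in_disk; lra).
destruct (compact_image_closed (cdisk 0 (Cmod z2)) (gc c) (h z2)) as (x & Kx & Ex).
{ apply cdisk_compact. }
{ intros w Hw; unfold cdisk in Hw; rewrite S0 in Hw.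
  apply cdiff_cts, gc_cdiff, slit_plane_disk; unfold in_disk; lra. }
{ intros e He.
  destruct (cdiff_cts h z2 everywhere (proj1 (sub_h_ode z2 D2)) e He) as (d & Hd & HC).
  set (t := Rmax (1 / 2) (1 - d / 2)).
  assert (T1 : t < 1) by (apply Rmax_lub_lt; lra).
  assert (T2 : 1 / 2 <= t) by apply Rmax_l.
  assert (T3 : 1 - d / 2 <= t) by apply Rmax_r.
  assert (Lt : Cmod (RtoC t * z2) < Cmod z2).
  { rewrite Cmod_mult, Cmod_R, Rabs_pos_eq by lra; nra. }
  destruct (In2 _ Lt) as (y & Dy & Ey); exists y; split.
  - unfold cdisk; rewrite S0.
    assert (X := Bd _ Lt); rewrite <- Ey, (proj1 (Hg y Dy)) in X; lra.
  - rewrite Ey; apply HC; [easy|]; unfold dC.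
    replace (RtoC t * z2 - z2)%C with (RtoC (t - 1) * z2)%C by (rewrite RtoC_minus; ring).
    rewrite Cmod_mult, Cmod_R, Rabs_minus_sym, Rabs_pos_eq by lra.
    unfold in_disk in D2; nra. }
apply N2; exists x; split; [|easy].
unfold cdisk in Kx; rewrite S0 in Kx; unfold in_disk; lra.
Qed.

End Comparison.

End Subordination.

(** * The first touching parameter *)

Definition gc_positive (c : R) : Prop := forall z, unit_disk z -> 0 < Re (gc c z).

Lemma starlike_of_gc_positive c f : 0 < c -> gc_positive c -> class_A1 f ->
  phi_maps_into f (PI * c / 4) -> starlike f.
Proof.
intros Hc Hp Cf Hphi.
destruct (class_repr f Cf (fun z Hz => proj1 (Hphi z Hz))) as (a & a0 & Ha & Hfa).
apply (starlike_of_Re_G_pos f a); auto.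
- intros z Hz; destruct (Hfa z Hz) as (E1 & E2 & _); auto.
- apply (subordination c Hc Hp a Ha).
  intros z Hz; destruct (Hphi z Hz) as [_ Hw]; unfold W in Hw.
  destruct (Hfa z Hz) as (_ & _ & E3); rewrite E3 in Hw.
  now rewrite im_plus, im_RtoC, Rplus_0_l in Hw.
Qed.

Lemma gc_positive_0 : gc_positive 0.
Proof.
intros z Hz; unfold gc, G; rewrite (CInt_ext 0 1 _ (fun _ => RtoC 1)).
- rewrite CInt_const; simpl; lra.
- lra.
- intros t _; unfold ca; rewrite !Cmult_0_l, <- cexp_0; f_equal; ring.
Qed.

Lemma gc_positive_open c : gc_positive c ->
  exists d, 0 < d /\ forall c', Rabs (c' - c) < d -> gc_positive c'.
Proof.
intros Hp.
destruct (compact_uniform unit_disk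
  (fun z d => forall c', Rabs (c' - c) < d -> 0 < Re (gc c' z))) as (d & Hd & H).
- apply cdisk_compact.
- intros x e e' H He c' Hc'; apply H; lra.
- intros p Hp'; destruct (gc_jointly_cts c p Hp' (Re (gc c p)) (Hp p Hp')) as (d & Hd & H).
  exists (d / 2); split; [lra|]; intros x Hx Hxp c' Hc'.
  assert (X := H (c', x) Hx); unfold dprod, dR, dC in X; cbn [fst snd] in X; specialize (X ltac:(lra)).
  assert (Y := re_le_Cmod (gc c' x - gc c p)); rewrite re_minus in Y.
  apply Rabs_le_between in Y; lra.
- exists d; split; [easy|]; intros c' Hc' z Hz; now apply H.
Qed.

(* [(exp (8 z) - 1) / 8] takes the same value at [i pi / 8] and [- i pi / 8]. *)
Lemma gc_positive_bounded c : 0 < c -> gc_positive c -> PI * c / 4 < 8.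
Proof.
intros Hc Hp; apply Rnot_le_lt; intros Big.
(* Then [phi f = 1 + 8 z], whose imaginary part stays below [8 <= PI c / 4], while the two points
   with a common value lie in the disk because [PI / 8 < 1]. *)
set (a := fun z => (8 * z)%C).
assert (Da : forall z, cder a z 8).
{ intros z; apply (cder_eq _ _ (8 * 1)%C); [apply cder_scal, cder_id|ring]. }
assert (a0 : a 0 = 0) by (unfold a; ring).
assert (Ha : hol in_disk a) by (intros z _; eexists; apply Da).
destruct (class_build a a0 Ha) as (f & Cf & Hfa).
assert (Sf : starlike f).
{ apply (starlike_of_gc_positive c); auto; intros z Hz.
  destruct (Hfa z Hz) as (E1 & _ & E3); split; [rewrite E1; apply cexp_neq_0|].
  unfold W; rewrite E3, (cder_C_derive _ _ _ (Da z)), im_plus, im_RtoC, Rplus_0_l, im_scal_r.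
  unfold in_disk in Hz; rewrite Rabs_mult, (Rabs_pos_eq 8) by lra.
  generalize (im_le_Cmod z); lra. }
assert (N8 : RtoC 8 <> 0) by (intros E; apply RtoC_inj in E; lra).
assert (Ef : forall z, in_disk z -> f z = ((cexp (a z) - 1) / 8)%C).
{ intros z Hz.
  assert (X := zero_derivative_const in_disk (fun w => f w - (cexp (a w) - 1) * / 8)%C in_disk_star).
  assert (E : (f z - (cexp (a z) - 1) * / 8)%C = (f 0 - (cexp (a 0) - 1) * / 8)%C).
  { apply X; [|easy]; intros w Hw.
    apply (cder_eq _ _ (cexp (a w) - ((cexp (a w) * 8 - 0) * / 8 + (cexp (a w) - 1) * 0))%C).
    - apply cder_minus.
      + rewrite <- (proj1 (Hfa w Hw)); apply cdiff_cder; now apply (class_A1_hol f Cf).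
      + apply (cder_mult (fun w => cexp (a w) - 1)%C (fun _ => / 8)%C); [|apply cder_const].
        apply cder_minus; [|apply cder_const].
        apply (cder_cexp_comp a), Da.
    - field; auto. }
  rewrite (proj1 (proj2 Cf)), a0, cexp_0 in E.
  apply Ceq_minus; unfold Cdiv; rewrite E; ring. }
assert (P4 := PI_4); assert (P0 := PI_RGT_0).
set (p := (RtoC (PI / 8) * Ci)%C).
assert (Dp : in_disk p).
{ unfold in_disk, p; rewrite Cmod_mult, Cmod_Ci, Cmod_R, Rabs_pos_eq; lra. }
assert (Dm : in_disk (- p)) by (unfold in_disk; now rewrite Cmod_opp).
assert (E : p = (- p)%C).
{ apply (proj1 (proj2 Sf)); auto; rewrite !Ef by easy; do 2 f_equal.
  replace (a p) with (a (- p) + RtoC (2 * (IZR 1 * PI)) * Ci)%C; [apply cexp_period|].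
  unfold a, p; apply C_ext; rewrite ?re_plus, ?im_plus, ?re_scal_l, ?im_scal_l, ?re_opp, ?im_opp,
    ?re_scal_l, ?im_scal_l; simpl; field. }
apply (f_equal Im) in E; unfold p in E; rewrite im_opp, im_scal_l in E; simpl in E; lra.
Qed.

(* Such a zero is a boundary minimum of [Re gc], hence [z gc' (z)] is real; the
   differential equation then gives [Re (rhs c z) = 0]. *)
Lemma touching_point c z : 0 < c -> (forall w, unit_disk w -> 0 <= Re (gc c w)) ->
  unit_disk z -> Re (gc c z) = 0 ->
  Cmod z = 1 /\ slit_plane z /\ gc c z <> 0 /\ Re (rhs c z) = 0.
Proof.
intros Hc Hnn Kz Rz.
assert (Hz : Cmod z = 1).
{ destruct (proj1 (unit_disk_Cmod z) Kz) as [Lt|]; [exfalso|easy].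
  assert (X : 0 < Re (gc c z)); [|lra].
  apply Re_pos_of_nonneg; auto.
  - intros w Hw; now apply gc_cdiff, slit_plane_disk.
  - intros w Hw; now apply Hnn, in_disk_unit_disk.
  - rewrite gc_0; simpl; lra.
  - now rewrite gc_0. }
assert (N1 : z <> 1).
{ intros ->; destruct (gc_real_pos c 1 Kz); lra. }
assert (N2 : z <> (-(1))%C).
{ intros ->; rewrite <- RtoC_opp in Kz, Rz; destruct (gc_real_pos c (Ropp 1) Kz); lra. }
assert (Sz := circle_slit_plane z Hz N1 N2).
set (g' := C_derive (gc c) z).
destruct (boundary_max (fun x => - gc c (z * x)%C)%C (- (g' * z)) 1) as [B1 B2]; [lra| | |].
- apply cder_opp, (cder_comp (gc c) (fun x => z * x)%C).
  + rewrite Cmult_1_r; now apply cdiff_cder, gc_cdiff.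
  + apply (cder_eq _ _ (z * 1)%C); [apply cder_scal, cder_id|ring].
- intros x Hx _; rewrite !re_opp, Cmult_1_r, Rz.
  assert (X := Hnn (z * x)%C); rewrite unit_disk_Cmod, Cmod_mult, Hz in X.
  specialize (X ltac:(lra)); lra.
- assert (E := gc_ode c z Sz); fold g' in E.
  assert (E1 := f_equal Re E); assert (E2 := f_equal Im E).
  rewrite re_plus, (re_mult (rhs c z)), Rz, re_RtoC in E1.
  rewrite im_plus, (im_mult (rhs c z)), Rz, im_RtoC in E2.
  rewrite im_opp, (Cmult_comm g') in B1; rewrite re_opp, (Cmult_comm g') in B2.
  assert (Nb : Im (gc c z) <> 0) by (intros E0; rewrite E0 in E1; lra).
  split; [easy|split; [easy|split]].
  + intros E0; apply Nb; now rewrite E0.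
  + assert (X : Re (rhs c z) * Im (gc c z) = 0) by lra.
    apply Rmult_integral in X; tauto.
Qed.

(** The condition says [|1 - z| = K |1 + z|] with [K = exp (2 / c)], a circle of Apollonius. It
    meets the unit circle in two conjugate points of real part
    [(1 - K^2) / (1 + K^2) = cos (2 atan K)], which is the origin of [theta]. *)
Lemma Re_rhs_zero_circle c z : 0 < c -> Cmod z = 1 -> slit_plane z ->
  Re (rhs c z) = 0 -> z = cis (theta c) \/ z = Cconj (cis (theta c)).
Proof.
intros Hc Hz Sz HR.
destruct (slit_plane_mob z Sz) as (N1 & N2 & _).
set (K := exp (2 / c)); assert (PK : 0 < K) by apply exp_pos.
assert (P1 := proj1 (Cmod_gt_0 _) (C1_minus_neq z N1)).
assert (P2 := proj1 (Cmod_gt_0 _) (C1_plus_neq z N2)).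
assert (El : ln (Cmod (mob z)) = - (2 / c)).
{ unfold rhs in HR; fold (mob z) in HR.
  rewrite re_plus, re_scal_l, re_RtoC in HR; unfold Clog in HR; simpl in HR.
  apply Rmult_eq_reg_l with (c / 2); [|lra].
  replace (c / 2 * - (2 / c)) with (-1) by (field; lra); lra. }
assert (Em : Cmod (1 + z) * K = Cmod (1 - z)).
{ assert (X : Cmod (mob z) = / K).
  { unfold K; rewrite <- exp_Ropp, <- El, exp_ln; [easy|].
    unfold mob; rewrite Cmod_div by (now apply C1_minus_neq); now apply Rdiv_lt_0_compat. }
  unfold mob in X; rewrite Cmod_div in X by (now apply C1_minus_neq).
  apply Rmult_eq_reg_r with (/ K); [|apply Rgt_not_eq; now apply Rinv_0_lt_compat].
  rewrite Rmult_assoc, Rinv_r, <- X by lra; field; lra. }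
assert (Q1 := Cmod_sqr (1 + z)); assert (Q2 := Cmod_sqr (1 - z)); assert (Q0 := Cmod_sqr z).
rewrite re_plus, im_plus, re_RtoC, im_RtoC in Q1.
rewrite re_minus, im_minus, re_RtoC, im_RtoC in Q2; rewrite Hz in Q0.
assert (Ex : Re z * (1 + K * K) = 1 - K * K).
{ assert (X : K * K * (Cmod (1 + z) * Cmod (1 + z)) = Cmod (1 - z) * Cmod (1 - z))
    by (rewrite <- Em; ring).
  rewrite Q1, Q2 in X; nra. }
set (th := theta c).
assert (Ec : cos th * (1 + K * K) = 1 - K * K).
{ unfold th, theta; fold K; rewrite cos_2a, cos_atan, sin_atan.
  assert (S : sqrt (1 + Rsqr K) * sqrt (1 + Rsqr K) = 1 + K * K)
    by (unfold Rsqr; apply sqrt_sqrt; nra).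
  assert (Sp : 0 < sqrt (1 + Rsqr K)) by (apply sqrt_lt_R0; unfold Rsqr; nra).
  rewrite <- S; unfold Rsqr in *; field_simplify; [|lra]; nra. }
assert (Exc : Re z = cos th) by (apply Rmult_eq_reg_r with (1 + K * K); [lra|nra]).
assert (T := sin2_cos2 th); unfold Rsqr in T.
assert (Ey : (Im z - sin th) * (Im z + sin th) = 0) by (rewrite Exc in Q0; nra).
apply Rmult_integral in Ey; destruct Ey as [Ey|Ey].
- left; apply C_ext; unfold cis; simpl; lra.
- right; apply C_ext; rewrite ?re_conj, ?im_conj; unfold cis; simpl; lra.
Qed.

Lemma theta_point c : 0 < c -> let e := cis (theta c) in
  Cmod e = 1 /\ e <> 1 /\ e <> (-(1))%C /\ 0 < Im e.
Proof.
intros Hc e; destruct (theta_bounds c Hc) as [T1 T2].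
assert (I : 0 < Im e).
{ unfold e, cis; simpl; apply sin_gt_0; generalize PI_RGT_0; lra. }
split; [apply Cmod_cis|split; [|split; [|easy]]];
  intros E; rewrite E in I; simpl in I; lra.
Qed.

(** As long as [Re (gc c)] is nonnegative, [gc c] has no zero on the closed disk, so [/ gc c] itself
    is an admissible solution and has no poles there. The touching point may be the conjugate of
    [cis (theta c)]; [gc_conj] carries the zero over. *)
Lemma ReF_zero_of_touching c : 0 < c -> (forall w, unit_disk w -> 0 <= Re (gc c w)) ->
  ~ gc_positive c -> ReF_zero c.
Proof.
intros Hc Hnn Np.
assert (Ng : forall z, unit_disk z -> gc c z <> 0).
{ intros z Kz E; assert (R0 : Re (gc c z) = 0) by now rewrite E.
  now destruct (touching_point c z Hc Hnn Kz R0) as (_ & _ & N & _). }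
assert (Hz : exists z, unit_disk z /\ Re (gc c z) = 0).
{ apply NNPP; intros N; apply Np; intros z Kz.
  destruct (Hnn z Kz) as [|E]; [easy|exfalso]; apply N; eauto. }
destruct Hz as (z & Kz & Rz).
destruct (touching_point c z Hc Hnn Kz Rz) as (Hz & Sz & _ & HR).
set (e := cis (theta c)).
destruct (theta_point c Hc) as (He & E1 & E2 & _); fold e in He, E1, E2.
assert (Ke : unit_disk e) by (apply unit_disk_Cmod; lra).
assert (Re0 : Re (gc c e) = 0).
{ destruct (Re_rhs_zero_circle c z Hc Hz Sz HR) as [->| ->]; [easy|].
  fold e in Rz; rewrite gc_conj, re_conj in Rz; easy. }
assert (Hol : forall w, slit_plane w -> gc c w <> 0 -> holomorphic_at (fun w => / gc c w)%C w).
{ intros w Sw Nw; apply holomorphic_at_ball.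
  destruct (slit_plane_open w Sw) as (r1 & Hr1 & HB1).
  destruct (cdiff_cts (gc c) w everywhere (gc_cdiff c w Sw) (Cmod (gc c w))) as (r2 & Hr2 & HB2).
  { now apply Cmod_gt_0. }
  exists (Rmin r1 r2); split; [now apply Rmin_pos|]; intros x Hx.
  assert (A1 := Rlt_le_trans _ _ _ Hx (Rmin_l _ _)).
  assert (A2 := HB2 x I (Rlt_le_trans _ _ _ Hx (Rmin_r _ _))).
  eexists; apply (gc_inv_ode c x); [now apply HB1|].
  intros E; rewrite E in A2; replace (0 - gc c w)%C with (- gc c w)%C in A2 by ring.
  rewrite Cmod_opp in A2; lra. }
exists (ray c (fun w => / gc c w)%C 1); split.
- exists (fun w => / gc c w)%C; split; [|split; [|easy]].
  + split; [|split; [|split]].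
    * intros w Hw W1 W2; left; apply Hol.
      { apply slit_plane_circle; auto; intros ->; apply W2, C_ext; simpl; ring. }
      apply Ng; now apply unit_disk_Cmod.
    * apply Hol; [apply slit_plane_star|rewrite gc_0; apply C1_nz].
    * rewrite gc_0; replace (/ 1)%C with (RtoC 1) by field; easy.
    * intros w Dw _ Nw.
      assert (Nw' := Ng w (in_disk_unit_disk w Dw)).
      destruct (gc_inv_ode c w (slit_plane_disk w Dw) Nw') as [Dq Eq].
      rewrite (cder_C_derive _ _ _ Dq); rewrite Eq; field; auto.
  + apply Hol; [now apply circle_slit_plane|now apply Ng].
- unfold ray; rewrite Cmult_1_l; fold e.
  revert Re0; generalize (gc c e); intros g Re0.
  simpl; unfold Re in Re0; rewrite Re0; unfold Rdiv; ring.
Qed.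

Lemma first_touching : exists c0, 0 < c0 /\ (forall c, 0 <= c < c0 -> gc_positive c) /\
  (forall w, unit_disk w -> 0 <= Re (gc c0 w)) /\ ~ gc_positive c0.
Proof.
(* Positivity is demanded on the whole of [[0, c]], so that the supremum is the first parameter of
   failure. *)
set (S := fun c => 0 <= c /\ forall c', 0 <= c' <= c -> gc_positive c').
assert (P0 := PI_RGT_0).
destruct (completeness S) as [c0 [Ub Lb]].
{ exists (32 / PI); intros c [Hc Hp].
  destruct Hc as [Hc|<-]; [|left; apply Rdiv_lt_0_compat; lra].
  assert (X := gc_positive_bounded c Hc (Hp c ltac:(lra))).
  apply Rmult_le_reg_l with PI; [easy|].
  replace (PI * (32 / PI)) with 32 by (field; lra); lra. }
{ exists 0; split; [lra|]; intros c' Hc'; replace c' with 0 by lra; apply gc_positive_0. }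
assert (Below : forall c, 0 <= c < c0 -> gc_positive c).
{ intros c Hc; apply NNPP; intros N.
  assert (c0 <= c); [|lra]; apply Lb; intros x [Hx Hp].
  apply Rnot_lt_le; intros Lt; apply N, Hp; lra. }
assert (Pos0 : 0 < c0).
{ destruct (gc_positive_open 0 gc_positive_0) as (d & Hd & H).
  assert (d / 2 <= c0); [|lra]; apply Ub; split; [lra|]; intros c' Hc'.
  apply H; rewrite Rminus_0_r, Rabs_pos_eq; lra. }
exists c0; split; [easy|split; [easy|split]].
- intros w Kw; apply Rnot_lt_le; intros Neg.
  destruct (gc_jointly_cts c0 w Kw (- Re (gc c0 w)) ltac:(lra)) as (d & Hd & H).
  set (c := Rmax 0 (c0 - d / 2)).
  assert (C1 : c < c0) by (apply Rmax_lub_lt; lra).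
  assert (C2 : 0 <= c) by apply Rmax_l.
  assert (C3 : c0 - d / 2 <= c) by apply Rmax_r.
  assert (X := H (c, w) Kw); unfold dprod in X; cbn [fst snd] in X.
  rewrite dC_self in X; unfold dR in X; rewrite Rabs_left in X by lra.
  specialize (X ltac:(lra)).
  assert (Y := re_le_Cmod (gc c w - gc c0 w)); rewrite re_minus in Y.
  apply Rabs_le_between in Y.
  assert (Z := Below c ltac:(lra) w Kw); lra.
- intros Hp; destruct (gc_positive_open c0 Hp) as (d & Hd & H).
  assert (c0 + d / 2 <= c0); [|lra]; apply Ub; split; [lra|]; intros c' Hc'.
  destruct (Rlt_le_dec c' c0) as [L|L]; [apply Below; lra|].
  apply H; rewrite Rabs_pos_eq; lra.
Qed.

(** * Uniqueness of the meromorphic solution on the ray *)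

(** For [t = 0] the inner condition of the first premise is void, which supplies the start of the
    induction. *)
Lemma real_induction (P : R -> Prop) :
  (forall t, 0 <= t <= 1 -> (forall s, 0 <= s < t -> P s) -> P t) ->
  (forall t, 0 <= t < 1 -> P t -> exists d, 0 < d /\ forall s, t < s < t + d -> P s) ->
  forall t, 0 <= t <= 1 -> P t.
Proof.
intros HL HR t1 Ht1; apply NNPP; intros N.
destruct (completeness (fun x => x <= t1 /\ forall s, 0 <= s <= x -> P s)) as [m [Ub Lb]].
{ exists t1; now intros x [H _]. }
{ exists 0; split; [lra|]; intros s Hs; replace s with 0 by lra.
  apply HL; [lra|]; intros; lra. }
assert (M0 : 0 <= m).
{ apply Ub; split; [lra|]; intros s Hs; replace s with 0 by lra.
  apply HL; [lra|]; intros; lra. }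
assert (M1 : m <= t1) by (apply Lb; now intros x [H _]).
assert (Lt : forall s, 0 <= s < m -> P s).
{ intros s Hs; apply NNPP; intros Ns; assert (m <= s); [|lra].
  apply Lb; intros x [_ Hx]; apply Rnot_lt_le; intros L; apply Ns, Hx; lra. }
assert (Pm : P m) by (apply HL; [lra|easy]).
destruct (Req_dec m t1) as [->|Nm]; [easy|].
destruct (HR m ltac:(lra) Pm) as (d & Hd & H).
set (x := Rmin t1 (m + d / 2)).
assert (X1 : m < x) by (apply Rmin_glb_lt; lra).
assert (X2 : x <= m + d / 2) by apply Rmin_r.
assert (x <= m); [|lra].
apply Ub; split; [apply Rmin_l|]; intros s Hs.
destruct (Rtotal_order s m) as [L|[->|L]]; [apply Lt; lra|easy|apply H; lra].
Qed.

Lemma pole_at_ball q p M : pole_at q p -> exists r, 0 < r /\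
  forall w, w <> p -> Cmod (w - p) < r -> cdiff q w /\ M < Cmod (q w).
Proof.
intros [H1 H2].
assert (H3 : locally' p (fun w => M < Cmod (q w))).
{ apply (H2 (fun y => M < y)); exists M; auto. }
unfold locally', within in H1, H3; apply locally_ball in H1; apply locally_ball in H3.
destruct H1 as (r1 & Hr1 & H1); destruct H3 as (r2 & Hr2 & H3).
exists (Rmin r1 r2); split; [now apply Rmin_pos|]; intros w N Hw; split.
- apply ex_derive_cdiff; apply H1; [|easy]; apply Rlt_le_trans with (1 := Hw), Rmin_l.
- apply H3; [|easy]; apply Rlt_le_trans with (1 := Hw), Rmin_r.
Qed.

Lemma holomorphic_at_near q p r w : Cmod (w - p) < r ->
  (forall x, Cmod (x - p) < r -> cdiff q x) -> holomorphic_at q w.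
Proof.
intros Hw H; apply holomorphic_at_ball; exists (r - Cmod (w - p)); split; [lra|].
intros x Hx; apply H; assert (X := Cmod_sub_triangle x w p); lra.
Qed.

Lemma holomorphic_at_cdiff q p : holomorphic_at q p -> cdiff q p.
Proof.
intros H; apply holomorphic_at_ball in H; destruct H as (r & Hr & H).
apply H; rewrite Cmod_sub_self; lra.
Qed.

Lemma holomorphic_not_pole q p : holomorphic_at q p -> pole_at q p -> False.
Proof.
intros H1 H2.
destruct (cts_eps_bound q p (cdiff_cts _ _ _ (holomorphic_at_cdiff _ _ H1))) as (d & Hd & B).
destruct (pole_at_ball q p (Cmod (q p) + 1) H2) as (r & Hr & X).
set (s := Rmin (d / 2) (r / 2)).
assert (Hs : 0 < s) by (apply Rmin_pos; lra).
assert (S1 : s <= d / 2) by apply Rmin_l; assert (S2 : s <= r / 2) by apply Rmin_r.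
assert (E : (p + RtoC s - p)%C = RtoC s) by ring.
destruct (X (p + RtoC s)%C) as [_ X2].
- intros E'; apply Ceq_minus in E'; rewrite E in E'; apply RtoC_inj in E'; lra.
- rewrite E, Cmod_R, Rabs_pos_eq; lra.
- assert (Y : Cmod (q (p + RtoC s)%C) <= Cmod (q p) + 1); [|lra].
  apply B; rewrite E, Cmod_R, Rabs_pos_eq; lra.
Qed.

Section Ray.
Variables (c : R) (q : C -> C).
Hypotheses (Hc : 0 < c) (Hq : is_q c q).

Let e : C := cis (theta c).
Let K (z : C) : C := (z * cexp (ca c z))%C.
Let Fc (z : C) : C := (K z * gc c z)%C.

Lemma ray_slit_plane t : 0 <= t <= 1 -> slit_plane (RtoC t * e).
Proof.
intros Ht; destruct (theta_point c Hc) as (He & E1 & E2 & _).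
apply star_0_ray; [apply slit_plane_star| |exact Ht].
apply circle_slit_plane; auto.
Qed.

Lemma ray_disk t : 0 <= t < 1 -> in_disk (RtoC t * e).
Proof.
intros Ht; unfold in_disk; rewrite Cmod_mult, Cmod_R, Rabs_pos_eq by lra.
unfold e; rewrite Cmod_cis; lra.
Qed.

Lemma ray_distance s t : Cmod (RtoC s * e - RtoC t * e) = Rabs (s - t).
Proof.
replace (RtoC s * e - RtoC t * e)%C with (RtoC (s - t) * e)%C by (rewrite RtoC_minus; ring).
rewrite Cmod_mult, Cmod_R; unfold e; rewrite Cmod_cis; ring.
Qed.

Lemma ray_K_cder z : slit_plane z -> cder K z (cexp (ca c z) * rhs c z).
Proof.
intros Hz; rewrite <- ca_phi by easy.
assert (D := cdiff_cder _ _ (ca_hol c z Hz)).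
apply (cder_eq _ _ (1 * cexp (ca c z) + z * (cexp (ca c z) * C_derive (ca c) z))%C); [|ring].
apply (cder_mult (fun z => z) (fun z => cexp (ca c z))); [apply cder_id|].
now apply cder_cexp_comp.
Qed.

Lemma ray_F_cder z : slit_plane z -> cder Fc z (cexp (ca c z)).
Proof.
intros Hz; destruct (slit_plane_open z Hz) as (r & Hr & HB).
apply (cder_ext_loc (Iseg (fun w => cexp (ca c w)) 0)) with (r := r); auto.
- intros w Hw; apply (cexp_ray_primitive slit_plane); auto using slit_plane_star, ca_hol.
- apply (cexp_ray_primitive slit_plane); auto using slit_plane_star, ca_hol.
Qed.

(** [K] is an integrating factor: where [q] is regular and nonzero its equation gives [K / q] the
    derivative [cexp (ca c z)], the same as that of [Fc]. So [E] is locally constant, and [E = 0]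
    means [/ q = gc c] away from 0. *)
Let E (z : C) : C := (K z / q z - Fc z)%C.

Lemma ray_E_cder z : in_disk z -> holomorphic_at q z -> q z <> 0 -> cder E z 0.
Proof.
intros Dz Hz Nz; assert (Sz := slit_plane_disk z Dz).
assert (Dq := cdiff_cder _ _ (holomorphic_at_cdiff _ _ Hz)).
destruct Hq as (_ & _ & _ & Ode); specialize (Ode z Dz Hz Nz).
set (q' := C_derive q z) in *.
apply (cder_eq _ _ ((cexp (ca c z) * rhs c z * q z - K z * q') / (q z * q z) - cexp (ca c z))%C).
- apply cder_minus; [|now apply ray_F_cder].
  apply cder_div; auto using ray_K_cder.
- rewrite <- Ode; unfold K; field; auto.
Qed.

Lemma ray_K_neq t : 0 < t -> K (RtoC t * e) <> 0.
Proof.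
intros Ht; unfold K; apply Cmult_neq_0; [|apply cexp_neq_0].
apply Cmod_gt_0; rewrite Cmod_mult, Cmod_R, Rabs_pos_eq by lra.
unfold e; rewrite Cmod_cis; lra.
Qed.

Lemma ray_E_const t1 t2 : 0 <= t1 <= t2 -> t2 < 1 ->
  (forall t, t1 <= t <= t2 -> holomorphic_at q (RtoC t * e) /\ q (RtoC t * e)%C <> 0) ->
  E (RtoC t2 * e)%C = E (RtoC t1 * e)%C.
Proof.
intros H1 H2 Ht.
apply (rder_zero_const t1 t2 (fun t => E (RtoC t * e)%C)); [lra|].
intros t T; destruct (Ht t T) as [A1 A2].
apply (rder_eq _ _ (0 * e)%C); [|ring].
apply (rder_comp E (fun t => RtoC t * e)%C); [|apply rder_ray].
apply ray_E_cder; auto; apply ray_disk; unfold in_itv in T; lra.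
Qed.

(** The relation [/ q = gc c] in a form that survives poles. At a regular point it is stated without
    division, together with [q <> 0]; at a pole, where the value of [q] is arbitrary, it becomes
    [Fc = 0]. *)
Let P (t : R) : Prop :=
  (holomorphic_at q (RtoC t * e) ->
     q (RtoC t * e)%C <> 0 /\ K (RtoC t * e)%C = (q (RtoC t * e) * Fc (RtoC t * e))%C) /\
  (pole_at q (RtoC t * e) -> Fc (RtoC t * e)%C = 0).

(** At a regular point the identity [K = q Fc] passes to the limit, and [K <> 0] forces [q <> 0]. At
    a pole [K = q Fc] stays bounded while [q] blows up, so [Fc] tends to 0. *)
Lemma ray_P_left t : 0 <= t <= 1 -> (forall s, 0 <= s < t -> P s) -> P t.
Proof.
intros Ht Hs; set (z := (RtoC t * e)%C).
destruct (proj1 Ht) as [Pt|<-].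
2:{ assert (z0 : z = 0) by (unfold z; ring).
  unfold P; fold z; rewrite z0; unfold Fc, K; split; [intros _|intros; ring].
  destruct Hq as (_ & _ & -> & _); split; [apply C1_nz|ring]. }
assert (Sz := ray_slit_plane t Ht); fold z in Sz.
assert (CK : cts dC everywhere K z) by (eapply cder_cts, ray_K_cder; auto).
assert (CF : cts dC everywhere Fc z) by (eapply cder_cts, ray_F_cder; auto).
split; fold z.
- intros Hz.
  assert (Hz' := Hz); apply holomorphic_at_ball in Hz'; destruct Hz' as (r & Hr & HB).
  assert (Eq : (K z - q z * Fc z)%C = 0).
  { apply small_multiples_zero with 1; intros eps Heps.
    assert (Ch : cts dC everywhere (fun w => K w - q w * Fc w)%C z).
    { apply cts_minus; [easy|]; apply cts_mult; [|easy].
      apply cdiff_cts; now apply holomorphic_at_cdiff. }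
    destruct (Ch eps ltac:(lra)) as (d & Hd & HC).
    set (s := Rmax (t / 2) (Rmax (t - r / 2) (t - d / 2))).
    assert (S1 : s < t) by (repeat apply Rmax_lub_lt; lra).
    assert (S2 : t / 2 <= s) by apply Rmax_l.
    assert (S3 : t - r / 2 <= s) by (eapply Rle_trans; [|apply Rmax_r]; apply Rmax_l).
    assert (S4 : t - d / 2 <= s) by (eapply Rle_trans; [|apply Rmax_r]; apply Rmax_r).
    assert (Ds : Cmod (RtoC s * e - z) = t - s)
      by (unfold z; rewrite ray_distance, Rabs_minus_sym, Rabs_pos_eq; lra).
    destruct (Hs s ltac:(lra)) as [Hp _].
    destruct Hp as [_ Ks]; [apply (holomorphic_at_near q z r); auto; lra|].
    assert (X := HC (RtoC s * e)%C I); cbv beta in X; unfold dC in X; rewrite Ds in X.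
    specialize (X ltac:(lra)); rewrite Ks in X.
    replace (_ - _ - _)%C with (- (K z - q z * Fc z))%C in X by ring.
    rewrite Cmod_opp in X; lra. }
  apply Ceq_minus in Eq; split; [|easy].
  intros E0; apply (ray_K_neq t Pt); fold z; rewrite Eq, E0; ring.
- intros Hz; destruct (Ceq_dec (Fc z) 0) as [|NF]; [easy|exfalso].
  assert (Pm := proj1 (Cmod_gt_0 _) NF); set (mu := Cmod (Fc z)) in *.
  destruct (cts_eps_bound K z CK) as (d1 & D1 & B1).
  destruct (CF (mu / 2) ltac:(lra)) as (d2 & D2 & B2).
  assert (PK := Cmod_ge_0 (K z)).
  destruct (pole_at_ball q z (2 * (Cmod (K z) + 1) / mu) Hz) as (r & Hr & HB).
  set (s := Rmax (Rmax (t / 2) (t - r / 2)) (Rmax (t - d1 / 2) (t - d2 / 2))).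
  assert (S1 : s < t) by (repeat apply Rmax_lub_lt; lra).
  assert (S2 : t / 2 <= s) by (eapply Rle_trans; [|apply Rmax_l]; apply Rmax_l).
  assert (S3 : t - r / 2 <= s) by (eapply Rle_trans; [|apply Rmax_l]; apply Rmax_r).
  assert (S4 : t - d1 / 2 <= s) by (eapply Rle_trans; [|apply Rmax_r]; apply Rmax_l).
  assert (S5 : t - d2 / 2 <= s) by (eapply Rle_trans; [|apply Rmax_r]; apply Rmax_r).
  set (w := (RtoC s * e)%C).
  assert (Ds : Cmod (w - z) = t - s)
    by (unfold w, z; rewrite ray_distance, Rabs_minus_sym, Rabs_pos_eq; lra).
  assert (Nw : w <> z) by (intros E0; rewrite E0, Cmod_sub_self in Ds; lra).
  assert (Hw : holomorphic_at q w).
  { apply holomorphic_at_ball; exists (Rmin (t - s) (r / 2)); split; [apply Rmin_pos; lra|].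
    intros x Hx; assert (X1 := Rlt_le_trans _ _ _ Hx (Rmin_l _ _)).
    assert (X2 := Rlt_le_trans _ _ _ Hx (Rmin_r _ _)).
    apply HB.
    - intros ->; rewrite Cmod_sub_sym in X1; lra.
    - assert (X := Cmod_sub_triangle x w z); lra. }
  destruct (proj1 (Hs s ltac:(lra)) Hw) as [_ Ks]; fold w in Ks.
  destruct (HB w Nw ltac:(lra)) as [_ Big].
  assert (Y1 := B1 w ltac:(lra)); assert (Y2 := B2 w I); unfold dC in Y2.
  specialize (Y2 ltac:(lra)).
  assert (Y3 := Cmod_sub_le (Fc z) (Fc w)); rewrite (Cmod_sub_sym (Fc z)) in Y3; fold mu in Y3.
  rewrite Ks, Cmod_mult in Y1.
  assert (Z : 2 * (Cmod (K z) + 1) / mu * (mu / 2) = Cmod (K z) + 1) by (field; lra).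
  assert (Zp : 0 < 2 * (Cmod (K z) + 1) / mu) by (apply Rdiv_lt_0_compat; lra).
  assert (2 * (Cmod (K z) + 1) / mu * (mu / 2) < Cmod (q w) * Cmod (Fc w)); [|lra].
  apply Rmult_le_0_lt_compat; lra.
Qed.

(** To the right of a regular point [E] keeps its value 0. To the right of a pole [E] is constant on
    a short open interval, and its limit at the pole is 0 because both [K / q] and [Fc] tend to
    0. *)
Lemma ray_P_right t : 0 <= t < 1 -> P t -> exists d, 0 < d /\ forall s, t < s < t + d -> P s.
Proof.
intros Ht [P1 P2]; set (z := (RtoC t * e)%C) in *.
assert (Dz := ray_disk t Ht); fold z in Dz; assert (Sz := slit_plane_disk z Dz).
assert (Mer : meromorphic_at q z).
{ destruct Hq as (M & _); unfold in_disk in Dz; apply M; [lra| |];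
    intros E0; rewrite E0 in Dz.
  - rewrite Cmod_1 in Dz; lra.
  - rewrite Cmod_R, Rabs_left in Dz by lra; lra. }
destruct Mer as [Hz|Hz].
- destruct (P1 Hz) as [Nq Kq].
  assert (Hz' := Hz); apply holomorphic_at_ball in Hz'; destruct Hz' as (r & Hr & HB).
  destruct (cdiff_cts q z everywhere (holomorphic_at_cdiff _ _ Hz) (Cmod (q z))) as (d & Hd & HC).
  { now apply Cmod_gt_0. }
  set (k := Rmin (Rmin r d) (1 - t)).
  assert (Hk : 0 < k) by (repeat apply Rmin_pos; lra).
  assert (K1 : k <= r) by (eapply Rle_trans; [apply Rmin_l|apply Rmin_l]).
  assert (K2 : k <= d) by (eapply Rle_trans; [apply Rmin_l|apply Rmin_r]).
  assert (K3 : k <= 1 - t) by apply Rmin_r.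
  assert (Good : forall x, t <= x < t + k ->
    holomorphic_at q (RtoC x * e) /\ q (RtoC x * e)%C <> 0).
  { intros x Hx.
    assert (Dx : Cmod (RtoC x * e - z) = x - t) by (unfold z; rewrite ray_distance, Rabs_pos_eq; lra).
    split; [apply (holomorphic_at_near q z r); auto; lra|].
    intros E0; assert (X := HC (RtoC x * e)%C I); unfold dC in X; rewrite Dx, E0 in X.
    specialize (X ltac:(lra)); replace (0 - q z)%C with (- q z)%C in X by ring.
    rewrite Cmod_opp in X; lra. }
  exists k; split; [easy|]; intros s Hs; destruct (Good s ltac:(lra)) as [G1 G2]; split.
  + intros _; split; [easy|].
    assert (X := ray_E_const t s ltac:(lra) ltac:(lra) (fun x Hx => Good x ltac:(lra))).
    fold z in X; unfold E at 2 in X; rewrite Kq in X.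
    replace (q z * Fc z / q z - Fc z)%C with (RtoC 0) in X by (field; auto).
    unfold E in X; apply Ceq_minus in X; rewrite <- X; field; auto.
  + intros Hp; exfalso; now apply (holomorphic_not_pole q (RtoC s * e)).
- assert (F0 := P2 Hz).
  destruct (pole_at_ball q z 1 Hz) as (r & Hr & HB).
  set (k := Rmin r (1 - t)).
  assert (Hk : 0 < k) by (apply Rmin_pos; lra).
  assert (K1 : k <= r) by apply Rmin_l.
  assert (K3 : k <= 1 - t) by apply Rmin_r.
  assert (Dx : forall x, t < x < t + k -> Cmod (RtoC x * e - z) = x - t /\ (RtoC x * e)%C <> z).
  { intros x Hx; assert (X : Cmod (RtoC x * e - z) = x - t)
      by (unfold z; rewrite ray_distance, Rabs_pos_eq; lra).
    split; [easy|]; intros E0; rewrite E0, Cmod_sub_self in X; lra. }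
  assert (Good : forall x, t < x < t + k ->
    holomorphic_at q (RtoC x * e) /\ q (RtoC x * e)%C <> 0).
  { intros x Hx; destruct (Dx x Hx) as [D1 D2]; split.
    - apply holomorphic_at_ball; exists (Rmin (x - t) (t + k - x)); split; [apply Rmin_pos; lra|].
      intros y Hy; assert (X1 := Rlt_le_trans _ _ _ Hy (Rmin_l _ _)).
      assert (X2 := Rlt_le_trans _ _ _ Hy (Rmin_r _ _)).
      apply HB.
      + intros ->; rewrite Cmod_sub_sym in X1; lra.
      + assert (X := Cmod_sub_triangle y (RtoC x * e) z); lra.
    - destruct (HB _ D2 ltac:(lra)) as [_ B]; apply Cmod_gt_0; lra. }
  exists k; split; [easy|]; intros s Hs; destruct (Good s ltac:(lra)) as [G1 G2]; split.
  2:{ intros Hp; exfalso; now apply (holomorphic_not_pole q (RtoC s * e)). }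
  intros _; split; [easy|].
  assert (E0 : E (RtoC s * e)%C = 0).
  { apply small_multiples_zero with 1; intros eps Heps.
    assert (CK : cts dC everywhere K z) by (eapply cder_cts, ray_K_cder; auto).
    assert (CF : cts dC everywhere Fc z) by (eapply cder_cts, ray_F_cder; auto).
    destruct (cts_eps_bound K z CK) as (d1 & D1 & B1).
    destruct (CF (eps / 2) ltac:(lra)) as (d2 & D2 & B2).
    assert (PK := Cmod_ge_0 (K z)).
    destruct (pole_at_ball q z (2 * (Cmod (K z) + 1) / eps) Hz) as (r2 & Hr2 & HB2).
    set (x := Rmin s (t + Rmin (Rmin (d1 / 2) (d2 / 2)) (r2 / 2))).
    assert (Hm : 0 < Rmin (Rmin (d1 / 2) (d2 / 2)) (r2 / 2)) by (repeat apply Rmin_pos; lra).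
    assert (X0 : t < x) by (apply Rmin_glb_lt; lra).
    assert (X1 : x <= s) by apply Rmin_l.
    assert (X2 : x <= t + Rmin (Rmin (d1 / 2) (d2 / 2)) (r2 / 2)) by apply Rmin_r.
    assert (M1 := Rmin_l (Rmin (d1 / 2) (d2 / 2)) (r2 / 2)).
    assert (M2 := Rmin_r (Rmin (d1 / 2) (d2 / 2)) (r2 / 2)).
    assert (M3 := Rmin_l (d1 / 2) (d2 / 2)); assert (M4 := Rmin_r (d1 / 2) (d2 / 2)).
    rewrite (ray_E_const x s); [|lra|lra|intros y Hy; apply Good; lra].
    set (w := (RtoC x * e)%C).
    destruct (Dx x ltac:(lra)) as [Y1 Y2]; fold w in Y1, Y2.
    destruct (Good x ltac:(lra)) as [_ Nq]; fold w in Nq.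
    destruct (HB2 w Y2 ltac:(lra)) as [_ Big].
    assert (Z1 := B1 w ltac:(lra)); assert (Z2 := B2 w I); unfold dC in Z2.
    specialize (Z2 ltac:(lra)); rewrite F0 in Z2.
    replace (Fc w - 0)%C with (Fc w) in Z2 by ring.
    unfold E; apply Rle_trans with (1 := Cmod_sub_le_sum _ _).
    rewrite Cmod_div by easy.
    assert (Pq := proj1 (Cmod_gt_0 _) Nq).
    assert (Cmod (K w) / Cmod (q w) <= eps / 2); [|lra].
    apply Rmult_le_reg_r with (Cmod (q w)); [easy|].
    unfold Rdiv at 1; rewrite Rmult_assoc, Rinv_l, Rmult_1_r by lra.
    apply Rle_trans with (1 := Z1).
    replace (Cmod (K z) + 1) with (eps / 2 * (2 * (Cmod (K z) + 1) / eps)) by (field; lra).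
    apply Rmult_le_compat_l; lra. }
  unfold E in E0; apply Ceq_minus in E0; rewrite <- E0; field; auto.
Qed.

Lemma ray_inverse : holomorphic_at q e -> (q e * gc c e)%C = 1.
Proof.
intros He.
assert (E1 : (RtoC 1 * e)%C = e) by ring.
destruct (real_induction P ray_P_left ray_P_right 1 ltac:(lra)) as [H _].
rewrite E1 in H; destruct (H He) as [Nq Kq].
assert (NK := ray_K_neq 1 ltac:(lra)); rewrite E1 in NK.
unfold Fc in Kq; set (k := K e) in *.
replace (q e * gc c e)%C with (q e * (k * gc c e) / k)%C by (field; auto).
rewrite <- Kq; field; auto.
Qed.

End Ray.

(** By [ray_inverse] every admissible value [w] satisfies [w gc = 1], and the reciprocal of a
    nonzero purely imaginary number is purely imaginary. *)
Lemma ReF_zero_gc c : 0 < c -> ReF_zero c ->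
  Re (gc c (cis (theta c))) = 0 /\ gc c (cis (theta c)) <> 0.
Proof.
intros Hc (w & (q & Hq & He & Ew) & Rw).
assert (H := ray_inverse c q Hc Hq He).
unfold ray in Ew; rewrite Cmult_1_l in Ew; rewrite <- Ew in H.
set (g := gc c (cis (theta c))) in *.
assert (Ng : g <> 0) by (intros E; rewrite E, Cmult_0_r in H; now apply C1_nz).
split; [|easy].
assert (H1 := f_equal Re H); assert (H2 := f_equal Im H).
rewrite re_mult, Rw, re_RtoC in H1; rewrite im_mult, Rw, im_RtoC in H2.
assert (X : Im w * Re g = 0) by lra.
apply Rmult_integral in X; destruct X as [X|]; [rewrite X in H1; lra|easy].
Qed.

(** * Sharpness *)

Lemma CInt_dominated a b f (phi Phi : R -> R) : a <= b -> rcts a b f ->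
  rcts a b (fun t => RtoC (phi t)) -> (forall t, in_itv a b t -> is_derive Phi t (phi t)) ->
  (forall t, in_itv a b t -> Cmod (f t) <= phi t) -> Cmod (CInt f a b) <= Phi b - Phi a.
Proof.
intros Hab Hf Hphi HPhi Hle.
destruct (rotation (CInt f a b)) as (u & Hu & E).
assert (Hs := rcts_scal a b u f Hf).
rewrite <- CInt_scal in E by easy.
apply (f_equal Re) in E; rewrite re_RtoC in E; rewrite <- E.
assert (EP := CInt_ftc a b (fun t => RtoC (Phi t)) (fun t => RtoC (phi t)) Hab
  (fun t Ht => rder_RtoC Phi t (phi t) (HPhi t Ht)) Hphi).
apply (f_equal Re) in EP; rewrite re_minus, !re_RtoC in EP; rewrite <- EP.
simpl; apply RInt_le; auto.
- now apply rcts_ex_RInt in Hs.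
- now apply rcts_ex_RInt in Hphi.
- intros x Hx; change (Re (u * f x) <= phi x).
  apply Rle_trans with (1 := Re_le_Cmod _).
  rewrite Cmod_mult, Hu, Rmult_1_l; apply Hle; unfold in_itv; lra.
Qed.

Lemma G_cts a z : (forall w, unit_disk w -> cts dC unit_disk a w) -> unit_disk z ->
  cts dC unit_disk (G a) z.
Proof.
intros Ha Hz.
apply (CInt_param_cts dC unit_disk (fun w t => cexp (a (RtoC t * w)%C - a w)) 0 1 z);
  auto using distance_dC; [lra|]; clear z Hz; intros z t Hz Ht.
set (S := fun x : R * C => in_itv 0 1 (fst x) /\ unit_disk (snd x)).
assert (C1 : cts (dprod dR dC) S (fun x => RtoC (fst x)) (t, z)).
{ apply (cts_fst dR dC distance_dC S everywhere (fun s => RtoC s)); [easy|apply cts_RtoC]. }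
assert (C2 : cts (dprod dR dC) S (fun x => snd x) (t, z)).
{ apply (cts_snd dR dC distance_dR S everywhere (fun w => w)); [easy|apply cts_id]. }
apply cts_cexp, cts_minus.
- apply (cts_comp _ S unit_disk a (fun x => (RtoC (fst x) * snd x)%C)).
  + intros x [H1 H2]; now apply unit_disk_ray.
  + now apply cts_mult.
  + apply Ha; now apply unit_disk_ray.
- apply (cts_comp _ S unit_disk a (fun x => snd x)); auto; now intros x [_ H].
Qed.

Lemma cder_pow k z n : cder (fun w => (k * w) ^ S n)%C z (INR (S n) * (k * (k * z) ^ n))%C.
Proof.
induction n as [|n IH].
- apply (cder_ext_loc (fun w => k * w)%C) with (r := 1); [lra|intros; simpl; ring|].
  apply (cder_eq _ _ (k * 1)%C); [apply cder_scal, cder_id|simpl; ring].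
- apply (cder_eq _ _ (k * 1 * (k * z) ^ S n + (k * z) * (INR (S n) * (k * (k * z) ^ n)))%C).
  + apply (cder_mult (fun w => k * w)%C (fun w => (k * w) ^ S n)%C); [|exact IH].
    apply cder_scal, cder_id.
  + rewrite (S_INR (S n)), RtoC_plus, (Cpow_S (k * z) n); ring.
Qed.

(** Starlikeness forces [Re (G a) >= 0] in the open disk; continuity up to the circle extends this
    to the boundary point [e]. *)
Lemma Re_neg_not_starlike (a f : C -> C) : a 0 = 0 -> hol in_disk a -> class_A1 f ->
  (forall z, in_disk z -> C_derive f z = cexp (a z) /\ f z = (z * cexp (a z) * G a z)%C) ->
  (forall w, unit_disk w -> cts dC unit_disk a w) ->
  forall e, Cmod e = 1 -> Re (G a e) < 0 -> ~ starlike f.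
Proof.
intros a0 Ha Cf Hfa Ca e He Neg Sf.
assert (Nn := Re_G_nonneg_of_starlike f a Cf Hfa Sf).
assert (Ke : unit_disk e) by (apply unit_disk_Cmod; lra).
destruct (G_cts a e Ca Ke (- Re (G a e)) ltac:(lra)) as (d & Hd & H).
set (t := Rmax (1 / 2) (1 - d / 2)).
assert (T1 : t < 1) by (apply Rmax_lub_lt; lra).
assert (T2 : 1 / 2 <= t) by apply Rmax_l.
assert (T3 : 1 - d / 2 <= t) by apply Rmax_r.
assert (Dt : in_disk (RtoC t * e)).
{ unfold in_disk; rewrite Cmod_mult, Cmod_R, He, Rabs_pos_eq; lra. }
assert (X := H _ (in_disk_unit_disk _ Dt)); unfold dC in X.
replace (RtoC t * e - e)%C with (RtoC (t - 1) * e)%C in X by (rewrite RtoC_minus; ring).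
rewrite (Cmod_mult (RtoC (t - 1))), Cmod_R, He, Rabs_minus_sym, Rabs_pos_eq in X by lra.
specialize (X ltac:(lra)).
assert (Y := re_le_Cmod (G a (RtoC t * e) - G a e)); rewrite re_minus in Y.
apply Rabs_le_between in Y; assert (Z := Nn _ Dt); lra.
Qed.

(* Adding the small multiple [i sigma (z / e)^N] of a monomial of high degree to
   the exponent moves [G] at [e] by about [- sigma * i * gc c e]. *)
Lemma not_starlike_beyond c gam : 0 < c -> Re (gc c (cis (theta c))) = 0 ->
  gc c (cis (theta c)) <> 0 -> PI * c / 4 < gam ->
  exists f, class_A1 f /\ phi_maps_into f gam /\ ~ starlike f.
Proof.
intros Hc R0 Ng Hgam.
destruct (theta_point c Hc) as (He & E1 & E2 & _).
set (e := cis (theta c)) in *.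
assert (Ke : unit_disk e) by (apply unit_disk_Cmod; lra).
set (b := Im (gc c e)).
assert (Eg : gc c e = (Ci * RtoC b)%C) by (apply C_ext;
  [rewrite R0, re_mult, re_RtoC, im_RtoC|change (Im (gc c e)) with b; rewrite im_mult, re_RtoC, im_RtoC];
  simpl; ring).
assert (Nb : b <> 0) by (intros E; apply Ng; rewrite Eg, E; ring).
assert (Pb := Rabs_pos_lt b Nb).
assert (Cca : forall w, unit_disk w -> cts dC unit_disk (ca c) w)
  by (intros w Hw; apply cts_scal; now apply chi2_cts).
set (k := fun t => cexp (ca c (RtoC t * e)%C - ca c e)).
assert (Hk : rcts 0 1 k) by now apply gc_rcts.
destruct (compact_max unit_disk (ca c) (cdisk_compact 0 1) (ex_intro _ e Ke) Cca)
  as (z0 & K0 & Hmax).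
set (M := exp (Re (ca c z0) - Re (ca c e))).
assert (PM : 0 < M) by apply exp_pos.
assert (HM : forall t, in_itv 0 1 t -> Cmod (k t) <= M).
{ intros t Ht; unfold k; rewrite Cmod_cexp, re_minus.
  assert (X := Hmax _ (unit_disk_ray e t Ke Ht)).
  destruct (Req_dec (Re (ca c (RtoC t * e))) (Re (ca c z0))) as [->|N]; [unfold M; lra|].
  left; apply exp_increasing; lra. }
(* The degree makes [M / (N + 1)], a bound for the moment [T] of [k] against [t ^ N], at most half
   of [|b|]. The first-order change of [Re (G a e)] is [s b - s Im T], so its first term
   prevails. *)
destruct (INR_unbounded (2 * M / Rabs b)) as [n Hn].
set (N := S n); set (rN := INR N).
assert (PN : 1 <= rN) by (unfold rN, N; rewrite S_INR; generalize (pos_INR n); lra).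
assert (HN : M / (rN + 1) <= Rabs b / 2).
{ unfold rN, N; rewrite S_INR in *; assert (P := pos_INR n).
  apply Rmult_le_reg_r with (2 * (INR n + 1 + 1)); [lra|].
  replace (M / (INR n + 1 + 1) * (2 * (INR n + 1 + 1))) with (2 * M) by (field; lra).
  assert (X : 2 * M / Rabs b * Rabs b = 2 * M) by (field; lra).
  nra. }
set (T := CInt (fun t => k t * RtoC (t ^ N))%C 0 1).
assert (CtN : rcts 0 1 (fun t => RtoC (t ^ N))).
{ intros t _; apply cts_ext with (f := fun s => (RtoC s ^ N)%C);
    [intros; now rewrite RtoC_pow|now rewrite RtoC_pow|].
  apply cts_pow, cts_RtoC. }
assert (HT : Cmod T <= Rabs b / 2).
{ apply Rle_trans with (2 := HN).
  replace (M / (rN + 1)) with (M * 1 ^ S N / (rN + 1) - M * 0 ^ S N / (rN + 1)).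
  2:{ rewrite pow1, pow_i by lia; field; lra. }
  apply (CInt_dominated 0 1 _ (fun t => M * t ^ N) (fun t => M * t ^ S N / (rN + 1))).
  - lra.
  - now apply rcts_mult.
  - intros t Ht; apply cts_ext with (f := fun s => (RtoC M * RtoC (s ^ N))%C);
      [intros; now rewrite RtoC_mult|now rewrite RtoC_mult|].
    apply cts_scal; now apply CtN.
  - intros t _; auto_derive; auto.
    (* The form that [INR (S n)] takes after [auto_derive]. *)
    change (match n with O => 1 | S _ => INR n + 1 end) with rN.
    simpl; field; lra.
  - intros t Ht; assert (P := pow_le t N (proj1 Ht)).
    rewrite Cmod_mult, Cmod_R, Rabs_pos_eq by easy.
    apply Rmult_le_compat_r; auto. }
(* The number [d] will be [|s| N], a bound for the change of [Im phi], so it must fit in the gap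
   [gam - PI c / 4]. The second bound keeps the quadratic error [3 M s^2] below [|s b| / 4], and the
   third allows the Taylor estimate. *)
set (d := Rmin (gam - PI * c / 4) (Rmin (Rabs b / (12 * M)) 1)).
assert (Pd : 0 < d).
{ repeat apply Rmin_pos; try lra; apply Rdiv_lt_0_compat; lra. }
assert (D1 : d <= gam - PI * c / 4) by apply Rmin_l.
assert (D2 : d <= Rabs b / (12 * M)) by (eapply Rle_trans; [apply Rmin_r|apply Rmin_l]).
assert (D3 : d <= 1) by (eapply Rle_trans; [apply Rmin_r|apply Rmin_r]).
assert (D4 : d * (12 * M) <= Rabs b).
{ apply Rle_trans with (Rabs b / (12 * M) * (12 * M)); [|right; field; lra].
  apply Rmult_le_compat_r; lra. }
(* The sign of [s] is opposite to that of [b]. Altogether [Re (G a e)] is at most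
   [- |s b| + |s b| / 2 + |s b| / 4], which is negative. *)
assert (Hs : exists s, Rabs s = d / rN /\ s * b = - (d / rN * Rabs b)).
{ assert (P : 0 < d / rN) by (apply Rdiv_lt_0_compat; lra).
  unfold Rabs at 2; destruct (Rcase_abs b).
  - exists (d / rN); rewrite Rabs_pos_eq by lra; split; [easy|ring].
  - exists (- (d / rN)); rewrite Rabs_Ropp, Rabs_pos_eq by lra; split; [easy|ring]. }
destruct Hs as (s & As & Sb).
assert (Ps : 0 < Rabs s <= d).
{ rewrite As; split; [apply Rdiv_lt_0_compat; lra|].
  apply Rmult_le_reg_r with rN; [lra|]; unfold Rdiv; rewrite Rmult_assoc, Rinv_l by lra; nra. }
assert (As' : Rabs (s * rN) = d).
{ rewrite Rabs_mult, As, (Rabs_pos_eq rN) by lra; field; lra. }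
(* As [|e| = 1], this is [1 / e]: the monomial [(x z) ^ N] equals [t ^ N] at [z = t e]. *)
set (x := Cconj e).
assert (Xe : (x * e)%C = 1).
{ unfold x; rewrite Cmult_comm, <- Cmod2_conj, He, pow1; easy. }
assert (Mx : Cmod x = 1) by (unfold x; now rewrite Cmod_conj).
set (a := fun z => (ca c z + Ci * RtoC s * (x * z) ^ N)%C).
assert (a0 : a 0 = 0).
{ unfold a, N; rewrite ca_0, Cmult_0_r, Cpow_S; ring. }
assert (Da : forall z, slit_plane z ->
  cder a z (RtoC c * kappa z + Ci * RtoC s * (RtoC rN * (x * (x * z) ^ n)))%C).
{ intros z Hz; apply cder_plus; [now apply ca_cder|]; apply cder_scal, cder_pow. }
assert (Ha : hol in_disk a) by (intros z Hz; eexists; now apply Da, slit_plane_disk).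
assert (Ca : forall w, unit_disk w -> cts dC unit_disk a w).
{ intros w Hw; apply cts_plus; [auto|]; apply cts_scal, cts_pow, cts_scal, cts_id. }
destruct (class_build a a0 Ha) as (f & Cf & Hfa).
exists f; split; [easy|split].
- intros z Dz; destruct (Hfa z Dz) as (F1 & _ & F3).
  assert (Sz := slit_plane_disk z Dz).
  split; [rewrite F1; apply cexp_neq_0|].
  unfold W; rewrite F3, (cder_C_derive _ _ _ (Da z Sz)).
  replace (1 + z * (RtoC c * kappa z + Ci * RtoC s * (RtoC rN * (x * (x * z) ^ n))))%C
    with (rhs c z + Ci * (RtoC (s * rN) * (x * z) ^ N))%C.
  2:{ rewrite rhs_artanh, artanh_kappa, RtoC_mult; unfold N; rewrite Cpow_S; ring. }
  rewrite im_plus, Im_rhs.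
  assert (SA := artanh_strip z Dz); unfold strip in SA.
  apply Rle_lt_trans with (1 := Rabs_triang _ _).
  rewrite Rabs_mult, (Rabs_pos_eq c) by lra.
  assert (X := im_le_Cmod (Ci * (RtoC (s * rN) * (x * z) ^ N))).
  rewrite !Cmod_mult, Cmod_Ci, Cmod_R, As', Cmod_pow, Cmod_mult, Mx in X.
  assert (Y : (1 * Cmod z) ^ N <= 1).
  { rewrite Rmult_1_l, <- (pow1 N); apply pow_incr; split; [apply Cmod_ge_0|now left]. }
  assert (Y0 : 0 <= (1 * Cmod z) ^ N).
  { apply pow_le; generalize (Cmod_ge_0 z); lra. }
  nra.
- apply (Re_neg_not_starlike a f a0 Ha Cf) with (e := e); auto.
  { intros z Dz; destruct (Hfa z Dz) as (F1 & F2 & _); auto. }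
  set (eta := fun t => (Ci * RtoC s * (RtoC (t ^ N) - 1))%C).
  assert (Ceta : rcts 0 1 eta).
  { apply rcts_scal, rcts_minus; [easy|apply rcts_const]. }
  assert (EG : G a e = CInt (fun t => k t * cexp (eta t))%C 0 1).
  { unfold G; apply CInt_ext; [lra|]; intros t Ht; unfold k; rewrite <- cexp_plus; f_equal.
    unfold a, eta.
    replace (x * (RtoC t * e))%C with (RtoC t * (x * e))%C by ring.
    rewrite Xe, Cmult_1_r, RtoC_pow, Cpow_1_l; ring. }
  assert (Lin : CInt (fun t => k t * (1 + eta t))%C 0 1
    = (gc c e + Ci * RtoC s * (T - gc c e))%C).
  { assert (X : gc c e = CInt k 0 1) by reflexivity.
    rewrite X; unfold T.
    rewrite <- CInt_minus; [|lra|now apply rcts_mult|easy].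
    rewrite <- CInt_scal; [|lra|apply rcts_minus; [now apply rcts_mult|easy]].
    rewrite <- CInt_plus; [|lra|easy|].
    - apply CInt_ext; [lra|]; intros t _; unfold eta; ring.
    - apply rcts_scal, rcts_minus; [now apply rcts_mult|easy]. }
  assert (C1e : rcts 0 1 (fun t => k t * cexp (eta t))%C).
  { apply rcts_mult; [easy|]; intros t Ht; apply cts_cexp; now apply Ceta. }
  assert (C2e : rcts 0 1 (fun t => k t * (1 + eta t))%C).
  { apply rcts_mult; [easy|]; intros t Ht; apply cts_plus; [apply cts_const|now apply Ceta]. }
  assert (Err : Cmod (G a e - (gc c e + Ci * RtoC s * (T - gc c e))) <= 3 * M * (Rabs s * Rabs s)).
  { rewrite EG, <- Lin, <- CInt_minus by (auto; lra).
    replace (3 * M * (Rabs s * Rabs s)) with (3 * M * (Rabs s * Rabs s) * (1 - 0)) by ring.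
    apply CInt_bound; [lra|now apply rcts_minus|]; intros t Ht.
    replace (k t * cexp (eta t) - k t * (1 + eta t))%C
      with (k t * (cexp (eta t) - 1 - eta t))%C by ring.
    assert (Me : Cmod (eta t) <= Rabs s).
    { unfold eta; rewrite !Cmod_mult, Cmod_Ci, <- RtoC_minus, !Cmod_R.
      assert (Q1 := pow_le t N (proj1 Ht)).
      assert (Q2 : t ^ N <= 1) by (rewrite <- (pow1 N); apply pow_incr; exact Ht).
      rewrite (Rabs_left1 (t ^ N - 1)) by lra; nra. }
    assert (Tay := cexp_taylor (eta t) ltac:(lra)).
    rewrite Cmod_mult; apply Rle_trans with (M * (3 * (Rabs s * Rabs s))); [|right; ring].
    apply Rmult_le_compat; auto using Cmod_ge_0.
    apply Rle_trans with (1 := Tay), Rmult_le_compat_l; [lra|].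
    apply Rmult_le_compat; auto using Cmod_ge_0. }
  assert (Re1 : Re (gc c e + Ci * RtoC s * (T - gc c e)) = s * b - s * Im T).
  { rewrite Eg; simpl; unfold Re, Im; ring. }
  assert (Y := re_le_Cmod (G a e - (gc c e + Ci * RtoC s * (T - gc c e)))).
  rewrite re_minus, Re1 in Y; apply Rabs_le_between in Y.
  assert (Z : - (s * Im T) <= Rabs s * (Rabs b / 2)).
  { apply Rle_trans with (Rabs (- (s * Im T))); [apply Rle_abs|].
    rewrite Rabs_Ropp, Rabs_mult; apply Rmult_le_compat_l; [apply Rabs_pos|].
    apply Rle_trans with (2 := HT), im_le_Cmod. }
  rewrite <- As in Sb.
  assert (3 * M * (Rabs s * Rabs s) <= Rabs s * (Rabs b / 4)).
  { assert (Rabs s * (12 * M) <= Rabs b) by (apply Rle_trans with (2 := D4), Rmult_le_compat_r; lra).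
    replace (3 * M * (Rabs s * Rabs s)) with (Rabs s * (Rabs s * (12 * M)) / 4) by field.
    assert (Rabs s * (Rabs s * (12 * M)) <= Rabs s * Rabs b) by (apply Rmult_le_compat_l; lra).
    lra. }
  assert (0 < Rabs s * Rabs b) by (apply Rmult_lt_0_compat; lra).
  lra.
Qed.

Theorem theorem1p4 :
  exists c0 : R,
    (0 < c0 /\ ReF_zero c0 /\ forall c : R, 0 < c -> ReF_zero c -> c0 <= c) /\
    gamma starlike = Finite (PI * c0 / 4).
Proof.
destruct first_touching as (c0 & Hc0 & Below & Hnn & Np).
assert (P0 := PI_RGT_0).
assert (Zero := ReF_zero_of_touching c0 Hc0 Hnn Np).
assert (In : forall c, 0 < c < c0 -> forall f, class_A1 f -> phi_maps_into f (PI * c / 4) ->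
  starlike f).
{ intros c Hc f; apply starlike_of_gc_positive; [lra|]; apply Below; lra. }
assert (Out : forall c gam, 0 < c -> ReF_zero c -> PI * c / 4 < gam ->
  exists f, class_A1 f /\ phi_maps_into f gam /\ ~ starlike f).
{ intros c gam Hc Z Hg; destruct (ReF_zero_gc c Hc Z) as [R0 N0].
  now apply not_starlike_beyond with c. }
exists c0; split; [split; [easy|split; [easy|]]|].
- intros c Hc Z; apply Rnot_lt_le; intros Lt.
  (* The midpoint gives a strip wider than that of [c], where some function is not starlike, and
     narrower than that of [c0], where all are. *)
  set (c1 := (c + c0) / 2).
  destruct (Out c (PI * c1 / 4) Hc Z) as (f & F1 & F2 & F3); [unfold c1; nra|].
  apply F3, (In c1); auto; unfold c1; lra.
- apply is_lub_Rbar_unique; split.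
  + intros gam [_ Hg]; simpl; apply Rnot_lt_le; intros Lt.
    destruct (Out c0 gam Hc0 Zero Lt) as (f & F1 & F2 & F3); auto.
  + intros m Hm.
    assert (Mem : forall c, 0 < c < c0 -> Rbar_le (PI * c / 4) m).
    { intros c Hc; apply Hm; split; [nra|]; now apply In. }
    destruct m as [m| |]; simpl in *; [|easy|].
    * apply Rnot_lt_le; intros Lt.
      (* A parameter below [c0] with [PI c / 4 > m]; the maximum with [c0 / 2] keeps it positive. *)
      set (c := Rmax (c0 / 2) ((4 * m / PI + c0) / 2)).
      assert (Lm : 4 * m / PI < c0).
      { apply Rmult_lt_reg_l with (PI / 4); [lra|].
        replace (PI / 4 * (4 * m / PI)) with m by (field; lra); lra. }
      assert (C1 : c < c0) by (apply Rmax_lub_lt; lra).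
      assert (C2 : c0 / 2 <= c) by apply Rmax_l.
      assert (C3 : (4 * m / PI + c0) / 2 <= c) by apply Rmax_r.
      assert (X := Mem c ltac:(lra)).
      assert (Y : 4 * m / PI < c) by lra.
      apply (Rmult_lt_compat_l (PI / 4)) in Y; [|lra].
      replace (PI / 4 * (4 * m / PI)) with m in Y by (field; lra); lra.
    * apply (Mem (c0 / 2)); lra.
Qed.
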